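(* Let $a>0$, $\mu>-\frac12$ and $|\arg z|<\pi$. Then the following Stieltjes transform representation is valid: $$e^{-a\sqrt{z}}z^{-\frac{\mu}{2}}I_{\mu}(a\sqrt{z})=\frac{1}{\pi}\int_{0}^{\infty}\frac{t^{-\frac{\mu}{2}}}{z+t}J_{\mu}(a\sqrt{t})\sin(a\sqrt{t})\,dt,$$ which can be rewritten as the two-fold Laplace transform $$e^{-a\sqrt{z}}z^{-\frac{\mu}{2}}I_{\mu}(a\sqrt{z})=\frac{1}{\pi}\int_{0}^{\infty}e^{-zs}\left[\int_{0}^{\infty}e^{-st}t^{-\frac{\mu}{2}}J_{\mu}(a\sqrt{t})\sin(a\sqrt{t})\,dt\right]ds.$$
   Context: $I_\mu$ is the modified Bessel function of the first kind and $J_\mu$ the Bessel function of the first kind, of order $\mu$. The variable $z$ is complex and nonzero; powers, square roots and Bessel functions are taken with their principal branches ($|\arg z|<\pi$).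
   Formalization: The two-fold Laplace form is proved only for nonzero z with Re z ≥ 0: for Re z < 0 the inner integral decays only like s^(-3/2) while e^(-zs) grows exponentially, so the outer integral diverges; the Stieltjes form holds for all |arg z| < π. *)

(* Defs.v *)
(* MathComp-Analysis; complex numbers are [R[i]] from mathcomp-real-closed. *)
From HB Require Import structures.
From mathcomp Require Import all_boot all_order all_algebra.
From mathcomp Require Import complex.
From mathcomp Require Import all_classical all_reals all_analysis.

Set Implicit Arguments.
Unset Strict Implicit.
Unset Printing Implicit Defensive.

Import Order.TTheory GRing.Theory Num.Theory.
Import numFieldNormedType.Exports.

Local Open Scope classical_set_scope.
Local Open Scope complex_scope.
Local Open Scope ring_scope.

(* The modulus as a real number; the norm [`|z|] lives in [R[i]]. *)
Local Notation cabs := ComplexField.Normc.normc.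

(* The argument in ]-pi, pi] (equal to pi on the negative real axis);
   meaningful for [z != 0] only. *)
Definition carg (R : realType) (z : R[i]) : R :=
  if 0 <= complex.Im z then acos (complex.Re z / cabs z)
  else - acos (complex.Re z / cabs z).

Definition cexp (R : realType) (z : R[i]) : R[i] :=
  (expR (complex.Re z))%:C * (cos (complex.Im z) +i* sin (complex.Im z)).

Definition clog (R : realType) (z : R[i]) : R[i] := ln (cabs z) +i* carg z.

(* Principal branch; meaningful for [z != 0] only. *)
Definition cpow (R : realType) (z w : R[i]) : R[i] := cexp (w * clog z).

(* Not MathComp's [sqrtC], whose values have nonnegative imaginary part
   and which therefore differs from the principal root when [Im z < 0]. *)
Definition csqrt (R : realType) (z : R[i]) : R[i] := cpow z (2^-1)%:C.

(* Euler's integral; meaningful for [0 < x] only. *)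
Definition Gamma (R : realType) (x : R) : R :=
  \int[lebesgue_measure]_(t in `]0, +oo[) (t `^ (x - 1) * expR (- t)).

(* Coefficients of the series
     J_mu(x) = (x/2)^mu sum_k (-1)^k (x/2)^(2k) / (k! Gamma(mu+k+1)),
     I_mu(w) = (w/2)^mu sum_k (w/2)^(2k) / (k! Gamma(mu+k+1)).
   As [Gamma] is given by Euler's integral, they are meaningful for [-1 < mu]
   only. *)
Definition bessel_coeff (R : realType) (mu : R) (k : nat) : R :=
  ((k`!)%:R * Gamma (mu + k%:R + 1))^-1.

(* On the positive half-line, where the principal power is [powR]. *)
Definition besselJ (R : realType) (mu x : R) : R :=
  (x / 2) `^ mu *
  limn (series (fun k => (-1) ^+ k * bessel_coeff mu k * (x / 2) ^+ (2 * k))).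

Definition besselI (R : realType) (mu : R) (w : R[i]) : R[i] :=
  cpow (w / 2) mu%:C *
  lim (series (fun k => (bessel_coeff mu k)%:C * (w / 2) ^+ (2 * k) : R[i]^o) @ \oo).

Definition cintegrable (R : realType) (D : set R) (f : R -> R[i]) : Prop :=
  (@lebesgue_measure R).-integrable D (fun t => (complex.Re (f t))%:E) /\
  (@lebesgue_measure R).-integrable D (fun t => (complex.Im (f t))%:E).

Definition cintegral (R : realType) (D : set R) (f : R -> R[i]) : R[i] :=
  (\int[lebesgue_measure]_(t in D) complex.Re (f t)) +i*
  (\int[lebesgue_measure]_(t in D) complex.Im (f t)).

(* Main.v *)
Require Import Defs.
From mathcomp Require Import all_boot all_order all_algebra.
From mathcomp Require Import complex.
From mathcomp Require Import all_classical all_reals all_analysis.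
From mathcomp Require Import measurable_realfun.
From mathcomp Require Import ring lra.
Import Order.TTheory GRing.Theory Num.Theory.
Import numFieldNormedType.Exports.
Local Open Scope classical_set_scope.
Local Open Scope complex_scope.
Local Open Scope ring_scope.

(* Poisson's integral represents [J_mu] and [I_mu] as averages of [cos (x u)]
   and [cosh (w u)] over [0 < u < 1] against the weight
   [(1 - u^2)^(mu - 1/2)], so that everything reduces to a single transform.
   For [z = w^2] with [Re w > 0],
     [S b = int_0^oo sin (b sqrt t) / (t (z + t)) dt = pi / z (1 - e^(- w b))]:
   with [Y = S'] one has [Y' = z S - pi], so that [A = w (S - pi / z) + Y]
   solves [A' = w A]; being at most of linear growth, it vanishes, which is a
   first-order equation for [S].
   As [sin x cos (x u)] is the mean of [sin (x (1 + u))] and [sin (x (1 - u))],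
   averaging over [u] gives the transform of [f t / t], where [f] is the density
   of the theorem; the extra factor [1 / t] is what makes the exchange of
   integrals absolutely convergent.  Letting [z = n^2] tend to infinity then
   gives the integral of [f t / t], and
   [1 / (z + t) = 1 / t - z / (t (z + t))] gives the transform of [f].
   That [f t / t] is integrable at infinity comes from the decay of the cosine
   transform of the weight.  The iterated Laplace integral follows by Fubini
   from [1 / (z + t) = int_0^oo e^(- (z + t) s) ds], dominated by
   [|f t| / t]. *)

Set Implicit Arguments.
Unset Strict Implicit.
Unset Printing Implicit Defensive.

(** * Integration over the half-line and the unit interval *)

Section RFubini.
Context d1 d2 (T1 : measurableType d1) (T2 : measurableType d2) (R : realType).
Variable m1 : {sigma_finite_measure set T1 -> \bar R}.
Variable m2 : {sigma_finite_measure set T2 -> \bar R}.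

Lemma RFubini (A : set T1) (B : set T2) (h : T1 -> T2 -> R) (G : T1 -> R) :
  measurable A -> measurable B ->
  measurable_fun [set: T1 * T2] (fun p : T1 * T2 => h p.1 p.2) ->
  (forall x, A x -> m2.-integrable B (EFin \o h x)) ->
  (forall y, B y -> m1.-integrable A (EFin \o h^~ y)) ->
  (forall x, A x -> \int[m2]_(y in B) `|h x y| <= G x) ->
  m1.-integrable A (EFin \o G) ->
  [/\ m1.-integrable A (EFin \o (fun x => \int[m2]_(y in B) h x y)),
      m2.-integrable B (EFin \o (fun y => \int[m1]_(x in A) h x y)) &
      \int[m1]_(x in A) \int[m2]_(y in B) h x y =
      \int[m2]_(y in B) \int[m1]_(x in A) h x y].
Proof.
move=> mA mB mh hB hA hG Gi.
pose H : T1 * T2 -> \bar R :=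
  EFin \o ((fun p : T1 * T2 => h p.1 p.2) \_ (A `*` B)).
have mAB : measurable (A `*` B) by exact: measurableX.
have mH : measurable_fun setT H.
  apply/measurable_EFinP; apply/measurable_restrict => //.
  by apply: measurable_funS mh.
have HB x : (fun y => H (x, y)) = if x \in A then (EFin \o h x) \_ B else cst 0%E.
  apply/funext => y; rewrite /H/= /patch in_setX/=.
  by case: (x \in A); case: (y \in B).
have HA y : (fun x => H (x, y)) = if y \in B then (EFin \o h^~ y) \_ A else cst 0%E.
  apply/funext => x; rewrite /H/= /patch in_setX/=.
  by case: (y \in B) => /=; case: (x \in A).
have HBi x : (\int[m2]_y H (x, y) =
    ((EFin \o (fun x => \int[m2]_(y in B) h x y)%R) \_ A) x)%E.
  rewrite (HB x) patchE; case: ifPn => xA; last by rewrite integral0.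
  by rewrite -integral_mkcond /= fineK// integrable_fin_num//; exact/hB/set_mem.
have HAi y : (\int[m1]_x H (x, y) =
    ((EFin \o (fun y => \int[m1]_(x in A) h x y)%R) \_ B) y)%E.
  rewrite (HA y) patchE; case: ifPn => yB; last by rewrite integral0.
  by rewrite -integral_mkcond /= fineK// integrable_fin_num//; exact/hA/set_mem.
have iH : (m1 \x m2)%E.-integrable setT H.
  apply/integrable12ltyP => //.
  apply: (@le_lt_trans _ _ (\int[m1]_(x in A) (G x)%:E)%E); last first.
    exact: integrable_lty.
  rewrite [leRHS]integral_mkcond; apply: ge0_le_integral => //.
  - by move=> x _; exact: integral_ge0.
  - have mH' : measurable_fun setT (abse \o H) by exact: measurableT_comp.
    exact: (measurable_fun_fubini_tonelli_F (abse \o H) mH' (fun _ => abse_ge0 _)).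
  - apply/(measurable_restrictT _ _).1 => //; exact: (measurable_int _ Gi).
  - move=> x _; rewrite patchE; case: ifPn => xA; last first.
      have := HB x; rewrite (negbTE xA) => HB0.
      rewrite (eq_integral (cst 0%E)) ?integral0// => y _.
      have -> : H (x, y) = 0%E := congr1 (@^~ y) HB0.
      by rewrite abse0.
    have xA' := set_mem xA.
    rewrite (eq_integral ((abse \o (EFin \o h x)) \_ B)); last first.
      move=> y _; have -> : H (x, y) = ((EFin \o h x) \_ B) y.
        by have := congr1 (@^~ y) (HB x); rewrite xA.
      by rewrite !patchE; case: ifP => //; rewrite abse0.
    rewrite -integral_mkcond.
    have hi : m2.-integrable B (EFin \o (Num.norm \o h x)) by exact/integrable_norm/hB.
    have -> : (\int[m2]_(y in B) (abse \o (EFin \o h x)) y)%E =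
       (\int[m2]_(y in B) `|h x y|)%:E by rewrite /Rintegral fineK// (integrable_fin_num _ hi).
    by rewrite lee_fin hG.
split.
- apply/(integrable_mkcond _ mA).
  by have := integrable_fubini_F iH; apply: eq_integrable => // x _; exact: HBi.
- apply/(integrable_mkcond _ mB).
  apply: (@eq_integrable _ _ _ m2 _ measurableT (fubini_G m1 H)).
    by move=> x _; exact: HAi.
  have mG := measurable_fubini_G iH.
  apply/integrableP; split => //.
  apply: le_lt_trans ((integrable21ltyP m1 m2 mH).1 iH).
  apply: ge0_le_integral => //.
  - exact: measurableT_comp.
  - have mH' : measurable_fun setT (abse \o H) by exact: measurableT_comp.
    exact: (measurable_fun_fubini_tonelli_G (abse \o H) mH' (fun _ => abse_ge0 _)).
  - move=> y _; apply: le_abse_integral => //.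
    exact: measurableT_comp mH (pair2_measurable y).
- rewrite /Rintegral [X in fine X]integral_mkcond [in RHS]integral_mkcond.
  rewrite -(eq_integral _ _ (fun x _ => HBi x)) -(eq_integral _ _ (fun x _ => HAi x)).
  by congr fine; exact: Fubini.
Qed.

End RFubini.

Section RealIntegration.
Context {R : realType}.
Notation mu := (@lebesgue_measure R).
Implicit Types (D : set R) (f g F G : R -> R).

Lemma measurable_invr : measurable_fun [set: R] (fun x : R => x^-1).
Proof.
rewrite -(setvU [set 0 : R]); apply/measurable_funU => //.
  exact: measurableC.
split; last exact: measurable_fun_set1.
apply: open_continuous_measurable_fun.
  by rewrite openC; apply: accessible_closed_set1; exact: hausdorff_accessible.
by move=> x /set_mem/= /eqP x0; exact: inv_continuous.
Qed.

Lemma eq_integral_lebesgue D (f g : R -> \bar R) : (forall x, D x -> f x = g x) ->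
  (\int[mu]_(x in D) f x = \int[mu]_(x in D) g x)%E.
Proof. by move=> fg; apply: eq_integral => x /set_mem/fg. Qed.

Lemma ler_integrable D f g : measurable D -> measurable_fun D f ->
  (forall x, D x -> `|f x| <= g x) -> mu.-integrable D (EFin \o g) ->
  mu.-integrable D (EFin \o f).
Proof.
move=> mD mf fg; apply: le_integrable => //; first exact/measurable_EFinP.
by move=> x Dx; rewrite /= lee_fin (le_trans (fg _ Dx))// ler_norm.
Qed.

Lemma integrable_scale D f k : measurable D -> mu.-integrable D (EFin \o f) ->
  mu.-integrable D (EFin \o (fun x => k * f x)).
Proof.
by move=> mD i; have := @integrableZl _ _ _ mu _ mD k _ i; apply: eq_integrable.
Qed.

Lemma integrable_sub D f g : measurable D -> mu.-integrable D (EFin \o f) ->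
  mu.-integrable D (EFin \o g) -> mu.-integrable D (EFin \o (fun x => f x - g x)).
Proof.
by move=> mD i j; have := @integrableB _ _ _ mu _ mD _ _ i j; apply: eq_integrable.
Qed.

Lemma integrable_add D f g : measurable D -> mu.-integrable D (EFin \o f) ->
  mu.-integrable D (EFin \o g) -> mu.-integrable D (EFin \o (fun x => f x + g x)).
Proof.
by move=> mD i j; have := @integrableD _ _ _ mu _ mD _ _ i j; apply: eq_integrable.
Qed.

Lemma integrable_measurable D f :
  mu.-integrable D (EFin \o f) -> measurable_fun D f.
Proof. by move=> /integrableP[/measurable_EFinP]. Qed.

Lemma Rintegral_gt0 D f : measurable D -> (0 < mu D)%E ->
  mu.-integrable D (EFin \o f) -> (forall x, D x -> 0 < f x) ->
  0 < \int[mu]_(x in D) f x.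
Proof.
move=> mD D0 fi f0; rewrite lt_neqAle Rintegral_ge0 ?andbT; last first.
  by move=> x /f0/ltW.
apply/negP => /eqP I0.
have If0 : (\int[mu]_(x in D) `|(f x)%:E| = 0)%E.
  rewrite (@eq_integral_lebesgue _ _ (EFin \o f)); last first.
    by move=> x /f0/ltW fx; rewrite /= ger0_norm.
  by rewrite -[LHS]fineK ?integrable_fin_num//; exact: (congr1 EFin (esym I0)).
have [N [mN N0 DN]] : ae_eq mu D (EFin \o f) (cst 0%E).
  apply/(ae_eq_integral_abs mu mD) => //.
  exact: (measurable_int _ fi).
have DN' : D `<=` N.
  move=> x Dx; apply: DN => /= /(_ Dx)[] /eqP.
  by rewrite gt_eqF// f0.
have : (mu D <= mu N)%E by rewrite le_measure// inE.
by rewrite N0 leNgt D0.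
Qed.

Lemma Rdominated_cvg D (fn : nat -> R -> R) f g : measurable D ->
  (forall n, measurable_fun D (fn n)) ->
  (forall x, D x -> fn n x @[n --> \oo] --> f x) ->
  mu.-integrable D (EFin \o g) ->
  (forall n x, D x -> `|fn n x| <= g x) ->
  mu.-integrable D (EFin \o f) /\
  \int[mu]_(x in D) fn n x @[n --> \oo] --> \int[mu]_(x in D) f x.
Proof.
move=> mD mfn fnf gi fng.
have mf : measurable_fun D f by exact: (@measurable_fun_cvg _ _ _ D fn).
have [||||fi _ cvgI] := @dominated_convergence _ _ _ mu D mD
  (fun n => EFin \o fn n) (EFin \o f) (EFin \o g) _ _ _ gi.
- by move=> n; apply/measurable_EFinP; exact: mfn.
- by apply/measurable_EFinP.
- by apply: aeW => x Dx; apply: cvg_EFin; [exact: nearW|exact: fnf].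
- by apply: aeW => x n Dx; rewrite lee_fin fng.
split => //; rewrite /Rintegral; apply: fine_cvg.
by rewrite fineK ?integrable_fin_num.
Qed.

Lemma FTC_itv F f (u v : R) : u < v ->
  (forall x : R, u <= x <= v -> is_derive x 1 F (f x)) ->
  (forall x : R, u <= x <= v -> {for x, continuous f}) ->
  (\int[mu]_(x in `[u, v]) (f x)%:E = (F v - F u)%:E)%E.
Proof.
move=> uv dF cf.
have cF (x : R) : u <= x <= v -> {for x, continuous F}.
  move=> /dF dFx; apply: differentiable_continuous; apply/derivable1_diffP.
  exact: ex_derive.
rewrite (@continuous_FTC2 _ f F)//.
- by apply: continuous_in_subspaceT => x; rewrite inE/= in_itv/=; exact: cf.
- split.
  + move=> x; rewrite in_itv/= => /andP[ux xv].
    by have := dF x; rewrite !ltW// => /(_ isT) ?; exact: ex_derive.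
  + by apply: cvg_at_right_filter; apply: cF; rewrite lexx ltW.
  + by apply: cvg_at_left_filter; apply: cF; rewrite lexx ltW.
- move=> x; rewrite in_itv/= => /andP[ux xv].
  have := dF x; rewrite !ltW// => /(_ isT) ?.
  by rewrite derive1E derive_val.
Qed.

Section exhaustion.
Variables (F f : R -> R) (D : set R) (u v : nat -> R) (la lb : R).
Hypothesis mD : measurable D.
Hypothesis uv : forall n, u n < v n.
Hypothesis uvD : forall n x, u n <= x <= v n -> D x.
Hypothesis Duv : forall x, D x -> \forall n \near \oo, u n <= x <= v n.
Hypothesis dF : forall x, D x -> is_derive x 1 F (f x).
Hypothesis cf : forall x, D x -> {for x, continuous f}.
Hypothesis mf : measurable_fun D f.
Hypothesis Fu : F (u n) @[n --> \oo] --> la.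
Hypothesis Fv : F (v n) @[n --> \oo] --> lb.

Let fn n := f \_ `[u n, v n].

Let fn_int n : (\int[mu]_(x in D) (fn n x)%:E = (F (v n) - F (u n))%:E)%E.
Proof.
have <- := @FTC_itv F f (u n) (v n) (uv n) (fun x h => dF (uvD h))
  (fun x h => cf (uvD h)).
rewrite -(setIidr (_ : `[u n, v n]%classic `<=` D)); last first.
  by move=> x /=; rewrite in_itv/=; exact: uvD.
rewrite integral_mkcondr; apply: eq_integral => x _.
by rewrite /fn !patchE; case: ifP.
Qed.

Let mfn n : measurable_fun D (EFin \o fn n).
Proof.
apply/measurable_EFinP; apply/measurable_restrict => //.
by apply: measurable_funS mf => //; exact: subIsetl.
Qed.

Let fn_cvg x : D x -> (fn n x)%:E @[n --> \oo] --> (f x)%:E.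
Proof.
move=> /Duv [N _ HN]; apply: cvg_near_cst.
exists N => // n /= /HN; rewrite /fn patchE => xn.
by rewrite mem_set//= in_itv.
Qed.

Let Fcvg : ((F (v n) - F (u n))%:E @[n --> \oo] --> (lb - la)%:E)%E.
Proof. by apply: cvg_EFin; [exact: nearW|exact: cvgB]. Qed.

Lemma integrable_exhaustion : (forall x, D x -> 0 <= f x) ->
  mu.-integrable D (EFin \o f).
Proof.
move=> f0; apply/integrableP; split; first exact/measurable_EFinP.
rewrite (@eq_integral_lebesgue _ _ (EFin \o f)); last first.
  by move=> x /f0 fx; rewrite /= ger0_norm.
have fn0 n x : D x -> (0 <= (EFin \o fn n) x)%E.
  by move=> Dx; rewrite lee_fin /fn patchE; case: ifP => // _; exact: f0.
have := @fatou _ _ _ mu D mD (fun n => EFin \o fn n) mfn fn0.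
rewrite (@eq_integral_lebesgue _ _ (EFin \o f)); last first.
  by move=> x /fn_cvg/cvg_limn_einf_sup[].
move=> /le_lt_trans; apply.
under eq_fun do rewrite fn_int.
by have [-> _] := cvg_limn_einf_sup Fcvg; rewrite ltry.
Qed.

Lemma Rintegral_exhaustion : mu.-integrable D (EFin \o f) ->
  \int[mu]_(x in D) f x = lb - la.
Proof.
move=> fi.
have [] := @Rdominated_cvg D fn f (Num.norm \o f) mD.
- by move=> n; apply/measurable_EFinP; exact: mfn.
- by move=> x /Duv [N _ HN]; apply: cvg_near_cst; exists N => // n /= /HN;
    rewrite /fn patchE => xn; rewrite mem_set//= in_itv.
- exact: integrable_norm.
- by move=> n x Dx; rewrite /fn patchE; case: ifP => _ /=; rewrite ?normr0.
move=> _; rewrite /Rintegral; under eq_fun do rewrite fn_int.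
by move=> /(cvg_unique _ (cvgB Fv Fu)) <- //; exact: norm_hausdorff.
Qed.

End exhaustion.

Section FTC_0y.
Variables (F f : R -> R) (la lb : R).
Hypothesis dF : forall x : R, 0 < x -> is_derive x 1 F (f x).
Hypothesis cf : forall x : R, 0 < x -> {for x, continuous f}.
Hypothesis F0 : F x @[x --> 0^'+] --> la.
Hypothesis Fy : F x @[x --> +oo] --> lb.

Let u n : R := n.+2%:R^-1.
Let v n : R := n.+2%:R.

Let uv n : u n < v n.
Proof.
by rewrite (@lt_trans _ _ 1)// /u /v ?invf_lt1 ?ltr0n// ltr1n.
Qed.

Let uvD n (x : R) : u n <= x <= v n -> `]0, +oo[%classic x.
Proof.
by rewrite /= in_itv/= andbT => /andP[+ _]; apply: lt_le_trans; rewrite invr_gt0 ltr0n.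
Qed.

Let v_cvg : v n @[n --> \oo] --> +oo.
Proof. by have := @cvgr_idn R; rewrite -(cvg_shiftn 2); under eq_fun do rewrite addn2. Qed.

Let u_cvg : u n @[n --> \oo] --> (0 : R).
Proof. by have := @cvg_harmonic R; rewrite -(cvg_shiftn 1); under eq_fun do rewrite addn1. Qed.

Let Duv (x : R) : `]0, +oo[%classic x -> \forall n \near \oo, u n <= x <= v n.
Proof.
rewrite /= in_itv/= andbT => x0.
have /cvgryPge/(_ x) h1 := v_cvg.
have h2 : \forall n \near \oo, u n <= x by apply: (cvgr_le 0).
by near=> n; apply/andP; split; near: n.
Unshelve. all: by end_near. Qed.

Let dF' (x : R) : `]0, +oo[%classic x -> is_derive x 1 F (f x).
Proof. by rewrite /= in_itv/= andbT; exact: dF. Qed.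

Let cf' (x : R) : `]0, +oo[%classic x -> {for x, continuous f}.
Proof. by rewrite /= in_itv/= andbT; exact: cf. Qed.

Let mf : measurable_fun (`]0, +oo[%classic : set R) f.
Proof.
by apply: open_continuous_measurable_fun => // x; rewrite inE; exact: cf'.
Qed.

Let Fu : F (u n) @[n --> \oo] --> la.
Proof.
by move/cvg_at_rightP : F0; apply; split => // n; rewrite /u invr_gt0 ltr0n.
Qed.

Let Fv : F (v n) @[n --> \oo] --> lb.
Proof. by move/cvg_pinftyP : Fy; apply. Qed.

Lemma integrable_FTC0y : (forall x : R, 0 < x -> 0 <= f x) ->
  mu.-integrable `]0, +oo[ (EFin \o f).
Proof.
move=> f0; apply: (integrable_exhaustion _ uv uvD Duv dF' cf' mf Fu Fv) => //.
by move=> x; rewrite /= in_itv/= andbT; exact: f0.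
Qed.

Lemma Rintegral_FTC0y : mu.-integrable `]0, +oo[ (EFin \o f) ->
  \int[mu]_(x in `]0, +oo[) f x = lb - la.
Proof. exact: (Rintegral_exhaustion _ uv uvD Duv dF' cf' mf Fu Fv). Qed.

End FTC_0y.

Section FTC_01.
Variables (F f : R -> R) (la lb : R).
Hypothesis dF : forall x : R, 0 < x < 1 -> is_derive x 1 F (f x).
Hypothesis cf : forall x : R, 0 < x < 1 -> {for x, continuous f}.
Hypothesis F0 : F x @[x --> 0^'+] --> la.
Hypothesis F1 : F x @[x --> 1^'-] --> lb.

Let u n : R := n.+3%:R^-1.
Let v n : R := 1 - n.+3%:R^-1.

Let uv n : u n < v n.
Proof.
have : 2 / n.+3%:R < 1 :> R by rewrite ltr_pdivrMr ?ltr0n// mul1r ltr_nat.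
by rewrite /u /v; move: (n.+3%:R^-1) => y; lra.
Qed.

Let uvD n (x : R) : u n <= x <= v n -> `]0, 1[%classic x.
Proof.
have u0 : 0 < u n by rewrite invr_gt0 ltr0n.
rewrite /= in_itv/= => /andP[ux xv]; rewrite (lt_le_trans u0)//=.
by rewrite (le_lt_trans xv)// /v ltrBlDr ltrDl.
Qed.

Let u_cvg : u n @[n --> \oo] --> (0 : R).
Proof. by have := @cvg_harmonic R; rewrite -(cvg_shiftn 2); under eq_fun do rewrite addn2. Qed.

Let v_cvg : v n @[n --> \oo] --> (1 : R).
Proof. by rewrite -[X in _ --> X]subr0; apply: cvgB => //; exact: cvg_cst. Qed.

Let Duv (x : R) : `]0, 1[%classic x -> \forall n \near \oo, u n <= x <= v n.
Proof.
rewrite /= in_itv/= => /andP[x0 x1].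
have h1 : \forall n \near \oo, x <= v n by apply: (cvgr_ge 1).
have h2 : \forall n \near \oo, u n <= x by apply: (cvgr_le 0).
by near=> n; apply/andP; split; near: n.
Unshelve. all: by end_near. Qed.

Let dF' (x : R) : `]0, 1[%classic x -> is_derive x 1 F (f x).
Proof. by rewrite /= in_itv/=; exact: dF. Qed.

Let cf' (x : R) : `]0, 1[%classic x -> {for x, continuous f}.
Proof. by rewrite /= in_itv/=; exact: cf. Qed.

Let mf : measurable_fun (`]0, 1[%classic : set R) f.
Proof.
by apply: open_continuous_measurable_fun => // x; rewrite inE; exact: cf'.
Qed.

Let Fu : F (u n) @[n --> \oo] --> la.
Proof.
by move/cvg_at_rightP : F0; apply; split => // n; rewrite /u invr_gt0 ltr0n.
Qed.

Let Fv : F (v n) @[n --> \oo] --> lb.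
Proof.
move/cvg_at_leftP : F1; apply; split => // n.
by rewrite /v ltrBlDr ltrDl invr_gt0 ltr0n.
Qed.

Lemma integrable_FTC01 : (forall x : R, 0 < x < 1 -> 0 <= f x) ->
  mu.-integrable `]0, 1[ (EFin \o f).
Proof.
by move=> f0; apply: (integrable_exhaustion _ uv uvD Duv dF' cf' mf Fu Fv).
Qed.

Lemma Rintegral_FTC01 : mu.-integrable `]0, 1[ (EFin \o f) ->
  \int[mu]_(x in `]0, 1[) f x = lb - la.
Proof. exact: (Rintegral_exhaustion _ uv uvD Duv dF' cf' mf Fu Fv). Qed.

End FTC_01.

End RealIntegration.

(** * Derivatives and elementary integrals *)

Section Derivation.
Context {R : realType}.
Implicit Types (f g : R -> R) (x a b k : R).

Lemma dvt_cst k x : is_derive x 1 (fun _ => k) 0.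
Proof. exact: is_derive_cst. Qed.

Lemma dvt_id x : is_derive x 1 (fun y : R => y) 1.
Proof. exact: is_derive_id. Qed.

Lemma dvtD f g x a b : is_derive x 1 f a -> is_derive x 1 g b ->
  is_derive x 1 (fun y => f y + g y) (a + b).
Proof. by move=> ? ?; exact: is_deriveD. Qed.

Lemma dvtN f x a : is_derive x 1 f a -> is_derive x 1 (fun y => - f y) (- a).
Proof. by move=> ?; exact: is_deriveN. Qed.

Lemma dvtB f g x a b : is_derive x 1 f a -> is_derive x 1 g b ->
  is_derive x 1 (fun y => f y - g y) (a - b).
Proof. by move=> ? ?; exact: is_deriveB. Qed.

Lemma dvtM f g x a b : is_derive x 1 f a -> is_derive x 1 g b ->
  is_derive x 1 (fun y => f y * g y) (a * g x + f x * b).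
Proof.
move=> fa gb; apply: (is_derive_eq (is_deriveM fa gb)).
by rewrite /GRing.scale/= addrC (mulrC a).
Qed.

Lemma dvtZ k f x a : is_derive x 1 f a -> is_derive x 1 (fun y => k * f y) (k * a).
Proof. by move=> fa; have := dvtM (dvt_cst k x) fa; rewrite mul0r add0r. Qed.

Lemma dvtX f n x a : is_derive x 1 f a ->
  is_derive x 1 (fun y => f y ^+ n) (n%:R * f x ^+ n.-1 * a).
Proof.
move=> fa; suff -> : (fun y => f y ^+ n) = f ^+ n by exact: is_deriveX.
by apply/funext => y; rewrite fctE.
Qed.

Lemma dvt_comp f g x a b : is_derive (g x) 1 f a -> is_derive x 1 g b ->
  is_derive x 1 (fun y => f (g y)) (a * b).
Proof. by move=> ? ?; exact: is_derive1_comp. Qed.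

Lemma dvt_powR p g x b : is_derive x 1 g b -> 0 < g x ->
  is_derive x 1 (fun y => g y `^ p) (p * g x `^ (p - 1) * b).
Proof. by move=> gb gx0; exact: dvt_comp (is_derive1_powR p gx0) gb. Qed.

Lemma dvtV f x a : is_derive x 1 f a -> f x != 0 ->
  is_derive x 1 (fun y => (f y)^-1) (- a / f x ^+ 2).
Proof.
move=> fa fx0; apply: (is_derive_eq (is_deriveV fx0 fa)).
by rewrite /GRing.scale/= mulNr mulrC mulNr.
Qed.

Lemma dvt_eq f x a b : is_derive x 1 f a -> a = b -> is_derive x 1 f b.
Proof. by move=> ? <-. Qed.

Lemma dvt_continuous f x a : is_derive x 1 f a -> {for x, continuous f}.
Proof.
move=> fa; apply: differentiable_continuous; apply/derivable1_diffP.
exact: ex_derive.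
Qed.

Lemma dvt_near f g x a : (\forall y \near x, f y = g y) -> is_derive x 1 f a ->
  is_derive x 1 g a.
Proof. exact: near_eq_is_derive. Qed.

End Derivation.

Section Elementary.
Context {R : realType}.
Notation mu := (@lebesgue_measure R).
Notation D0y := (`]0, +oo[%classic : set R).
Notation D01 := (`]0, 1[%classic : set R).
Implicit Types (f g : R -> R) (p q x t c b k : R).

Lemma eq_Rintegrable (D : set R) f g : measurable D -> (forall x, D x -> f x = g x) ->
  mu.-integrable D (EFin \o f) -> mu.-integrable D (EFin \o g).
Proof. by move=> mD fg; apply: eq_integrable => // x /set_mem Dx; rewrite /= fg. Qed.

Lemma in0y t : D0y t -> 0 < t.
Proof. by rewrite /= in_itv/= andbT. Qed.

Lemma in01 t : D01 t -> 0 < t < 1.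
Proof. by rewrite /= in_itv. Qed.

Lemma cvgy_powR p : 0 < p -> x `^ p @[x --> +oo] --> +oo.
Proof.
move=> p0; apply/cvgryPge => A; near=> x.
have Ax : Num.max A 1 `^ p^-1 <= x by near: x; exact: nbhs_pinfty_ge.
have A1 : 0 <= Num.max A 1 by rewrite le_max ler01 orbT.
apply: (@le_trans _ _ ((Num.max A 1 `^ p^-1) `^ p)).
  by rewrite -powRrM mulVf ?gt_eqF// powRr1// le_max lexx.
by apply: ge0_ler_powR => //; rewrite ?nnegrE ?powR_ge0// ?ltW// (le_trans _ Ax)// powR_ge0.
Unshelve. all: by end_near. Qed.

Lemma cvgy_inv f : f x @[x --> +oo] --> +oo -> (f x)^-1 @[x --> +oo] --> (0 : R).
Proof.
move=> fy; apply/(gtr0_cvgV0 (f := f)) => //.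
by move/cvgryPgt : fy; exact.
Qed.

(* The derivative of [- p^-1 / (1 + t^p)]: an integrable majorant with any
   prescribed power behaviour [t^(p - 1)] at [0] and [t^(- p - 1)] at infinity. *)
Lemma integrable_hat p : 0 < p ->
  mu.-integrable D0y (EFin \o (fun t => t `^ (p - 1) / (1 + t `^ p) ^+ 2)).
Proof.
move=> p0.
have d1 t : 0 < t -> is_derive t 1 (fun t => 1 + t `^ p) (p * t `^ (p - 1)).
  by move=> t0; apply: dvt_eq (dvtD (dvt_cst 1 t) (is_derive1_powR p t0)) _; rewrite add0r.
have n0 t : 1 + t `^ p != 0 by rewrite gt_eqF// ltr_pwDl// powR_ge0.
have dF t : 0 < t -> is_derive t 1 (fun t => - (1 + t `^ p)^-1)
    (p * (t `^ (p - 1) / (1 + t `^ p) ^+ 2)).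
  move=> t0; apply: dvt_eq (dvtN (dvtV (d1 t t0) (n0 t))) _.
  by rewrite mulNr opprK mulrA.
have cf t : 0 < t -> {for t, continuous (fun t => p * (t `^ (p - 1) / (1 + t `^ p) ^+ 2))}.
  move=> t0; have n02 : (1 + t `^ p) ^+ 2 != 0 by rewrite expf_neq0.
  exact: dvt_continuous (dvtZ p (dvtM (is_derive1_powR (p - 1) t0)
    (dvtV (dvtX 2 (d1 t t0)) n02))).
have F0 : - (1 + t `^ p)^-1 @[t --> 0^'+] --> (- (1 + 0)^-1 : R).
  apply: cvgN; apply: cvgV; first by rewrite addr0.
  by apply: cvgD; [exact: cvg_cst|exact: powR_cvg0].
have Fy : - (1 + t `^ p)^-1 @[t --> +oo] --> (0 : R).
  rewrite -[X in _ --> X]oppr0; apply: cvgN; apply: cvgy_inv.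
  by apply: ger_cvgy (cvgy_powR p0); apply: nearW => x; rewrite lerDr.
have fi := integrable_FTC0y dF cf F0 Fy.
have : mu.-integrable D0y (EFin \o (fun t => p^-1 * (p * (t `^ (p - 1) / (1 + t `^ p) ^+ 2)))).
  apply: integrable_scale => //; apply: fi => t t0.
  by rewrite mulr_ge0 ?(ltW p0)// divr_ge0 ?powR_ge0// sqr_ge0.
by apply: eq_Rintegrable => // t _; rewrite mulKf ?gt_eqF.
Qed.

Lemma cvgy_sqrt : @Num.sqrt R x @[x --> +oo] --> +oo.
Proof.
apply: cvg_trans (cvgy_powR (_ : 0 < 2^-1)); last by rewrite invr_gt0.
apply: near_eq_cvg; near=> x; rewrite powR12_sqrt//.
Unshelve. all: by end_near. Qed.

Let dF_sqrtK t : 0 < t -> is_derive t 1 (fun t => 2 * atan (Num.sqrt t))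
    ((Num.sqrt t * (1 + t))^-1).
Proof.
move=> t0; apply: dvt_eq (dvtZ 2 (dvt_comp (is_derive1_atan _) (is_derive1_sqrt t0))) _.
rewrite sqr_sqrtr ?ltW// !invfM mulrCA (mulrA 2) divff// mul1r mulrC//.
Qed.

Let cf_sqrtK t : 0 < t -> {for t, continuous (fun t : R => (Num.sqrt t * (1 + t))^-1)}.
Proof.
move=> t0; have s0 : 0 < Num.sqrt t by rewrite sqrtr_gt0.
have n0 : Num.sqrt t * (1 + t) != 0 by rewrite gt_eqF// mulr_gt0// addr_gt0.
exact: dvt_continuous (dvtV (dvtM (is_derive1_sqrt t0) (dvtD (dvt_cst 1 t) (dvt_id t))) n0).
Qed.

Let F0_sqrtK : 2 * atan (@Num.sqrt R t) @[t --> 0^'+] --> (0 : R).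
Proof.
apply: cvg_at_right_filter.
rewrite -[X in _ --> X](_ : 2 * atan (Num.sqrt 0) = 0); last by rewrite sqrtr0 atan0 mulr0.
apply: cvgM; first exact: cvg_cst.
apply: continuous_comp; first exact: sqrt_continuous.
exact: continuous_atan.
Qed.

Let Fy_sqrtK : 2 * atan (@Num.sqrt R t) @[t --> +oo] --> (pi : R).
Proof.
rewrite -[X in _ --> X](_ : 2 * (pi / 2) = pi); last by rewrite mulrC divfK.
apply: cvgM; first exact: cvg_cst.
by apply: cvg_comp cvgy_sqrt _; exact: cvgy_atan.
Qed.

Lemma integrable_sqrtK : mu.-integrable D0y (EFin \o (fun t => (Num.sqrt t * (1 + t))^-1)).
Proof.
apply: integrable_FTC0y dF_sqrtK cf_sqrtK F0_sqrtK Fy_sqrtK _ => t t0.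
by rewrite invr_ge0 mulr_ge0 ?sqrtr_ge0// addr_ge0// ltW.
Qed.

Lemma Rintegral_sqrtK : \int[mu]_(t in D0y) (Num.sqrt t * (1 + t))^-1 = pi.
Proof.
by rewrite (Rintegral_FTC0y dF_sqrtK cf_sqrtK F0_sqrtK Fy_sqrtK integrable_sqrtK) subr0.
Qed.

Lemma integrable_onem_powR p : - 1 < p ->
  mu.-integrable D01 (EFin \o (fun u => (1 - u) `^ p)).
Proof.
move=> p1; have q0 : 0 < p + 1 by rewrite -ltrBlDr sub0r.
have d1 (u : R) : is_derive u 1 (fun u : R => 1 - u) (- 1).
  by apply: dvt_eq (dvtB (dvt_cst 1 u) (dvt_id u)) _; rewrite sub0r.
have dF (u : R) : 0 < u < 1 -> is_derive u 1 (fun u => - (p + 1)^-1 * (1 - u) `^ (p + 1))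
    ((1 - u) `^ p).
  move=> /andP[_ u1]; have u0 : 0 < 1 - u by rewrite subr_gt0.
  apply: dvt_eq (dvtZ (- (p + 1)^-1) (dvt_powR (p + 1) (d1 u) u0)) _.
  by rewrite mulrN1 mulrNN mulrA mulVf ?gt_eqF// mul1r addrK.
have cf (u : R) : 0 < u < 1 -> {for u, continuous (fun u : R => (1 - u) `^ p)}.
  move=> /andP[_ u1]; have u0 : 0 < 1 - u by rewrite subr_gt0.
  exact: dvt_continuous (dvt_powR p (d1 u) u0).
apply: (integrable_FTC01 dF cf (la := - (p + 1)^-1 * (1 - 0) `^ (p + 1)) (lb := 0)).
- apply: cvg_at_right_filter; have u0 : 0 < 1 - 0 :> R by rewrite subr0.
  exact: dvt_continuous (dvtZ (- (p + 1)^-1) (dvt_powR (p + 1) (d1 0) u0)).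
- rewrite -[X in _ --> X](mulr0 (- (p + 1)^-1)); apply: cvgM; first exact: cvg_cst.
  apply/cvg_at_leftP => u [u1 ucvg].
  have /cvg_at_rightP := powR_cvg0 q0; apply; split; first by move=> n; rewrite subr_gt0.
  by rewrite -[X in _ --> X](subrr 1); apply: cvgB => //; exact: cvg_cst.
- by move=> u _; exact: powR_ge0.
Qed.

Lemma cvgy_expRNM p : 0 < p -> expR (- (p * t)) @[t --> +oo] --> (0 : R).
Proof.
move=> p0; apply: (@cvg_comp _ _ _ _ (@expR R \o -%R) _ (pinfty_nbhs R)); last exact: cvgr_expR.
by apply: gt0_cvgMry => //; exact: cvg_id.
Qed.

Lemma dvt_expRNM p t : is_derive t 1 (fun t => expR (- (p * t))) (- p * expR (- (p * t))).
Proof.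
apply: dvt_eq (dvt_comp (is_derive_expR _) (dvtN (dvtZ p (dvt_id t)))) _.
by rewrite mulr1 mulrC.
Qed.

Lemma dvt_cosM q t : is_derive t 1 (fun t => cos (q * t)) (- q * sin (q * t)).
Proof.
by apply: dvt_eq (dvt_comp (is_derive_cos _) (dvtZ q (dvt_id t))) _; rewrite mulr1 !mulNr mulrC.
Qed.

Lemma dvt_sinM q t : is_derive t 1 (fun t => sin (q * t)) (q * cos (q * t)).
Proof.
by apply: dvt_eq (dvt_comp (is_derive_sin _) (dvtZ q (dvt_id t))) _; rewrite mulr1 mulrC.
Qed.

Lemma integrable_expRNM p : 0 < p -> mu.-integrable D0y (EFin \o (fun t => expR (- (p * t)))).
Proof.
move=> p0.
have dF t : 0 < t -> is_derive t 1 (fun t => - p^-1 * expR (- (p * t))) (expR (- (p * t))).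
  move=> _; apply: dvt_eq (dvtZ (- p^-1) (dvt_expRNM p t)) _.
  by rewrite mulrA mulrNN mulVf ?gt_eqF// mul1r.
apply: (integrable_FTC0y dF _ (la := - p^-1 * expR (- (p * 0))) (lb := - p^-1 * 0)).
- by move=> t _; exact: dvt_continuous (dvt_expRNM p t).
- by apply: cvg_at_right_filter; exact: dvt_continuous (dvtZ (- p^-1) (dvt_expRNM p 0)).
- by apply: cvgM; [exact: cvg_cst|exact: cvgy_expRNM].
- by move=> t _; exact: expR_ge0.
Qed.

Lemma cvgy_expRNM_bounded p f k : 0 < p -> (forall t, `|f t| <= k) ->
  expR (- (p * t)) * f t @[t --> +oo] --> (0 : R).
Proof.
move=> p0 fk; apply: norm_cvg0.
apply: (@squeeze_cvgr _ _ _ _ (cst 0) (fun t => expR (- (p * t)) * k)).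
- apply: nearW => t; rewrite normr_ge0 normrM ger0_norm ?expR_ge0//=.
  by rewrite ler_wpM2l ?expR_ge0.
- exact: cvg_cst.
- by rewrite -[X in _ --> X](mul0r k); apply: cvgM; [exact: cvgy_expRNM|exact: cvg_cst].
Qed.

Lemma measurable_cosR : measurable_fun [set: R] (@cos R).
Proof. by apply: continuous_measurable_fun; exact: continuous_cos. Qed.

Lemma measurable_sinR : measurable_fun [set: R] (@sin R).
Proof. by apply: continuous_measurable_fun; exact: continuous_sin. Qed.

Lemma measurable_sqrtR : measurable_fun [set: R] (@Num.sqrt R).
Proof. by apply: continuous_measurable_fun; exact: sqrt_continuous. Qed.

Lemma integrable_expRNM_bounded p f k : 0 < p -> measurable_fun [set: R] f ->
  (forall t, `|f t| <= k) ->
  mu.-integrable D0y (EFin \o (fun t => expR (- (p * t)) * f t)).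
Proof.
move=> p0 mf fk.
apply: (@ler_integrable _ _ _ (fun t => k * expR (- (p * t)))) => //.
- apply: measurable_funTS; apply: measurable_funM => //.
  apply: measurableT_comp => //; apply: measurable_funN.
  exact: measurable_funM.
- move=> t _; rewrite normrM ger0_norm ?expR_ge0// mulrC.
  by rewrite ler_wpM2r ?expR_ge0.
- by apply: integrable_scale => //; exact: integrable_expRNM.
Qed.

Lemma Rintegral_expR_cos p q : 0 < p ->
  \int[mu]_(t in D0y) (expR (- (p * t)) * cos (q * t)) = p / (p ^+ 2 + q ^+ 2).
Proof.
move=> p0; have s0 : p ^+ 2 + q ^+ 2 != 0 by rewrite gt_eqF// ltr_pwDl ?exprn_gt0// sqr_ge0.
have dc t := dvtM (dvt_expRNM p t) (dvt_cosM q t).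
have dF0 t := dvtZ (p ^+ 2 + q ^+ 2)^-1 (dvtM (dvt_expRNM p t)
  (dvtB (dvtZ q (dvt_sinM q t)) (dvtZ p (dvt_cosM q t)))).
have dE t : (p ^+ 2 + q ^+ 2)^-1 * (- p * expR (- (p * t)) * (q * sin (q * t) - p * cos (q * t)) + expR (- (p * t)) * (q * (q * cos (q * t)) - p * (- q * sin (q * t)))) = expR (- (p * t)) * cos (q * t) by field.
have dF (t : R) (_ : 0 < t) := dvt_eq (dF0 t) (dE t).
rewrite (Rintegral_FTC0y dF (la := - (p / (p ^+ 2 + q ^+ 2))) (lb := 0)) ?sub0r ?opprK//.
- by move=> t _; exact: dvt_continuous (dc t).
- apply: cvg_at_right_filter.
  rewrite -[X in _ --> X](_ : (p ^+ 2 + q ^+ 2)^-1 * (expR (- (p * 0)) *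
    (q * sin (q * 0) - p * cos (q * 0))) = - (p / (p ^+ 2 + q ^+ 2))).
    exact: dvt_continuous (dF0 0).
  by rewrite !mulr0 oppr0 expR0 sin0 cos0; field.
- rewrite -[X in _ --> X](mulr0 (p ^+ 2 + q ^+ 2)^-1); apply: cvgM; first exact: cvg_cst.
  apply: (@cvgy_expRNM_bounded _ _ (`|q| + `|p|)) => // t.
  rewrite (le_trans (ler_normB _ _))// lerD// normrM ler_piMr//.
    exact: sin_max.
  exact: cos_max.
- apply: (@integrable_expRNM_bounded _ _ 1) => //.
  + by apply: measurableT_comp measurable_cosR _; exact: measurable_funM.
  + by move=> t; exact: cos_max.
Qed.

Lemma Rintegral_expR_sin p q : 0 < p ->
  \int[mu]_(t in D0y) (expR (- (p * t)) * sin (q * t)) = q / (p ^+ 2 + q ^+ 2).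
Proof.
move=> p0; have s0 : p ^+ 2 + q ^+ 2 != 0 by rewrite gt_eqF// ltr_pwDl ?exprn_gt0// sqr_ge0.
have dc t := dvtM (dvt_expRNM p t) (dvt_sinM q t).
have dF0 t := dvtZ (- (p ^+ 2 + q ^+ 2)^-1) (dvtM (dvt_expRNM p t)
  (dvtD (dvtZ p (dvt_sinM q t)) (dvtZ q (dvt_cosM q t)))).
have dE t : - (p ^+ 2 + q ^+ 2)^-1 * (- p * expR (- (p * t)) * (p * sin (q * t) + q * cos (q * t)) + expR (- (p * t)) * (p * (q * cos (q * t)) + q * (- q * sin (q * t)))) = expR (- (p * t)) * sin (q * t) by field.
have dF (t : R) (_ : 0 < t) := dvt_eq (dF0 t) (dE t).
rewrite (Rintegral_FTC0y dF (la := - (q / (p ^+ 2 + q ^+ 2))) (lb := 0)) ?sub0r ?opprK//.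
- by move=> t _; exact: dvt_continuous (dc t).
- apply: cvg_at_right_filter.
  rewrite -[X in _ --> X](_ : - (p ^+ 2 + q ^+ 2)^-1 * (expR (- (p * 0)) *
    (p * sin (q * 0) + q * cos (q * 0))) = - (q / (p ^+ 2 + q ^+ 2))).
    exact: dvt_continuous (dF0 0).
  by rewrite !mulr0 oppr0 expR0 sin0 cos0; field.
- rewrite -[X in _ --> X](mulr0 (- (p ^+ 2 + q ^+ 2)^-1)); apply: cvgM; first exact: cvg_cst.
  apply: (@cvgy_expRNM_bounded _ _ (`|p| + `|q|)) => // t.
  rewrite (le_trans (ler_normD _ _))// lerD// normrM ler_piMr//.
    exact: sin_max.
  exact: cos_max.
- apply: (@integrable_expRNM_bounded _ _ 1) => //.
  + by apply: measurableT_comp measurable_sinR _; exact: measurable_funM.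
  + by move=> t; exact: sin_max.
Qed.

Section scaling.
Variables (c : R).
Hypothesis c0 : 0 < c.

Let scale : measurableTypeR R -> measurableTypeR R := fun x => c * x.

Let mscale : measurable_fun setT scale.
Proof. exact: measurable_funM. Qed.

Let k : {nonneg R} := NngNum (ltW c0).

Let c0' : 0 <= c^-1. Proof. by rewrite invr_ge0 ltW. Qed.

Let k' : {nonneg R} := NngNum c0'.

Let pm : {measure set (measurableTypeR R) -> \bar R} :=
  measure_function_pushforward__canonical__measure_function_Measure mu mscale.

Let lebesgue_scale (A : set R) : measurable A ->
  pushforward mu scale A = measure_function.mscale k' mu A.
Proof.
move=> mA; suff muE : mu A = measure_function.mscale k pm A.
  transitivity ((c^-1)%:E * (c%:E * pushforward mu scale A))%E.
    by rewrite muleA -EFinM mulVf ?gt_eqF// mul1e.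
  by congr mule; exact/esym.
apply: (@lebesgue_measure_unique _ (measure_function.mscale k pm)) => //.
move=> _ [[a b]] _ <-.
rewrite [RHS](_ : _ = (c%:E * mu (scale @^-1` `]a, b]%classic))%E)//.
rewrite (_ : scale @^-1` _ = `]c^-1 * a, c^-1 * b]%classic); last first.
  apply/seteqP; split => x /=; rewrite !in_itv/= /scale.
    by rewrite ltr_pdivrMl// ler_pdivlMl.
  by rewrite ltr_pdivrMl// ler_pdivlMl.
rewrite !lebesgue_measure_itv/= !lte_fin ltr_pM2l ?invr_gt0//.
case: ifPn => _; last by rewrite mule0.
by rewrite -!EFinB -EFinM; congr EFin; field; rewrite gt_eqF.
Qed.

Lemma Rintegral_scale f : measurable_fun D0y f -> (forall t, 0 < t -> 0 <= f t) ->
  \int[mu]_(t in D0y) f (c * t) = c^-1 * \int[mu]_(t in D0y) f t.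
Proof.
move=> mf f0.
have f0' t : D0y t -> (0%:E <= (f t)%:E)%E by rewrite lee_fin => /in0y/f0.
have -> : c^-1 * \int[mu]_(t in D0y) f t =
    fine ((c^-1)%:E * \int[mu]_(t in D0y) (f t)%:E)%E.
  rewrite /Rintegral; have [->|I0] := eqVneq (\int[mu]_(t in D0y) (f t)%:E)%E +oo%E.
    by rewrite /= mulr0 gt0_muley// lte_fin invr_gt0.
  by rewrite fineM// fin_num_abs gee0_abs ?integral_ge0// ltey.
have <- : (\int[measure_function.mscale k' mu]_(x in D0y) (f x)%:E =
    (c^-1)%:E * \int[mu]_(t in D0y) (f t)%:E)%E.
  apply: ge0_integral_mscale => //; exact/measurable_EFinP.
have <- : (\int[pushforward mu scale]_(x in D0y) (f x)%:E =
    \int[measure_function.mscale k' mu]_(x in D0y) (f x)%:E)%E.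
  by apply: eq_measure_integral => A mA _; exact: lebesgue_scale.
have -> : (\int[pushforward mu scale]_(x in D0y) (f x)%:E =
    \int[mu]_(x in scale @^-1` D0y) ((EFin \o f) \o scale) x)%E.
  apply: ge0_integral_pushforward => //; first exact/measurable_EFinP.
  by move=> t /set_mem; exact: f0'.
rewrite (_ : scale @^-1` _ = D0y)//.
apply/seteqP; split => x /=; rewrite !in_itv/= /scale !andbT.
  by rewrite pmulr_rgt0.
by rewrite pmulr_rgt0.
Qed.

End scaling.

End Elementary.

(** * Complex exponential, logarithm and integrals *)

Section ComplexTools.
Context {R : realType}.
Notation mu := (@lebesgue_measure R).
Notation Re := complex.Re.
Notation Im := complex.Im.
Notation cabs := ComplexField.Normc.normc.
Implicit Types (z w k : R[i]) (F G : R -> R[i]).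

Lemma complex_ext z w : Re z = Re w -> Im z = Im w -> z = w.
Proof. by case: z => a b; case: w => c d /= -> ->. Qed.

Lemma Re_mul z w : Re (z * w) = Re z * Re w - Im z * Im w.
Proof. by case: z => a b; case: w. Qed.

Lemma Im_mul z w : Im (z * w) = Re z * Im w + Im z * Re w.
Proof. by case: z => a b; case: w. Qed.

Lemma Re_add z w : Re (z + w) = Re z + Re w.
Proof. by case: z => a b; case: w. Qed.

Lemma Im_add z w : Im (z + w) = Im z + Im w.
Proof. by case: z => a b; case: w. Qed.

Lemma Re_opp z : Re (- z) = - Re z. Proof. by case: z. Qed.

Lemma Im_opp z : Im (- z) = - Im z. Proof. by case: z. Qed.

Lemma Re_sub z w : Re (z - w) = Re z - Re w. Proof. by rewrite Re_add Re_opp. Qed.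

Lemma Im_sub z w : Im (z - w) = Im z - Im w. Proof. by rewrite Im_add Im_opp. Qed.

Lemma Re_scale (a : R) z : Re (a%:C * z) = a * Re z.
Proof. by rewrite Re_mul /= mul0r subr0. Qed.

Lemma Im_scale (a : R) z : Im (a%:C * z) = a * Im z.
Proof. by rewrite Im_mul /= mul0r addr0. Qed.

Lemma Re_inv z : Re z^-1 = Re z / (Re z ^+ 2 + Im z ^+ 2).
Proof. by case: z. Qed.

Lemma Im_inv z : Im z^-1 = - Im z / (Re z ^+ 2 + Im z ^+ 2).
Proof. by case: z => a b /=; rewrite mulNr. Qed.

Definition ReImE := (Re_mul, Im_mul, Re_sub, Im_sub, Re_add, Im_add, Re_opp, Im_opp).

Lemma sqr_cabs z : cabs z ^+ 2 = Re z ^+ 2 + Im z ^+ 2.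
Proof. by case: z => a b /=; rewrite sqr_sqrtr// addr_ge0// sqr_ge0. Qed.

Lemma cabs_ge0 z : 0 <= cabs z.
Proof. by case: z => a b; exact: sqrtr_ge0. Qed.

Lemma cabs_gt0 z : z != 0 -> 0 < cabs z.
Proof.
move=> z0; rewrite lt_neqAle cabs_ge0 andbT eq_sym.
by apply: contra_neq z0 => /ComplexField.Normc.eq0_normc.
Qed.

Lemma cabsM z w : cabs (z * w) = cabs z * cabs w.
Proof. exact: ComplexField.Normc.normcM. Qed.

Lemma cabsV z : cabs z^-1 = (cabs z)^-1.
Proof. exact: ComplexField.Normc.normcV. Qed.

Lemma cabs_real (a : R) : cabs a%:C = `|a|.
Proof. by rewrite /= expr0n addr0 sqrtr_sqr. Qed.

Lemma Re_le_cabs z : `|Re z| <= cabs z.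
Proof.
by case: z => a b; rewrite -sqrtr_sqr ler_sqrt ?addr_ge0 ?sqr_ge0// lerDl sqr_ge0.
Qed.

Lemma Im_le_cabs z : `|Im z| <= cabs z.
Proof.
by case: z => a b; rewrite -sqrtr_sqr ler_sqrt ?addr_ge0 ?sqr_ge0// lerDr sqr_ge0.
Qed.

Lemma cabs_le_ReIm z : cabs z <= `|Re z| + `|Im z|.
Proof.
rewrite -ler_sqr ?nnegrE ?cabs_ge0 ?addr_ge0//.
rewrite sqr_cabs -(real_normK (num_real (Re z))) -(real_normK (num_real (Im z))).
by rewrite sqrrD lerD2r// lerDl mulrn_wge0// mulr_ge0.
Qed.

Lemma cexpD z w : cexp (z + w) = cexp z * cexp w.
Proof.
case: z => a b; case: w => c d; apply: complex_ext; rewrite /cexp/= !(expRD, cosD, sinD).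
  by ring.
by ring.
Qed.

Lemma Re_cexp z : Re (cexp z) = expR (Re z) * cos (Im z).
Proof. by rewrite /cexp Re_scale. Qed.

Lemma Im_cexp z : Im (cexp z) = expR (Re z) * sin (Im z).
Proof. by rewrite /cexp Im_scale. Qed.

Lemma cexp0 : cexp 0 = 1 :> R[i].
Proof. by apply: complex_ext; rewrite ?Re_cexp ?Im_cexp /= expR0 ?cos0 ?sin0 ?mulr0 ?mulr1. Qed.

Lemma cexp_mulN z : cexp z * cexp (- z) = 1.
Proof. by rewrite -cexpD subrr cexp0. Qed.

Lemma cexp_neq0 z : cexp z != 0.
Proof.
apply/eqP => e0; have := cexp_mulN z.
by rewrite e0 mul0r => /esym/eqP; rewrite oner_eq0.
Qed.

Lemma cexp_real (a : R) : cexp a%:C = (expR a)%:C.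
Proof. by apply: complex_ext; rewrite ?Re_cexp ?Im_cexp /= ?cos0 ?sin0 ?mulr0 ?mulr1. Qed.

Lemma cabs_cexp z : cabs (cexp z) = expR (Re z).
Proof.
apply/eqP; rewrite -(eqrXn2 (n := 2))// ?cabs_ge0 ?expR_ge0// sqr_cabs Re_cexp Im_cexp.
by rewrite !exprMn -mulrDr cos2Dsin2 mulr1.
Qed.

Lemma cexp_clog z : z != 0 -> cexp (clog z) = z.
Proof.
move=> z0; have n0 := cabs_gt0 z0.
have h : -1 <= Re z / cabs z <= 1.
  rewrite -ler_norml normrM normfV (ger0_norm (cabs_ge0 z)).
  by rewrite ler_pdivrMr ?cabs_gt0// mul1r Re_le_cabs.
have cE : cos (carg z) = Re z / cabs z.
  by rewrite /carg; case: ifPn => _; rewrite ?cosN acosK// in_itv.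
have sE : sin (carg z) = Im z / cabs z.
  have sq : Num.sqrt (1 - (Re z / cabs z) ^+ 2) = `|Im z| / cabs z.
    rewrite -[RHS]ger0_norm ?divr_ge0 ?cabs_ge0// -sqrtr_sqr; congr Num.sqrt.
    rewrite !exprMn real_normK ?num_real// !exprVn sqr_cabs.
    have : Re z ^+ 2 + Im z ^+ 2 != 0 by rewrite -sqr_cabs expf_neq0// gt_eqF.
    by move=> ?; field.
  rewrite /carg; case: ifPn => iz; rewrite ?sinN sin_acos// sq.
    by rewrite ger0_norm.
  by rewrite ltr0_norm ?ltNge// mulNr opprK.
apply: complex_ext; rewrite ?Re_cexp ?Im_cexp /clog/= lnK ?posrE// ?cE ?sE mulrC divfK// gt_eqF//.
Qed.

Lemma clog_cexp z : - pi < Im z <= pi -> clog (cexp z) = z.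
Proof.
move=> /andP[z1 z2]; have e0 := expR_gt0 (Re z).
apply: complex_ext; first by rewrite -[LHS]/(ln (cabs (cexp z))) cabs_cexp expRK.
rewrite -[LHS]/(carg (cexp z)).
rewrite /carg cabs_cexp Re_cexp Im_cexp pmulr_rge0// mulrAC mulfV ?gt_eqF// mul1r.
have [i0|i0] := leP 0 (Im z).
  by rewrite sin_ge0_pi ?i0 ?z2// cosK// in_itv/= i0 z2.
rewrite ifF; first by rewrite cosKN ?opprK// (ltW z1) ltW.
apply/negbTE; rewrite -ltNge -oppr_gt0 -sinN sin_gt0_pi// oppr_gt0 i0/=.
by rewrite ltrNl.
Qed.

Lemma csqrtE z : csqrt z = cexp ((2^-1)%:C * clog z). Proof. by []. Qed.

Lemma sqr_csqrt z : z != 0 -> csqrt z ^+ 2 = z.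
Proof.
move=> z0; rewrite csqrtE expr2 -cexpD -mulrDl -[RHS]cexp_clog//; congr cexp.
by apply: complex_ext; rewrite ?Re_scale ?Im_scale ReImE /= ?addr0 ?mul0r ?subr0 ?addr0; field.
Qed.

Lemma Re_csqrt_gt0 z : `|carg z| < pi -> 0 < Re (csqrt z).
Proof.
move=> hz; rewrite csqrtE Re_cexp mulr_gt0 ?expR_gt0// cos_gt0_pihalf// Im_scale /=.
by move: hz; rewrite ltr_norml => /andP[]; lra.
Qed.

Definition is_cderive F (x : R) (l : R[i]) :=
  is_derive x 1 (fun y => Re (F y)) (Re l) /\ is_derive x 1 (fun y => Im (F y)) (Im l).

Lemma cdvtM F G (x : R) z w : is_cderive F x z -> is_cderive G x w ->
  is_cderive (fun y => F y * G y) x (z * G x + F x * w).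
Proof.
move=> [a b] [c d]; split.
  have -> : (fun y => Re (F y * G y)) = (fun y => Re (F y) * Re (G y) - Im (F y) * Im (G y)).
    by apply/funext => y; rewrite Re_mul.
  by apply: dvt_eq (dvtB (dvtM a c) (dvtM b d)) _; rewrite !ReImE; ring.
have -> : (fun y => Im (F y * G y)) = (fun y => Re (F y) * Im (G y) + Im (F y) * Re (G y)).
  by apply/funext => y; rewrite Im_mul.
by apply: dvt_eq (dvtD (dvtM a d) (dvtM b c)) _; rewrite !ReImE; ring.
Qed.

Lemma cdvtD (F G : R -> R[i]) (x : R) (y z : R[i]) :
  is_cderive F x y -> is_cderive G x z -> is_cderive (fun u => F u + G u) x (y + z).
Proof.
move=> [a b] [c d]; split.
  by under eq_fun do rewrite Re_add; rewrite Re_add; exact: dvtD.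
by under eq_fun do rewrite Im_add; rewrite Im_add; exact: dvtD.
Qed.

Lemma cdvt_cst (x : R) (y : R[i]) : is_cderive (fun=> y) x 0.
Proof. by split; exact: dvt_cst. Qed.

Lemma cdvtZ (F : R -> R[i]) (x : R) (y z : R[i]) :
  is_cderive F x z -> is_cderive (fun u => y * F u) x (y * z).
Proof. by move=> dF; have := cdvtM (cdvt_cst x y) dF; rewrite mul0r add0r. Qed.

Lemma cdvt_cexp w (x : R) :
  is_cderive (fun y => cexp (w * y%:C)) x (w * cexp (w * x%:C)).
Proof.
have rE y : Re (w * y%:C) = Re w * y by rewrite mulrC Re_scale mulrC.
have iE y : Im (w * y%:C) = Im w * y by rewrite mulrC Im_scale mulrC.
have de := dvt_comp (is_derive_expR _) (dvtZ (Re w) (dvt_id x)).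
split.
  have -> : (fun y => Re (cexp (w * y%:C))) = (fun y => expR (Re w * y) * cos (Im w * y)).
    by apply/funext => y; rewrite Re_cexp rE iE.
  by apply: dvt_eq (dvtM de (dvt_cosM (Im w) x)) _; rewrite Re_mul Re_cexp Im_cexp rE iE; ring.
have -> : (fun y => Im (cexp (w * y%:C))) = (fun y => expR (Re w * y) * sin (Im w * y)).
  by apply/funext => y; rewrite Im_cexp rE iE.
by apply: dvt_eq (dvtM de (dvt_sinM (Im w) x)) _; rewrite Im_mul Re_cexp Im_cexp rE iE; ring.
Qed.

Lemma is_derive_0_cst_gt0 (f : R -> R) (b c : R) :
  (forall x : R, 0 < x -> is_derive x 1 f 0) -> 0 < b -> 0 < c -> f b = f c.
Proof.
move=> df; wlog bc : b c / b < c.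
  move=> H b0 c0; have [bc|cb|->//] := ltgtP b c; first exact: H.
  by apply/esym; exact: H.
move=> b0 c0.
have df' (x : R) : x \in `]b, c[ -> is_derive x 1 f 0.
  by rewrite in_itv/= => /andP[bx _]; apply: df; rewrite (lt_trans b0).
have cf : {within `[b, c], continuous f}.
  apply: continuous_in_subspaceT => x; rewrite inE/= in_itv/= => /andP[bx _].
  by apply: (dvt_continuous (a := 0)); apply: df; rewrite (lt_le_trans b0).
have [x _] := MVT bc df' cf.
by rewrite mul0r => /eqP; rewrite subr_eq0 => /eqP.
Qed.

Lemma cderive_expM F w : (forall x : R, 0 < x -> is_cderive F x (w * F x)) ->
  forall b c : R, 0 < b -> 0 < c ->
  F b * cexp (- w * b%:C) = F c * cexp (- w * c%:C).
Proof.
move=> dF b c b0 c0.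
have dG (x : R) : 0 < x -> is_cderive (fun y => F y * cexp (- w * y%:C)) x 0.
  move=> x0; have := cdvtM (dF x x0) (cdvt_cexp (- w) x).
  by congr is_cderive; ring.
by apply: complex_ext; apply: (is_derive_0_cst_gt0 (f := fun y => _ (F y * cexp (- w * y%:C)))) => //
  x /dG[].
Qed.

Lemma cintegrable_eq (D : set R) F G : measurable D -> (forall t, D t -> F t = G t) ->
  cintegrable D F -> cintegrable D G.
Proof.
by move=> mD FG [h1 h2]; split;
  [apply: eq_Rintegrable mD _ h1|apply: eq_Rintegrable mD _ h2] => t Dt; rewrite FG.
Qed.

Lemma cintegral_eq (D : set R) F G : (forall t, D t -> F t = G t) ->
  cintegral D F = cintegral D G.
Proof.
by move=> FG; rewrite /cintegral; congr Complex; apply: eq_Rintegral => t /set_mem Dt;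
  rewrite FG.
Qed.

Lemma Re_cintegral (D : set R) F : Re (cintegral D F) = \int[mu]_(t in D) Re (F t).
Proof. by []. Qed.

Lemma Im_cintegral (D : set R) F : Im (cintegral D F) = \int[mu]_(t in D) Im (F t).
Proof. by []. Qed.

Lemma cintegrable_le (D : set R) F (g : R -> R) : measurable D ->
  measurable_fun D (fun t => Re (F t)) -> measurable_fun D (fun t => Im (F t)) ->
  (forall t, D t -> cabs (F t) <= g t) -> mu.-integrable D (EFin \o g) ->
  cintegrable D F.
Proof.
move=> mD mr mi Fg gi; split; apply: (ler_integrable mD _ _ gi) => // t Dt;
  apply: le_trans (Fg t Dt); [exact: Re_le_cabs|exact: Im_le_cabs].
Qed.

Lemma cintegrableB (D : set R) F G : measurable D -> cintegrable D F -> cintegrable D G ->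
  cintegrable D (fun t => F t - G t).
Proof.
move=> mD [a b] [c d]; split.
  by apply: eq_Rintegrable mD _ (integrable_sub mD a c) => t _; rewrite Re_sub.
by apply: eq_Rintegrable mD _ (integrable_sub mD b d) => t _; rewrite Im_sub.
Qed.

Lemma cintegralB (D : set R) F G : measurable D -> cintegrable D F -> cintegrable D G ->
  cintegral D (fun t => F t - G t) = cintegral D F - cintegral D G.
Proof.
move=> mD [a b] [c d]; apply: complex_ext; rewrite ?Re_sub ?Im_sub /= -RintegralB//;
  by apply: eq_Rintegral => t _; rewrite ?Re_sub ?Im_sub.
Qed.

Lemma cintegrableZ (D : set R) k F : measurable D -> cintegrable D F ->
  cintegrable D (fun t => k * F t).
Proof.
move=> mD [a b]; split.
  apply: eq_Rintegrable mD _ (integrable_sub mD (integrable_scale (Re k) mD a)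
    (integrable_scale (Im k) mD b)) => t _; by rewrite Re_mul.
apply: eq_Rintegrable mD _ (integrable_add mD (integrable_scale (Re k) mD b)
    (integrable_scale (Im k) mD a)) => t _; by rewrite Im_mul.
Qed.

Lemma cintegralZ (D : set R) k F : measurable D -> cintegrable D F ->
  cintegral D (fun t => k * F t) = k * cintegral D F.
Proof.
move=> mD [a b]; apply: complex_ext; rewrite ?Re_mul ?Im_mul /=.
  rewrite -!RintegralZl// -RintegralB//; try exact: integrable_scale.
  by apply: eq_Rintegral => t _; rewrite Re_mul.
rewrite -!RintegralZl// -RintegralD//; try exact: integrable_scale.
by apply: eq_Rintegral => t _; rewrite Im_mul.
Qed.

Lemma cvg_complex (u : nat -> R[i]) (l : R[i]) :
  Re (u n) @[n --> \oo] --> Re l -> Im (u n) @[n --> \oo] --> Im l ->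
  lim ((u : nat -> R[i]^o) @ \oo) = l.
Proof.
move=> ur ui; apply/cvg_lim; first exact: norm_hausdorff.
apply/cvgrPdist_le => /= e e0.
have er : 0 < Re e by move: e0; rewrite ltcE /= => /andP[].
have eE : e = (Re e)%:C by move: e0; rewrite ltcE /= => /andP[/eqP ie _]; apply: complex_ext.
have er2 : 0 < Re e / 2 by rewrite divr_gt0.
move/cvgrPdist_le : ur => /(_ _ er2) ur; move/cvgrPdist_le : ui => /(_ _ er2) ui.
near=> n; rewrite eE normc_def lecR.
have ->: Re e = Num.sqrt (Re e ^+ 2) by rewrite sqrtr_sqr gtr0_norm.
rewrite ler_sqrt ?sqr_ge0// Re_sub Im_sub.
have h1 : `|Re l - Re (u n)| <= Re e / 2 by near: n.
have h2 : `|Im l - Im (u n)| <= Re e / 2 by near: n.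
rewrite -(real_normK (num_real (Re l - _))) -(real_normK (num_real (Im l - _))).
move: h1 h2 (normr_ge0 (Re l - Re (u n))) (normr_ge0 (Im l - Im (u n))).
move: (`|Re l - Re (u n)|) (`|Im l - Im (u n)|) => x y; nra.
Unshelve. all: by end_near. Qed.

End ComplexTools.

(** * The Stieltjes transform of sin (b sqrt t) / t *)

Section SineKernel.
Context {R : realType}.
Notation mu := (@lebesgue_measure R).
Notation D0y := (`]0, +oo[%classic : set R).
Notation D01 := (`]0, 1[%classic : set R).
Notation Re := complex.Re.
Notation Im := complex.Im.
Notation cabs := ComplexField.Normc.normc.
Notation sqrt := (@Num.sqrt R).
Implicit Types (f g h : R -> R) (x t c b k : R).

Lemma lipschitz_is_derive f f' k x y : (forall x, is_derive x 1 f (f' x)) ->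
  (forall x, `|f' x| <= k) -> `|f x - f y| <= k * `|x - y|.
Proof.
move=> df fk; wlog xy : x y / x < y.
  move=> H; have [xy|yx|->] := ltgtP x y; first exact: H.
    by rewrite distrC (distrC x); exact: H.
  by rewrite !subrr normr0 mulr0.
have cf : {within `[x, y], continuous f}.
  by apply: continuous_in_subspaceT => z _; exact: dvt_continuous (df z).
have [z _] := MVT xy (fun z _ => df z) cf.
by rewrite distrC (distrC x) => ->; rewrite normrM ler_wpM2r.
Qed.

Lemma sin_lipschitz x y : `|sin x - sin y| <= `|x - y|.
Proof. by have := lipschitz_is_derive x y (@is_derive_sin R) (@cos_max R); rewrite mul1r. Qed.

Lemma sin_le_norm x : `|sin x| <= `|x|.
Proof. by have := sin_lipschitz x 0; rewrite sin0 !subr0. Qed.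

Lemma onem_cosE x : 1 - cos x = 2 * sin (x / 2) ^+ 2.
Proof.
have {1}-> : x = (x / 2) *+ 2 by rewrite -mulr_natr divfK.
by rewrite cos_mulr2n cos2sin2; ring.
Qed.

Lemma onem_cos_ge0 x : 0 <= 1 - cos x.
Proof. by rewrite subr_ge0 cos_le1. Qed.

Lemma onem_cos_le2 x : 1 - cos x <= 2.
Proof. by have := cos_geN1 x; lra. Qed.

Lemma onem_cos_le x : 1 - cos x <= x ^+ 2 / 2.
Proof.
rewrite onem_cosE.
have : `|sin (x / 2)| ^+ 2 <= `|x / 2| ^+ 2 by rewrite ler_sqr ?nnegrE// sin_le_norm.
rewrite !real_normK ?num_real// => h.
by have : (x / 2) ^+ 2 = x ^+ 2 / 4; [field | lra].
Qed.

Lemma is_derive_Rintegral (f f' : R -> R -> R) (D : set R) (G : R -> R) (a u v : R) :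
  measurable D -> u < a < v ->
  (forall x t, D t -> is_derive x 1 (f^~ t) (f' x t)) ->
  (forall x, u < x < v -> mu.-integrable D (EFin \o f x)) ->
  (forall t, 0 <= G t) -> mu.-integrable D (EFin \o G) ->
  (forall x t, u < x < v -> D t -> `|f' x t| <= G t) ->
  is_derive a 1 (fun x => \int[mu]_(t in D) f x t) (\int[mu]_(t in D) f' a t).
Proof.
move=> mD auv df fi G0 Gi fG.
have uvE x : `]u, v[%classic x -> u < x < v by rewrite /= in_itv.
have Ia : `]u, v[%classic a by rewrite /= in_itv.
have d1 x t : D t -> partial1of2 f x t = f' x t.
  by move=> Dt; rewrite partial1of2E; have ? := df x t Dt; exact: derive_val.
have fi' x : `]u, v[%classic x -> mu.-integrable D (EFin \o f x) by move/uvE/fi.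
have df' x t : `]u, v[%classic x -> D t -> derivable (f^~ t) x 1.
  by move=> _ Dt; have ? := df x t Dt; exact: ex_derive.
have fG' x t : `]u, v[%classic x -> D t -> `|partial1of2 f x t| <= G t.
  by move=> /uvE xuv Dt; rewrite d1//; exact: fG.
have H := @derivable_under_integral R _ _ mu f D mD a u v Ia fi' df' G G0 Gi fG'.
 apply: DeriveDef; first exact: H.
rewrite -derive1E (@differentiation_under_integral R _ _ mu f D mD a u v Ia fi' df' G G0 Gi fG').
by apply: eq_Rintegral => t /set_mem Dt; rewrite d1.
Qed.

Let invsq (t : R) : R := (sqrt t * (1 + t))^-1.

Lemma invsq_ge0 t : 0 <= invsq t.
Proof.
rewrite /invsq; have [t0|t0] := leP t 0.
  by rewrite ler0_sqrtr// mul0r invr0.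
by rewrite invr_ge0 mulr_ge0 ?sqrtr_ge0// addr_ge0// ltW.
Qed.

Lemma mulr_sqrt t : 0 < t -> sqrt t * sqrt t = t.
Proof. by move=> t0; rewrite -expr2 sqr_sqrtr ?ltW. Qed.

Section real_kernel.
Variables (h : R -> R) (C : R).
Hypothesis mh : measurable_fun D0y h.
Hypothesis hC : forall t, 0 < t -> `|h t| <= C / (1 + t).

Let C0 : 0 <= C.
Proof.
have := hC ltr01; have : 0 <= `|h 1| by [].
by move=> h0 /(le_trans h0); rewrite pmulr_lge0// invr_gt0.
Qed.

Lemma measurable_sinsqrt b : measurable_fun D0y (fun t => sin (b * sqrt t)).
Proof.
apply: measurable_funTS; apply: measurableT_comp measurable_sinR _.
by apply: measurable_funM => //; exact: measurable_sqrtR.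
Qed.

Lemma measurable_cossqrt b : measurable_fun D0y (fun t => cos (b * sqrt t)).
Proof.
apply: measurable_funTS; apply: measurableT_comp measurable_cosR _.
by apply: measurable_funM => //; exact: measurable_sqrtR.
Qed.

Let CinvsqE t : 0 < t -> (sqrt t)^-1 * (C / (1 + t)) = C * invsq t.
Proof. by move=> t0; rewrite /invsq invfM; ring. Qed.

Lemma le_sinK b t : 0 < t -> `|sin (b * sqrt t) / t * h t| <= `|b| * C * invsq t.
Proof.
move=> t0; have s0 : 0 < sqrt t by rewrite sqrtr_gt0.
rewrite -[leRHS]mulrA -CinvsqE// !normrM normfV (gtr0_norm t0).
have -> : `|b| * ((sqrt t)^-1 * (C / (1 + t))) = (`|b| * sqrt t / t) * (C / (1 + t)).
  rewrite (_ : t^-1 = (sqrt t)^-1 * (sqrt t)^-1); last by rewrite -invfM mulr_sqrt.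
  by field; rewrite !gt_eqF// addr_gt0.
apply: ler_pM => //; first by rewrite divr_ge0// ltW.
  rewrite ler_pM2r ?invr_gt0//; apply: le_trans (sin_le_norm _) _.
  by rewrite normrM (gtr0_norm s0).
exact: hC.
Qed.

Lemma le_cosK b t : 0 < t -> `|cos (b * sqrt t) / sqrt t * h t| <= C * invsq t.
Proof.
move=> t0; have s0 : 0 < sqrt t by rewrite sqrtr_gt0.
rewrite -CinvsqE// !normrM normfV (gtr0_norm s0) -mulrA.
rewrite -[leRHS]mul1r; apply: ler_pM => //; first exact: cos_max.
by rewrite ler_pM2l ?invr_gt0//; exact: hC.
Qed.

Lemma le_onemcosK b t : 0 < t ->
  `|(1 - cos (b * sqrt t)) / (t * sqrt t) * h t| <= b ^+ 2 / 2 * C * invsq t.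
Proof.
move=> t0; have s0 : 0 < sqrt t by rewrite sqrtr_gt0.
have ts0 : 0 < t * sqrt t by rewrite mulr_gt0.
rewrite -[leRHS]mulrA -CinvsqE// !normrM normfV (gtr0_norm ts0) (ger0_norm (onem_cos_ge0 _)).
have -> : b ^+ 2 / 2 * ((sqrt t)^-1 * (C / (1 + t))) =
    ((b * sqrt t) ^+ 2 / 2 / (t * sqrt t)) * (C / (1 + t)).
  rewrite exprMn sqr_sqrtr ?ltW//; field; by rewrite !gt_eqF// addr_gt0.
apply: ler_pM => //; first by rewrite divr_ge0 ?onem_cos_ge0// ltW.
  by rewrite ler_pM2r ?invr_gt0//; exact: onem_cos_le.
exact: hC.
Qed.

Let invsq_int k : mu.-integrable D0y (EFin \o (fun t => k * invsq t)).
Proof. by apply: integrable_scale => //; exact: integrable_sqrtK. Qed.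

Lemma measurable_invr_D (D : set R) f : measurable_fun D f -> measurable_fun D (fun t => (f t)^-1).
Proof. by move=> mf; apply: measurableT_comp mf; exact: measurable_invr. Qed.

Lemma integrable_sinK b : mu.-integrable D0y (EFin \o (fun t => sin (b * sqrt t) / t * h t)).
Proof.
apply: (ler_integrable _ _ _ (invsq_int (`|b| * C))) => //.
  apply: measurable_funM => //; apply: measurable_funM; first exact: measurable_sinsqrt.
  exact: measurable_invr_D.
by move=> t /in0y; exact: le_sinK.
Qed.

Lemma integrable_cosK b :
  mu.-integrable D0y (EFin \o (fun t => cos (b * sqrt t) / sqrt t * h t)).
Proof.
apply: (ler_integrable _ _ _ (invsq_int C)) => //.
  apply: measurable_funM => //; apply: measurable_funM; first exact: measurable_cossqrt.
  by apply: measurable_invr_D; apply: measurable_funTS; exact: measurable_sqrtR.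
by move=> t /in0y; exact: le_cosK.
Qed.

Lemma integrable_onemcosK b :
  mu.-integrable D0y (EFin \o (fun t => (1 - cos (b * sqrt t)) / (t * sqrt t) * h t)).
Proof.
apply: (ler_integrable _ _ _ (invsq_int (b ^+ 2 / 2 * C))) => //.
  apply: measurable_funM => //; apply: measurable_funM.
    by apply: measurable_funB => //; exact: measurable_cossqrt.
  apply: measurable_invr_D; apply: measurable_funM => //.
  by apply: measurable_funTS; exact: measurable_sqrtR.
by move=> t /in0y; exact: le_onemcosK.
Qed.

Let sqrt_neq0 t : 0 < t -> sqrt t != 0.
Proof. by move=> t0; rewrite gt_eqF// sqrtr_gt0. Qed.

Lemma is_derive_onemcosK b :
  is_derive b 1 (fun b => \int[mu]_(t in D0y) ((1 - cos (b * sqrt t)) / (t * sqrt t) * h t))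
    (\int[mu]_(t in D0y) (sin (b * sqrt t) / t * h t)).
Proof.
apply: (@is_derive_Rintegral (fun b t => (1 - cos (b * sqrt t)) / (t * sqrt t) * h t)
  (fun b t => sin (b * sqrt t) / t * h t) D0y (fun t => (`|b| + 1) * C * invsq t)
  b (- (`|b| + 1)) (`|b| + 1)) => //.
- have := ler_norm b; have := ler_norm (- b); rewrite normrN => h1 h2.
  by apply/andP; split; lra.
- move=> x t /in0y t0.
  have dx : is_derive x 1 (fun x => x * sqrt t) (sqrt t).
    by apply: dvt_eq (dvtM (dvt_id x) (dvt_cst (sqrt t) x)) _; rewrite mul1r mulr0 addr0.
  have := dvtZ (h t / (t * sqrt t)) (dvtB (dvt_cst 1 x) (dvt_comp (is_derive_cos _) dx)).
  have -> : h t / (t * sqrt t) * (0 - - sin (x * sqrt t) * sqrt t) = sin (x * sqrt t) / t * h t.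
    by have := sqrt_neq0 t0; move=> ?; field; rewrite gt_eqF.
  by congr is_derive; apply/funext => y; ring.
- by move=> x _; exact: integrable_onemcosK.
- by move=> t; rewrite mulr_ge0 ?invsq_ge0// mulr_ge0// addr_ge0.
- move=> x t xb /in0y t0; apply: le_trans (le_sinK x t0) _.
  rewrite ler_wpM2r ?invsq_ge0// ler_wpM2r// ler_norml.
  by move: xb => /andP[/ltW -> /ltW ->].
Qed.

Lemma is_derive_sinK b :
  is_derive b 1 (fun b => \int[mu]_(t in D0y) (sin (b * sqrt t) / t * h t))
    (\int[mu]_(t in D0y) (cos (b * sqrt t) / sqrt t * h t)).
Proof.
apply: (@is_derive_Rintegral (fun b t => sin (b * sqrt t) / t * h t)
  (fun b t => cos (b * sqrt t) / sqrt t * h t) D0y (fun t => C * invsq t)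
  b (b - 1) (b + 1)) => //.
- by apply/andP; split; lra.
- move=> x t /in0y t0.
  have dx : is_derive x 1 (fun x => x * sqrt t) (sqrt t).
    by apply: dvt_eq (dvtM (dvt_id x) (dvt_cst (sqrt t) x)) _; rewrite mul1r mulr0 addr0.
  have := dvtZ (h t / t) (dvt_comp (is_derive_sin _) dx).
  have -> : h t / t * (cos (x * sqrt t) * sqrt t) = cos (x * sqrt t) / sqrt t * h t.
    rewrite (_ : t^-1 = (sqrt t)^-1 * (sqrt t)^-1); last by rewrite -invfM mulr_sqrt.
    by have := sqrt_neq0 t0; move=> ?; field.
  by congr is_derive; apply/funext => y; ring.
- by move=> x _; exact: integrable_sinK.
- by move=> t; rewrite mulr_ge0 ?invsq_ge0.
- by move=> x t _ /in0y t0; exact: le_cosK.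
Qed.

Lemma normr_sinK_le b :
  `|\int[mu]_(t in D0y) (sin (b * sqrt t) / t * h t)| <= `|b| * C * pi.
Proof.
apply: le_trans (le_normr_Rintegral _ (integrable_sinK b)) _ => //.
rewrite -Rintegral_sqrtK -RintegralZl//; last exact: integrable_sqrtK.
apply: le_Rintegral => //; first exact: integrable_norm (integrable_sinK b).
by move=> t /in0y; exact: le_sinK.
Qed.

Lemma normr_cosK_le b :
  `|\int[mu]_(t in D0y) (cos (b * sqrt t) / sqrt t * h t)| <= C * pi.
Proof.
apply: le_trans (le_normr_Rintegral _ (integrable_cosK b)) _ => //.
rewrite -Rintegral_sqrtK -RintegralZl//; last exact: integrable_sqrtK.
apply: le_Rintegral => //; first exact: integrable_norm (integrable_cosK b).
by move=> t /in0y; exact: le_cosK.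
Qed.

End real_kernel.

(* Shown to be [pi] in [onemcosI_pi], from the case [w = 1] of
   [cintegral_cosker0]. *)
Definition onemcosI : R := \int[mu]_(t in D0y) ((1 - cos (sqrt t)) / (t * sqrt t)).

Lemma measurable_onemcos b : measurable_fun D0y (fun t => (1 - cos (b * sqrt t)) / (t * sqrt t)).
Proof.
apply: measurable_funM.
  by apply: measurable_funB => //; exact: measurable_cossqrt.
apply: measurable_invr_D; apply: measurable_funM => //.
by apply: measurable_funTS; exact: measurable_sqrtR.
Qed.

Lemma integrable_onemcos b :
  mu.-integrable D0y (EFin \o (fun t => (1 - cos (b * sqrt t)) / (t * sqrt t))).
Proof.
apply: (@ler_integrable _ _ _ (fun t => (b ^+ 2 / 2 + 2) * invsq t)) => //.
- exact: measurable_onemcos.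
- move=> t /in0y t0; have s0 : 0 < sqrt t by rewrite sqrtr_gt0.
  have ts0 : 0 < t * sqrt t by rewrite mulr_gt0.
  have t1 : 0 < sqrt t * (1 + t) by rewrite mulr_gt0// addr_gt0.
  rewrite normrM normfV (gtr0_norm ts0) (ger0_norm (onem_cos_ge0 _)).
  have h1 := onem_cos_le (b * sqrt t); have h2 := onem_cos_le2 (b * sqrt t).
  rewrite exprMn (sqr_sqrtr (ltW t0)) in h1.
  have := onem_cos_ge0 (b * sqrt t); move: (1 - cos _) h1 h2 => X h1 h2 X0.
  have key : X * (1 + t) <= (b ^+ 2 / 2 + 2) * t by nra.
  rewrite /invsq ler_pdivrMr// mulrAC ler_pdivlMr//.
  have -> : X * (sqrt t * (1 + t)) = sqrt t * (X * (1 + t)) by ring.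
  have -> : (b ^+ 2 / 2 + 2) * (t * sqrt t) = sqrt t * ((b ^+ 2 / 2 + 2) * t) by ring.
  by rewrite ler_pM2l.
- by apply: integrable_scale => //; exact: integrable_sqrtK.
Qed.

Lemma Rintegral_onemcos b : 0 < b ->
  \int[mu]_(t in D0y) ((1 - cos (b * sqrt t)) / (t * sqrt t)) = onemcosI * b.
Proof.
move=> b0; have b20 : 0 < b ^+ 2 by rewrite exprn_gt0.
have mf : measurable_fun D0y (fun t => (1 - cos (sqrt t)) / (t * sqrt t)).
  by have := measurable_onemcos 1; apply: eq_measurable_fun => t _; rewrite mul1r.
have f0 t : 0 < t -> 0 <= (1 - cos (sqrt t)) / (t * sqrt t).
  by move=> t0; rewrite divr_ge0 ?onem_cos_ge0// mulr_ge0 ?sqrtr_ge0// ltW.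
have := Rintegral_scale b20 mf f0; rewrite -/onemcosI => E.
have oi : mu.-integrable D0y (EFin \o (fun t => (1 - cos (b * sqrt t)) / (t * sqrt t))).
  exact: integrable_onemcos.
have -> : onemcosI * b = b ^+ 3 * ((b ^+ 2)^-1 * onemcosI) by field; rewrite gt_eqF.
rewrite -E; rewrite -RintegralZl//; last first.
  apply: eq_Rintegrable (integrable_scale (b ^+ 3)^-1 _ oi) => // t /in0y t0.
  have b30 : b ^+ 3 != 0 by rewrite expf_neq0// gt_eqF.
  rewrite sqrtrM ?ltW// sqrtr_sqr gtr0_norm//.
  by field; rewrite !gt_eqF// sqrtr_gt0.
apply: eq_Rintegral => t /set_mem/in0y t0.
rewrite sqrtrM ?ltW// sqrtr_sqr gtr0_norm//.
by field; rewrite !gt_eqF// sqrtr_gt0.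
Qed.

Section complex_kernel.
Variable w : R[i].
Hypothesis pw : 0 < Re w.
Let z : R[i] := w * w.
Let ker (t : R) : R[i] := (z + t%:C)^-1.

Let r := Re w ^+ 2 + Im w ^+ 2.

Let r0 : 0 < r. Proof. by rewrite /r ltr_pwDl ?exprn_gt0// sqr_ge0. Qed.

Let Re_zt t : Re (z + t%:C) = Re w ^+ 2 - Im w ^+ 2 + t.
Proof. by rewrite Re_add /z Re_mul /= -!expr2. Qed.

Let Im_zt t : Im (z + t%:C) = 2 * Re w * Im w.
Proof. by rewrite Im_add /z Im_mul /= addr0; ring. Qed.

Lemma sqr_cabs_ztE t : 0 <= t -> Re w ^+ 2 / r * (r + t) ^+ 2 <= cabs (z + t%:C) ^+ 2.
Proof.
move=> t0; rewrite sqr_cabs Re_zt Im_zt.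
have p2 : 0 <= Re w ^+ 2 by exact: sqr_ge0.
have q2 : 0 <= Im w ^+ 2 by exact: sqr_ge0.
rewrite mulrAC ler_pdivrMr//.
have : 0 <= Im w ^+ 2 * (r - t) ^+ 2 by rewrite mulr_ge0// sqr_ge0.
rewrite /r; move: (Re w) (Im w) p2 q2 => p q p2 q2 h.
rewrite -subr_ge0; apply: le_trans h _.
rewrite le_eqVlt; apply/orP; left; apply/eqP; ring.
Qed.

Lemma zt_neq0 t : 0 <= t -> z + t%:C != 0.
Proof.
move=> t0; apply/eqP => e0; have := sqr_cabs_ztE t0.
rewrite e0 ComplexField.Normc.normc0 expr0n/= leNgt => /negP; apply.
by rewrite mulr_gt0// ?divr_gt0 ?exprn_gt0// ltr_pwDl.
Qed.

Lemma ker_bound : exists2 C, 0 <= C & forall t, 0 <= t -> cabs (ker t) <= C / (1 + t).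
Proof.
pose m := Num.min r 1.
have m0 : 0 < m by rewrite lt_min r0 ltr01.
have Cpos : 0 < (r + 1) / (Re w * m).
  by apply: divr_gt0; [exact: addr_gt0 r0 ltr01|exact: mulr_gt0].
exists ((r + 1) / (Re w * m)); first exact: ltW.
move=> t t0; have t1 : 0 < 1 + t by rewrite ltr_pwDl.
have zt0 : 0 < cabs (z + t%:C) by rewrite cabs_gt0// zt_neq0.
rewrite /ker cabsV -[leLHS]mul1r ler_pdivrMr// mulrAC ler_pdivlMr// mul1r.
rewrite -ler_pdivrMl; last by rewrite divr_gt0 ?mulr_gt0// ltr_wpDl// ltW.
rewrite -ler_sqr ?nnegrE ?(ltW zt0)//; last first.
  by rewrite mulr_ge0 ?invr_ge0 ?(ltW Cpos) ?(ltW t1).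
apply: le_trans (sqr_cabs_ztE t0).
have mrt : m * (1 + t) <= r + t.
  have mr : m <= r by rewrite ge_min lexx.
  have m1 : m <= 1 by rewrite ge_min lexx orbT.
  by rewrite mulrDr mulr1 lerD// ler_piMl.
have -> : (((r + 1) / (Re w * m))^-1 * (1 + t)) ^+ 2 =
    Re w ^+ 2 / (r + 1) ^+ 2 * (m * (1 + t)) ^+ 2.
  by field; rewrite !gt_eqF// ltr_wpDl// ltW.
apply: ler_pM.
- by rewrite divr_ge0 ?sqr_ge0.
- exact: sqr_ge0.
- have r1 : 0 < r + 1 by exact: addr_gt0.
  rewrite (ler_pM2l (exprn_gt0 2 pw)) lef_pV2 ?posrE ?(exprn_gt0 2 r1) ?r0//.
  by have := sqr_ge0 r; have := r0; nra.
- have mt0 : 0 <= m * (1 + t) by exact: mulr_ge0 (ltW m0) (ltW t1).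
  by rewrite ler_sqr ?nnegrE// (le_trans mt0).
Qed.

Lemma measurable_Re_ker : measurable_fun [set: R] (fun t => Re (ker t)).
Proof.
have -> : (fun t => Re (ker t)) = (fun t => (Re w ^+ 2 - Im w ^+ 2 + t) *
    ((Re w ^+ 2 - Im w ^+ 2 + t) ^+ 2 + (2 * Re w * Im w) ^+ 2)^-1).
  by apply/funext => t; rewrite /ker Re_inv Re_zt Im_zt.
apply: measurable_funM; first exact: measurable_funD.
apply: measurable_invr_D; apply: measurable_funD => //.
by apply: measurable_funX; exact: measurable_funD.
Qed.

Lemma measurable_Im_ker : measurable_fun [set: R] (fun t => Im (ker t)).
Proof.
have -> : (fun t => Im (ker t)) = (fun t => (- (2 * Re w * Im w)) *
    ((Re w ^+ 2 - Im w ^+ 2 + t) ^+ 2 + (2 * Re w * Im w) ^+ 2)^-1).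
  by apply/funext => t; rewrite /ker Im_inv Re_zt Im_zt.
apply: measurable_funM => //.
apply: measurable_invr_D; apply: measurable_funD => //.
by apply: measurable_funX; exact: measurable_funD.
Qed.

Let mRe : measurable_fun D0y (fun t => Re (ker t)).
Proof. exact: measurable_funTS measurable_Re_ker. Qed.

Let mIm : measurable_fun D0y (fun t => Im (ker t)).
Proof. exact: measurable_funTS measurable_Im_ker. Qed.

Let Re_ker_le C : (forall t, 0 <= t -> cabs (ker t) <= C / (1 + t)) ->
  forall t, 0 < t -> `|Re (ker t)| <= C / (1 + t).
Proof. by move=> kC t t0; apply: le_trans (Re_le_cabs _) (kC t (ltW t0)). Qed.

Let Im_ker_le C : (forall t, 0 <= t -> cabs (ker t) <= C / (1 + t)) ->
  forall t, 0 < t -> `|Im (ker t)| <= C / (1 + t).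
Proof. by move=> kC t t0; apply: le_trans (Im_le_cabs _) (kC t (ltW t0)). Qed.

Let P b := cintegral D0y (fun t => ((1 - cos (b * sqrt t)) / (t * sqrt t))%:C * ker t).
Let S b := cintegral D0y (fun t => (sin (b * sqrt t) / t)%:C * ker t).
Let Y b := cintegral D0y (fun t => (cos (b * sqrt t) / sqrt t)%:C * ker t).

Let cintegral_ReZ (g : R -> R) : Re (cintegral D0y (fun t => (g t)%:C * ker t)) =
  \int[mu]_(t in D0y) (g t * Re (ker t)).
Proof. by apply: eq_Rintegral => t _; rewrite Re_scale. Qed.

Let cintegral_ImZ (g : R -> R) : Im (cintegral D0y (fun t => (g t)%:C * ker t)) =
  \int[mu]_(t in D0y) (g t * Im (ker t)).
Proof. by apply: eq_Rintegral => t _; rewrite Im_scale. Qed.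

Let dP b : is_cderive P b (S b).
Proof.
have [C C0 kC] := ker_bound; split.
  rewrite cintegral_ReZ; under eq_fun do rewrite cintegral_ReZ.
  exact: (is_derive_onemcosK mRe (Re_ker_le kC)).
rewrite cintegral_ImZ; under eq_fun do rewrite cintegral_ImZ.
exact: (is_derive_onemcosK mIm (Im_ker_le kC)).
Qed.

Let dS b : is_cderive S b (Y b).
Proof.
have [C C0 kC] := ker_bound; split.
  rewrite cintegral_ReZ; under eq_fun do rewrite cintegral_ReZ.
  exact: (is_derive_sinK mRe (Re_ker_le kC)).
rewrite cintegral_ImZ; under eq_fun do rewrite cintegral_ImZ.
exact: (is_derive_sinK mIm (Im_ker_le kC)).
Qed.

Let iY b : cintegrable D0y (fun t => (cos (b * sqrt t) / sqrt t)%:C * ker t).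
Proof.
have [C C0 kC] := ker_bound; split.
  apply: eq_Rintegrable (integrable_cosK mRe (Re_ker_le kC) b) => // t _; by rewrite Re_scale.
apply: eq_Rintegrable (integrable_cosK mIm (Im_ker_le kC) b) => // t _; by rewrite Im_scale.
Qed.

Let iP b : cintegrable D0y (fun t => ((1 - cos (b * sqrt t)) / (t * sqrt t))%:C * ker t).
Proof.
have [C C0 kC] := ker_bound; split.
  apply: eq_Rintegrable (integrable_onemcosK mRe (Re_ker_le kC) b) => // t _; by rewrite Re_scale.
apply: eq_Rintegrable (integrable_onemcosK mIm (Im_ker_le kC) b) => // t _; by rewrite Im_scale.
Qed.

Let iO b : cintegrable D0y (fun t => ((1 - cos (b * sqrt t)) / (t * sqrt t))%:C : R[i]).
Proof. by split => /=; [exact: integrable_onemcos|exact: integrable0]. Qed.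

Let ker_id t : 0 < t -> z * ker t = 1 - t%:C * ker t.
Proof.
move=> t0; have := zt_neq0 (ltW t0); rewrite /ker => h.
by apply/eqP; rewrite eq_sym subr_eq -mulrDl mulfV.
Qed.

Let YE b : 0 < b -> Y b = z * P b - (onemcosI * b)%:C + Y 0.
Proof.
move=> b0.
have -> : (onemcosI * b)%:C = cintegral D0y (fun t => ((1 - cos (b * sqrt t)) / (t * sqrt t))%:C).
  by apply: complex_ext; rewrite /= ?Rintegral_onemcos// /Rintegral integral0.
apply/eqP; rewrite -subr_eq; apply/eqP.
rewrite /P -cintegralZ// -!cintegralB//; last exact: cintegrableZ.
apply: cintegral_eq => t /in0y t0.
have s0 : sqrt t != 0 by rewrite gt_eqF// sqrtr_gt0.
rewrite mul0r cos0 mulrCA ker_id// mulrBr mulr1 mulrA -rmorphM addrAC subrr add0r.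
rewrite -mulrBl -rmorphB -mulNr -rmorphN; congr (_%:C * _).
by field; rewrite s0 gt_eqF.
Qed.

Let is_derive_linear k x : is_derive x 1 (fun b => k * b) k.
Proof. by apply: dvt_eq (dvtZ k (dvt_id x)) _; rewrite mulr1. Qed.

Let dY b : 0 < b -> is_cderive Y b (z * S b - onemcosI%:C).
Proof.
move=> b0; have [dP1 dP2] := dP b.
have near_gt0 : \forall y \near b, 0 < y by exact: lt_nbhsr.
split.
  apply: (@dvt_near _ (fun y => Re z * Re (P y) - Im z * Im (P y) - onemcosI * y + Re (Y 0))).
    by apply: filterS near_gt0 => y y0; rewrite (YE y0) !(Re_add, Re_sub, Re_mul z).
  apply: dvt_eq (dvtD (dvtB (dvtB (dvtZ (Re z) dP1) (dvtZ (Im z) dP2))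
    (is_derive_linear onemcosI b)) (dvt_cst _ b)) _.
  by rewrite Re_sub (Re_mul z) addr0.
apply: (@dvt_near _ (fun y => Re z * Im (P y) + Im z * Re (P y) + Im (Y 0))).
  by apply: filterS near_gt0 => y y0; rewrite (YE y0) !(Im_add, Im_sub, Im_mul z) /= subr0.
apply: dvt_eq (dvtD (dvtD (dvtZ (Re z) dP2) (dvtZ (Im z) dP1)) (dvt_cst _ b)) _.
by rewrite Im_sub (Im_mul z) addr0 /= subr0.
Qed.

Let z_neq0 : z != 0.
Proof. by have := zt_neq0 (lexx 0); rewrite addr0. Qed.

Let w_neq0 : w != 0.
Proof. by have := z_neq0; rewrite mulf_eq0 negb_or => /andP[]. Qed.

Let U b : R[i] := S b + (- (onemcosI%:C / z)).

Let dU b : is_cderive U b (Y b).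
Proof. by have := cdvtD (dS b) (cdvt_cst b (- (onemcosI%:C / z))); rewrite addr0. Qed.

Let A b : R[i] := w * U b + Y b.

Let dA b : 0 < b -> is_cderive A b (w * A b).
Proof.
move=> b0; have := cdvtD (cdvtZ w (dU b)) (dY b0); congr is_cderive.
rewrite /A /U -/z.
have : onemcosI%:C = z * (onemcosI%:C / z) by rewrite mulrC divfK.
by move: (_ / _) => X ->; rewrite /z; ring.
Qed.

Let cabsD (u v : R[i]) : cabs (u + v) <= cabs u + cabs v.
Proof. exact: le_normcD. Qed.

Let A_bound : exists2 k, 0 <= k & forall b, 0 < b -> cabs (A b) <= k * (1 + b).
Proof.
have [C C0 kC] := ker_bound.
exists (cabs w * (2 * (C * pi) + cabs (- (onemcosI%:C / z))) + 2 * (C * pi)).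
  have Cp : 0 <= 2 * (C * pi) by rewrite !mulr_ge0// pi_ge0.
  apply: (addr_ge0 _ Cp); apply: (mulr_ge0 (cabs_ge0 _)); exact: (addr_ge0 Cp (cabs_ge0 _)).
move=> b b0.
have Sb : cabs (S b) <= 2 * (b * C * pi).
  apply: le_trans (cabs_le_ReIm _) _.
  have h1 := normr_sinK_le mRe (Re_ker_le kC) b.
  have h2 := normr_sinK_le mIm (Im_ker_le kC) b.
  rewrite -cintegral_ReZ (gtr0_norm b0) in h1; rewrite -cintegral_ImZ (gtr0_norm b0) in h2.
  by rewrite mulr_natl mulr2n lerD.
have Yb : cabs (Y b) <= 2 * (C * pi).
  apply: le_trans (cabs_le_ReIm _) _.
  have h1 := normr_cosK_le mRe (Re_ker_le kC) b.
  have h2 := normr_cosK_le mIm (Im_ker_le kC) b.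
  rewrite -cintegral_ReZ in h1; rewrite -cintegral_ImZ in h2.
  by rewrite mulr_natl mulr2n lerD.
have Cp : 0 <= C * pi by rewrite mulr_ge0// pi_ge0.
apply: le_trans (cabsD _ _) _; rewrite cabsM.
have Ub : cabs (U b) <= 2 * (b * C * pi) + cabs (- (onemcosI%:C / z)).
  by apply: le_trans (cabsD _ _) _; rewrite lerD2r.
have Ub' : cabs w * cabs (U b) <= cabs w * (2 * (b * C * pi) + cabs (- (onemcosI%:C / z))).
  by rewrite ler_wpM2l ?cabs_ge0.
apply: le_trans (lerD Ub' Yb) _.
have k0 := cabs_ge0 (- (onemcosI%:C / z)); have w0 := cabs_ge0 w.
move: (cabs (- _)) (cabs w) k0 w0 => k W k0 W0.
rewrite -subr_ge0.
have -> : (W * (2 * (C * pi) + k) + 2 * (C * pi)) * (1 + b) - (W * (2 * (b * C * pi) + k) + 2 * (C * pi))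
  = W * (2 * (C * pi)) + W * k * b + 2 * (C * pi) * b by ring.
have b0' := ltW b0; have C2 : 0 <= 2 * (C * pi) by rewrite mulr_ge0.
exact: addr_ge0 (addr_ge0 (mulr_ge0 W0 C2) (mulr_ge0 (mulr_ge0 W0 k0) b0')) (mulr_ge0 C2 b0').
Qed.

Let A0 b : 0 < b -> A b = 0.
Proof.
move=> b0; have [k k0 Ak] := A_bound.
suff : A b * cexp (- w * b%:C) = 0.
  by move/eqP; rewrite mulf_eq0 (negbTE (cexp_neq0 _)) orbF => /eqP.
set c := A b * _; set p := Re w.
have cE x : 0 < x -> cabs c <= k * (1 + x) * expR (- (p * x)).
  move=> x0; rewrite /c (cderive_expM dA b0 x0) cabsM cabs_cexp.
  rewrite mulrC Re_mul Re_opp Im_opp /= mulr0 subr0 mulNr.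
  by rewrite mulrC ler_wpM2r ?expR_ge0// Ak.
have cK x : 0 < x -> cabs c * (1 + p / 2 * x) <= k * (1 + 2 / p).
  move=> x0; have := cE x x0; set E := expR (p / 2 * x).
  have E1 : 1 + p / 2 * x <= E by exact: expR_ge1Dx.
  have E0 : 0 < E by exact: expR_gt0.
  have -> : expR (- (p * x)) = E^-1 * E^-1.
    by rewrite /E -expRN -expRD; congr expR; field.
  rewrite mulrA ler_pdivlMr// ler_pdivlMr// => h.
  have kE : k * (1 + x) <= k * (1 + 2 / p) * E.
    rewrite -mulrA ler_wpM2l//; apply: (@le_trans _ _ ((1 + 2 / p) * (1 + p / 2 * x))).
      rewrite mulrDl mul1r mulrDr mulr1.
      have -> : 2 / p * (p / 2 * x) = x by field; rewrite gt_eqF.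
      have : 0 <= 2 / p by rewrite divr_ge0// ltW.
      have : 0 <= p / 2 * x by rewrite mulr_ge0 ?divr_ge0// ltW.
      by move: (_ / _) (_ * x) => X Y' ? ?; lra.
    by rewrite ler_wpM2l// addr_ge0// divr_ge0// ltW.
  have : cabs c * E <= k * (1 + 2 / p) by rewrite -(ler_pM2r E0) (le_trans h).
  by apply: le_trans; rewrite ler_wpM2l// cabs_ge0.
apply/ComplexField.Normc.eq0_normc/eqP; rewrite -[_ == _]negbK; apply/negP => c0.
have {}c0 : 0 < cabs c by rewrite lt_neqAle eq_sym c0 cabs_ge0.
set K := k * (1 + 2 / p) in cK.
have K0 : 0 <= K by rewrite mulr_ge0// addr_ge0// divr_ge0// ltW.
have x0 : 0 < (K / cabs c + 1) * (2 / p).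
  by rewrite mulr_gt0 ?divr_gt0// ltr_wpDl// divr_ge0// ltW.
have := cK _ x0.
have -> : cabs c * (1 + p / 2 * ((K / cabs c + 1) * (2 / p))) = 2 * cabs c + K.
  by field; rewrite !gt_eqF.
by move: (cabs c) c0 => X X0; lra.
Qed.

Let const_at0 f k : {for 0, continuous f} -> (forall x, 0 < x -> f x = k) -> f 0 = k.
Proof.
move=> cf fk; have c1 : f x @[x --> 0^'+] --> f 0 by exact: cvg_at_right_filter.
have c2 : f x @[x --> 0^'+] --> k.
  apply: cvg_near_cst; near=> x; apply: fk.
  by near: x; exact: nbhs_right_gt.
by apply: (cvg_unique _ c1 c2); exact: norm_hausdorff.
Unshelve. all: by end_near. Qed.

Let cconst_at0 (F : R -> R[i]) (u k : R[i]) : is_cderive F 0 u -> (forall x, 0 < x -> F x = k) -> F 0 = k.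
Proof.
move=> [d1 d2] Fk; apply: complex_ext.
  by apply: const_at0 (dvt_continuous d1) _ => x /Fk ->.
by apply: const_at0 (dvt_continuous d2) _ => x /Fk ->.
Qed.

Let S0 : S 0 = 0.
Proof.
rewrite /S (@cintegral_eq _ _ _ (fun=> 0)); last first.
  by move=> t _; rewrite mul0r sin0 mul0r mul0r.
by apply: complex_ext; rewrite /= /Rintegral integral0.
Qed.

Let UE b : 0 < b -> U b = - (onemcosI%:C / z) * cexp (- w * b%:C).
Proof.
move=> b0.
have dU' x : 0 < x -> is_cderive U x (- w * U x).
  move=> x0; have := dU x; congr is_cderive; have := A0 x0; rewrite /A.
  by move=> /eqP; rewrite addrC addr_eq0 mulNr => /eqP.
have h x : 0 < x -> U x * cexp (w * x%:C) = U b * cexp (w * b%:C).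
  by move=> x0; have := cderive_expM dU' x0 b0; rewrite opprK.
have := cconst_at0 (cdvtM (dU 0) (cdvt_cexp w 0)) h.
rewrite mulr0 cexp0 mulr1 {1}/U S0 add0r => ->.
by rewrite mulNr -mulrA cexp_mulN mulr1.
Qed.

Lemma cintegral_sinker_onemcosI b : 0 <= b ->
  cintegral D0y (fun t => (sin (b * sqrt t) / t)%:C * ker t) =
  onemcosI%:C / z * (1 - cexp (- (w * b%:C))).
Proof.
rewrite le_eqVlt => /predU1P[<-|b0].
  by rewrite -/(S 0) S0 mulr0 oppr0 cexp0 subrr mulr0.
have E : S b = U b + onemcosI%:C / z by rewrite /U subrK.
by rewrite -/(S b) E UE// !mulNr mulrBr mulr1 addrC.
Qed.

Lemma cintegral_cosker0 : Y 0 = onemcosI%:C / w.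
Proof.
have P0 : P 0 = 0.
  rewrite /P (@cintegral_eq _ _ _ (fun=> 0)); last first.
    by move=> t _; rewrite mul0r cos0 subrr mul0r mul0r.
  by apply: complex_ext; rewrite /= /Rintegral integral0.
have dL x : is_cderive (fun y => onemcosI%:C * y%:C) x onemcosI%:C.
  split => /=.
    under eq_fun do rewrite mul0r subr0.
    by apply: dvt_eq (dvtZ onemcosI (dvt_id x)) _; rewrite mulr1.
  by under eq_fun do rewrite mulr0 mul0r addr0; exact: dvt_cst.
have dT := cdvtD (cdvtZ w (dU 0)) (cdvtD (cdvtD (cdvtZ z (dP 0))
  (cdvtZ (-1) (dL 0))) (cdvt_cst 0 (Y 0))).
have T0 x : 0 < x -> w * U x + (z * P x + -1 * (onemcosI%:C * x%:C) + Y 0) = 0.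
  move=> x0; rewrite -[RHS](A0 x0) /A (YE x0) mulN1r; congr (_ + (_ - _ + _)).
  by rewrite -rmorphM.
have := cconst_at0 dT T0.
rewrite P0 /U S0 !mulr0 add0r addr0 add0r => /eqP; rewrite addrC addr_eq0 => /eqP ->.
rewrite mulrN opprK mulrCA; congr (_ * _).
by rewrite /z invfM mulrA mulfV ?w_neq0// mul1r.
Qed.

End complex_kernel.

Lemma onemcosI_pi : onemcosI = pi.
Proof.
have p1 : 0 < Re (1 : R[i]) by rewrite /=.
have := congr1 (fun u => Re u) (cintegral_cosker0 p1).
rewrite divr1 /= => <-; rewrite -Rintegral_sqrtK; apply: eq_Rintegral => t /set_mem/in0y t0.
rewrite mul0r cos0 !(mul0r, mulr0, mul1r, mulr1, addr0, subr0, add0r) expr0n/= addr0.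
have s0 : sqrt t != 0 by rewrite gt_eqF// sqrtr_gt0.
by field; rewrite s0 gt_eqF// addr_gt0.
Qed.

Lemma cintegral_sinker (w : R[i]) b : 0 < Re w -> 0 <= b ->
  cintegral D0y (fun t => (sin (b * sqrt t) / t)%:C * (w * w + t%:C)^-1) =
  pi%:C / (w * w) * (1 - cexp (- (w * b%:C))).
Proof. by move=> pw b0; rewrite cintegral_sinker_onemcosI// onemcosI_pi. Qed.

End SineKernel.

(** * Poisson's integral for the Bessel functions *)

Section Poisson.
Context {R : realType}.
Notation mu := (@lebesgue_measure R).
Notation D0y := (`]0, +oo[%classic : set R).
Notation D01 := (`]0, 1[%classic : set R).
Notation Re := complex.Re.
Notation Im := complex.Im.
Notation cabs := ComplexField.Normc.normc.
Implicit Types (x t u s : R) (k n : nat) (y z : R[i]).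

Lemma powR_le_expR x : 0 < x -> exists2 K, 0 <= K & forall t, 0 < t -> t `^ x <= K * expR t.
Proof.
move=> x0; pose n := (Num.truncn x).
have xn : x <= n.+1%:R by exact/ltW/truncnS_gt.
exists (1 + n.+1`!%:R); first by rewrite addr_ge0.
move=> t t0; have e1 : 1 <= expR t by rewrite -expR0 ler_expR ltW.
have f0 : 0 <= n.+1`!%:R * expR t by rewrite mulr_ge0 ?expR_ge0.
have [t1|t1] := leP t 1.
  apply: (@le_trans _ _ 1); last by rewrite mulrDl mul1r; lra.
  have h := @ge0_ler_powR R x (ltW x0) t 1; rewrite powR1 in h.
  by apply: h; rewrite ?nnegrE ?(ltW t0).
apply: (@le_trans _ _ (t ^+ n.+1)).
  by rewrite -(powR_mulrn n.+1 (ltW t0)); exact: ler_powR (ltW t1) _ _ xn.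
have := expR_ge1Dxn n (ltW t0) => h.
have : t ^+ n.+1 / n.+1`!%:R <= expR t by lra.
by rewrite ler_pdivrMr ?ltr0n ?fact_gt0// => h2; rewrite mulrDl mul1r mulrC; lra.
Qed.

Lemma dvt_powRx x t : 0 < t -> is_derive t 1 (fun t : R => t `^ x) (x * t `^ (x - 1)).
Proof. exact: is_derive1_powR. Qed.

Lemma integrable_Gamma x : 0 < x ->
  mu.-integrable D0y (EFin \o (fun t => t `^ (x - 1) * expR (- t))).
Proof.
move=> x0; have [K K0 hK] := powR_le_expR (mulr_gt0 (ltr0n R 2) x0 : 0 < 2 * x).
apply: (@ler_integrable _ _ _ (fun t => (2 + 2 * K) * (t `^ (x - 1) / (1 + t `^ x) ^+ 2))) => //.
- apply: measurable_funTS; apply: measurable_funM; first exact: measurable_powR.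
  exact: measurableT_comp.
- move=> t /in0y t0; rewrite ger0_norm ?mulr_ge0 ?powR_ge0 ?expR_ge0//.
  rewrite mulrCA ler_wpM2l ?powR_ge0//.
  have T0 : 0 <= t `^ x by exact: powR_ge0.
  rewrite ler_pdivlMr ?exprn_gt0 ?ltr_pwDl// expRN mulrC ler_pdivrMr ?expR_gt0//.
  have e1 : 1 <= expR t by rewrite -expR0 ler_expR ltW.
  have := hK t t0; rewrite (mulrC 2) powRrM powR_mulrn// => h.
  have : (1 + t `^ x) ^+ 2 <= 2 + 2 * t `^ x ^+ 2.
    by have := sqr_ge0 (1 - t `^ x); nra.
  by move=> h2; rewrite mulrDl; nra.
- by apply: integrable_scale => //; exact: integrable_hat.
Qed.

Lemma Gamma_gt0 x : 0 < x -> 0 < Gamma x.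
Proof.
move=> x0; apply: Rintegral_gt0 => //.
- by rewrite lebesgue_measure_itv/= ltry oppr0 addye// ltry.
- exact: integrable_Gamma.
- by move=> t /in0y t0; rewrite mulr_gt0 ?powR_gt0 ?expR_gt0.
Qed.

Lemma cvgy_powR_expRN x : 0 < x -> t `^ x * expR (- t) @[t --> +oo] --> (0 : R).
Proof.
move=> x0; have x1 : 0 < x + 1 by rewrite addr_gt0.
have [K K0 hK] := powR_le_expR x1.
apply: (@squeeze_cvgr _ _ _ _ (cst 0) (fun t => K * t^-1)).
- near=> t; have t0 : 0 < t by near: t; exact: nbhs_pinfty_gt.
  rewrite /= mulr_ge0 ?powR_ge0 ?expR_ge0//= expRN.
  rewrite ler_pdivrMr ?expR_gt0// mulrAC ler_pdivlMr//.
  by have := hK t t0; rewrite -(mulr_powRB1 (ltW t0) x1) addrK mulrC.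
- exact: cvg_cst.
- rewrite -[X in _ --> X](mulr0 K); apply: cvgM; first exact: cvg_cst.
  by apply: cvgy_inv; exact: cvg_id.
Unshelve. all: by end_near. Qed.

Lemma GammaS x : 0 < x -> Gamma (x + 1) = x * Gamma x.
Proof.
move=> x0; have i0 := integrable_Gamma x0.
have x1 : 0 < x + 1 by rewrite addr_gt0.
have i1 := integrable_Gamma x1.
have de t : is_derive t 1 (fun t => expR (- t)) (- expR (- t)).
  by apply: dvt_eq (dvt_comp (is_derive_expR _) (dvtN (dvt_id t))) _; rewrite mulrN1.
pose f t := x * (t `^ (x - 1) * expR (- t)) - t `^ (x + 1 - 1) * expR (- t).
have dF t : 0 < t -> is_derive t 1 (fun t => t `^ x * expR (- t)) (f t).
  move=> t0; apply: dvt_eq (dvtM (dvt_powRx x t0) (de t)) _.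
  by rewrite /f addrK mulrN mulrA.
have cf t : 0 < t -> {for t, continuous f}.
  move=> t0; exact: dvt_continuous (dvtB (dvtZ x (dvtM (dvt_powRx (x - 1) t0) (de t)))
    (dvtM (dvt_powRx (x + 1 - 1) t0) (de t))).
have F0 : t `^ x * expR (- t) @[t --> 0^'+] --> 0 * expR (- 0).
  apply: cvgM; first exact: powR_cvg0.
  by apply: cvg_at_right_filter; exact: dvt_continuous (de 0).
have fi : mu.-integrable D0y (EFin \o f).
  by apply: integrable_sub => //; exact: integrable_scale.
have := Rintegral_FTC0y dF cf F0 (cvgy_powR_expRN x0) fi.
rewrite mul0r subrr /f RintegralB//; last exact: integrable_scale.
by rewrite RintegralZl// => /eqP; rewrite subr_eq0 => /eqP.
Qed.

Section weight.
Variable s : R.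
Hypothesis s1 : - 1 < s.

Definition jacobi_weight (u : R) := (1 - u ^+ 2) `^ s.
Notation wt := jacobi_weight.

Let onem_sqr_gt0 u : 0 < u < 1 -> 0 < 1 - u ^+ 2.
Proof. by move=> /andP[u0 u1]; rewrite subr_gt0 expr_lt1 ?ltW. Qed.

Lemma jacobi_weight_ge0 u : 0 <= wt u.
Proof. exact: powR_ge0. Qed.

Lemma measurable_jacobi_weight : measurable_fun [set: R] wt.
Proof.
apply: measurableT_comp (measurable_powR s) _.
by apply: measurable_funB => //; exact: measurable_funX.
Qed.

Lemma integrable_jacobi_weight : mu.-integrable D01 (EFin \o wt).
Proof.
apply: (@ler_integrable _ _ _ (fun u => 2 `^ `|s| * (1 - u) `^ s)) => //.
- exact: measurable_funTS measurable_jacobi_weight.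
- move=> u /in01/andP[u0 u1]; rewrite ger0_norm ?jacobi_weight_ge0// /wt.
  have -> : 1 - u ^+ 2 = (1 + u) * (1 - u) by ring.
  have h1 : 0 <= 1 + u by lra.
  have h2 : 0 <= 1 - u by lra.
  rewrite (powRM s h1 h2) ler_wpM2r ?powR_ge0//.
  apply: (@le_trans _ _ ((1 + u) `^ `|s|)).
    by rewrite ler_powR ?lerDl ?(ltW u0)// ler_norm.
  by apply: ge0_ler_powR; rewrite ?nnegrE ?addr_ge0 ?(ltW u0)//; lra.
- by apply: integrable_scale => //; exact: integrable_onem_powR.
Qed.

Lemma integrable_weightM (f : R -> R) (C : R) : measurable_fun D01 f ->
  (forall u, 0 < u < 1 -> `|f u| <= C) -> mu.-integrable D01 (EFin \o (fun u => wt u * f u)).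
Proof.
move=> mf fC.
apply: (@ler_integrable _ _ _ (fun u => C * wt u)) => //.
- by apply: measurable_funM => //; exact: measurable_funTS measurable_jacobi_weight.
- move=> u /in01 u01; rewrite normrM ger0_norm ?jacobi_weight_ge0// mulrC.
  by rewrite ler_wpM2r ?jacobi_weight_ge0// fC.
- by apply: integrable_scale => //; exact: integrable_jacobi_weight.
Qed.

Definition jacobi_moment k := \int[mu]_(u in D01) (wt u * u ^+ (2 * k)).

Lemma integrable_jacobi_moment k :
  mu.-integrable D01 (EFin \o (fun u => wt u * u ^+ (2 * k))).
Proof.
apply: (integrable_weightM (C := 1)).
  by apply: measurable_funTS; exact: measurable_funX.
move=> u /andP[u0 u1]; rewrite ger0_norm ?exprn_ge0 ?(ltW u0)//.
by rewrite exprn_ile1 ?(ltW u0)// ltW.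
Qed.

Lemma jacobi_moment0_gt0 : 0 < jacobi_moment 0.
Proof.
apply: Rintegral_gt0 => //.
- by rewrite lebesgue_measure_itv/= lte01 sube0.
- exact: integrable_jacobi_moment.
- by move=> u /in01 u01; rewrite muln0 expr0 mulr1 powR_gt0// onem_sqr_gt0.
Qed.

Let dvt_onem_sqr u : is_derive u 1 (fun u => 1 - u ^+ 2) (- (2 * u)).
Proof.
by apply: dvt_eq (dvtB (dvt_cst 1 u) (dvtX 2 (dvt_id u))) _; rewrite sub0r mulr1 expr1.
Qed.

Lemma cvg_onem_sqr_powR p : 0 < p -> (1 - u ^+ 2) `^ p @[u --> 1^'-] --> (0 : R).
Proof.
move=> p0; apply: (@squeeze_cvgr _ _ _ _ (cst 0) (fun u => 2 `^ p * (1 - u) `^ p)).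
- near=> u; have u1 : u < 1 by near: u; exact: nbhs_left_lt.
  have u0 : 0 < u by near: u; exact: nbhs_left_gt.
  rewrite powR_ge0/= -powRM ?subr_ge0 ?(ltW u1)//.
  apply: ge0_ler_powR; rewrite ?nnegrE ?(ltW p0)//; nra.
- exact: cvg_cst.
- rewrite -[X in _ --> X](mulr0 (2 `^ p)); apply: cvgM; first exact: cvg_cst.
  apply/cvg_at_leftP => a [a1 acvg].
  have /cvg_at_rightP := powR_cvg0 p0; apply; split; first by move=> n; rewrite subr_gt0.
  by rewrite -[X in _ --> X](subrr 1); apply: cvgB => //; exact: cvg_cst.
Unshelve. all: by end_near. Qed.

Lemma jacobi_momentS k :
  (k%:R + s + 3 / 2) * jacobi_moment k.+1 = (k%:R + 1 / 2) * jacobi_moment k.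
Proof.
have s10 : 0 < s + 1 by rewrite -ltrBlDr sub0r.
pose f u := (2 * k%:R + 1) * (wt u * u ^+ (2 * k)) -
  (2 * k%:R + 2 * s + 3) * (wt u * u ^+ (2 * k.+1)).
have dw u : 0 < u < 1 -> is_derive u 1 (fun u => (1 - u ^+ 2) `^ (s + 1))
    ((s + 1) * wt u * (- (2 * u))).
  move=> u01; apply: dvt_eq (dvt_powR (s + 1) (dvt_onem_sqr u) (onem_sqr_gt0 u01)) _.
  by rewrite addrK.
have dF u : 0 < u < 1 ->
    is_derive u 1 (fun u => u ^+ (2 * k).+1 * (1 - u ^+ 2) `^ (s + 1)) (f u).
  move=> u01; apply: dvt_eq (dvtM (dvtX (2 * k).+1 (dvt_id u)) (dw u u01)) _.
  have -> : (1 - u ^+ 2) `^ (s + 1) = (1 - u ^+ 2) * wt u.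
    by rewrite powRD ?gt_eqF ?onem_sqr_gt0 ?implybT// powRr1 ?ltW ?onem_sqr_gt0// mulrC.
  rewrite /f mulnS !exprS /= -[(2 * k).+1%:R]natr1 natrM; ring.
have cf u : 0 < u < 1 -> {for u, continuous f}.
  move=> u01; have dwt := dvt_powR s (dvt_onem_sqr u) (onem_sqr_gt0 u01).
  exact: dvt_continuous (dvtB (dvtZ _ (dvtM dwt (dvtX (2 * k) (dvt_id u))))
    (dvtZ _ (dvtM dwt (dvtX (2 * k.+1) (dvt_id u))))).
have F0 : u ^+ (2 * k).+1 * (1 - u ^+ 2) `^ (s + 1) @[u --> 0^'+] -->
    (0 ^+ (2 * k).+1 * (1 - 0 ^+ 2) `^ (s + 1) : R).
  apply: cvg_at_right_filter.
  have h0 : 0 < 1 - 0 ^+ 2 :> R by rewrite expr0n subr0.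
  exact: dvt_continuous (dvtM (dvtX (2 * k).+1 (dvt_id 0)) (dvt_powR (s + 1) (dvt_onem_sqr 0) h0)).
have F1 : u ^+ (2 * k).+1 * (1 - u ^+ 2) `^ (s + 1) @[u --> 1^'-] --> (1 ^+ (2 * k).+1 * 0 : R).
  apply: cvgM; last exact: cvg_onem_sqr_powR.
  by apply: cvg_at_left_filter; exact: dvt_continuous (dvtX (2 * k).+1 (dvt_id 1)).
have fi : mu.-integrable D01 (EFin \o f).
  by apply: integrable_sub => //; apply: integrable_scale => //; exact: integrable_jacobi_moment.
have := Rintegral_FTC01 dF cf F0 F1 fi.
rewrite /f RintegralB//; last 2 first.
- by apply: integrable_scale => //; exact: integrable_jacobi_moment.
- by apply: integrable_scale => //; exact: integrable_jacobi_moment.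
rewrite !RintegralZl//; try exact: integrable_jacobi_moment.
rewrite mulr0 expr0n/= mul0r subrr -!/(jacobi_moment _).
by move: (jacobi_moment _) (jacobi_moment _) => X Y; lra.
Qed.

End weight.
Definition cexp_psum n z : R[i] := \sum_(k < n) (k`!%:R^-1)%:C * z ^+ k.

Definition ccosh z : R[i] := (cexp z + cexp (- z)) / 2.

Definition ccosh_psum n z : R[i] := \sum_(k < n) ((2 * k)`!%:R^-1)%:C * z ^+ (2 * k).

Lemma cdvtX n x : is_cderive (fun x => x%:C ^+ n) x (n%:R%:C * x%:C ^+ n.-1).
Proof.
have -> : (fun x => x%:C ^+ n) = (fun x : R => (x ^+ n)%:C).
  by apply/funext => u; rewrite rmorphXn.
rewrite -rmorphXn -rmorphM; split => /=; last exact: dvt_cst.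
by apply: dvt_eq (dvtX n (dvt_id x)) _; rewrite mulr1.
Qed.

Lemma dvt_cexp_psum n z x :
  is_cderive (fun x => cexp_psum n.+1 (z * x%:C)) x (z * cexp_psum n (z * x%:C)).
Proof.
elim: n => [|n IH].
  rewrite /cexp_psum big_ord0 mulr0.
  under eq_fun do rewrite big_ord1 expr0 mulr1.
  exact: cdvt_cst.
rewrite /cexp_psum; under eq_fun do rewrite big_ord_recr /=.
rewrite [X in _ * X]big_ord_recr /= mulrDr; apply: cdvtD IH _.
have -> : (fun u : R => (n.+1`!%:R^-1)%:C * (z * u%:C) ^+ n.+1) =
    (fun u : R => (n.+1`!%:R^-1)%:C * z ^+ n.+1 * u%:C ^+ n.+1).
  by apply/funext => u; rewrite exprMn mulrA.
have := cdvtZ ((n.+1`!%:R^-1)%:C * z ^+ n.+1) (cdvtX n.+1 x); congr is_cderive.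
have -> : (n.+1`!%:R^-1)%:C = (n`!%:R^-1)%:C * (n.+1%:R^-1)%:C :> R[i].
  by rewrite -rmorphM; congr (_%:C); rewrite factS natrM invfM mulrC.
have h : (n.+1%:R^-1)%:C * n.+1%:R%:C = 1 :> R[i].
  by rewrite -rmorphM mulVf// pnatr_eq0.
rewrite /= exprS exprMn.
transitivity ((n`!%:R^-1)%:C * z * z ^+ n * x%:C ^+ n * ((n.+1%:R^-1)%:C * n.+1%:R%:C)).
  by ring.
by rewrite h; ring.
Qed.

(* Differentiating [e^(- z x)] times a Taylor polynomial of [e^(z x)] leaves a
   single monomial. *)
Lemma dvt_exp_remainder n z x :
  is_cderive (fun x => cexp (- z * x%:C) * cexp_psum n.+1 (z * x%:C)) x
    (- z * cexp (- z * x%:C) * ((n`!%:R^-1)%:C * (z * x%:C) ^+ n)).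
Proof.
have := cdvtM (cdvt_cexp (- z) x) (dvt_cexp_psum n z x); congr is_cderive.
by rewrite {1}/cexp_psum big_ord_recr /= -/(cexp_psum n _); ring.
Qed.

Lemma cabsX z n : cabs (z ^+ n) = cabs z ^+ n.
Proof.
elim: n => [|n IH]; first by rewrite !expr0 ComplexField.Normc.normc1.
by rewrite !exprS cabsM IH.
Qed.

Lemma exp_remainder_le n z : cabs (cexp_psum n.+1 z - cexp z) <=
  2 * (expR (cabs z) ^+ 2 * cabs z * (cabs z ^+ n / n`!%:R)).
Proof.
pose r := cabs z.
have r0 : 0 <= r by exact: cabs_ge0.
pose B := expR r * r * (r ^+ n / n`!%:R).
pose G x := cexp (- z * x%:C) * cexp_psum n.+1 (z * x%:C).
pose G' x := - z * cexp (- z * x%:C) * ((n`!%:R^-1)%:C * (z * x%:C) ^+ n).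
have dG x : is_cderive G x (G' x) by exact: dvt_exp_remainder.
have GB x : 0 < x < 1 -> cabs (G' x) <= B.
  move=> /andP[x0 x1].
  rewrite /G' (cabsM (- z * _)) (cabsM (- z)) cabs_cexp (cabsM _%:C) cabsX (cabsM z).
  rewrite !cabs_real normcN -/r.
  rewrite (ger0_norm (ltW x0)) ger0_norm ?invr_ge0//.
  have -> : B = r * expR r * ((n`!%:R)^-1 * r ^+ n) by rewrite /B; ring.
  apply: ler_pM; rewrite ?mulr_ge0 ?expR_ge0 ?invr_ge0 ?exprn_ge0 ?mulr_ge0 ?(ltW x0)//.
    rewrite ler_wpM2l// ler_expR (le_trans (ler_norm _))// (le_trans (Re_le_cabs _))//.
    by rewrite cabsM normcN cabs_real gtr0_norm// ler_piMr// ltW.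
  rewrite ler_wpM2l ?invr_ge0// lerXn2r ?nnegrE ?mulr_ge0 ?(ltW x0)//.
  by rewrite ler_piMr// ltW.
have MV (g g' : R -> R) : (forall x, is_derive x 1 g (g' x)) ->
    (forall x, 0 < x < 1 -> `|g' x| <= B) -> `|g 1 - g 0| <= B.
  move=> dg gB.
  have cg : {within `[0, 1], continuous g}.
    by apply: continuous_in_subspaceT => x _; exact: dvt_continuous (dg x).
  have [x x01 ->] := MVT ltr01 (fun x _ => dg x) cg.
  by rewrite subr0 mulr1 gB//; move: x01; rewrite in_itv.
have E1 : cabs (G 1 - G 0) <= 2 * B.
  rewrite (le_trans (cabs_le_ReIm _))// Re_sub Im_sub mulr_natl mulr2n lerD//.
    apply: (MV (fun x => Re (G x)) (fun x => Re (G' x))) => x; first by have [] := dG x.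
    by move=> /GB; exact/le_trans/Re_le_cabs.
  apply: (MV (fun x => Im (G x)) (fun x => Im (G' x))) => x; first by have [] := dG x.
  by move=> /GB; exact/le_trans/Im_le_cabs.
have GE : G 1 - G 0 = cexp (- z) * (cexp_psum n.+1 z - cexp z).
  rewrite /G !mulr1 !mulr0 cexp0 mul1r mulrBr (mulrC _ (cexp z)) cexp_mulN; congr (_ - _).
  rewrite /cexp_psum big_ord_recl expr0 mulr1 big1 ?addr0; last first.
    by move=> k _; rewrite /= expr0n mulr0.
  by rewrite fact0 invr1.
have -> : cexp_psum n.+1 z - cexp z = cexp z * (G 1 - G 0).
  by rewrite GE mulrA cexp_mulN mul1r.
rewrite cabsM cabs_cexp.
apply: (@le_trans _ _ (expR r * (2 * B))).
  apply: ler_pM; rewrite ?expR_ge0 ?cabs_ge0// ler_expR.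
  by rewrite (le_trans (ler_norm _))// Re_le_cabs.
by rewrite /B -/r le_eqVlt; apply/orP; left; apply/eqP; ring.
Qed.

Lemma ccosh_psumE n z : ccosh_psum n z = (cexp_psum (2 * n) z + cexp_psum (2 * n) (- z)) / 2.
Proof.
elim: n => [|n IH]; first by rewrite /ccosh_psum /cexp_psum !big_ord0 addr0 mul0r.
rewrite /ccosh_psum big_ord_recr /= -/(ccosh_psum n z) IH mulnS /cexp_psum !big_ord_recr /=.
have e1 : (- z) ^+ (2 * n) = z ^+ (2 * n) by rewrite !exprM sqrrN.
have e2 : (- z) ^+ (2 * n).+1 = - z ^+ (2 * n).+1 by rewrite !exprS e1 mulNr.
rewrite e1 e2 mulrN; move: (_ * z ^+ (2 * n)) (_ * z ^+ (2 * n).+1) => T O.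
move: (\sum_(i < 2 * n) _) (\sum_(i < 2 * n) _) => A B.
have h2 : (2 : R[i]) != 0 by rewrite pnatr_eq0.
by field.
Qed.

Lemma cvg_ccosh_psum (r : R) : 0 <= r -> exists2 e : nat -> R, e n @[n --> \oo] --> 0 &
  forall n z, cabs z <= r -> cabs (ccosh_psum n.+1 z - ccosh z) <= e n.
Proof.
move=> r0; pose e n := 2 * (expR r ^+ 2 * r * exp_coeff r n).
have ecvg : e n @[n --> \oo] --> 0.
  rewrite -[X in _ --> X](mulr0 2); apply: cvgM; first exact: cvg_cst.
  rewrite -[X in _ --> X](mulr0 (expR r ^+ 2 * r)); apply: cvgM; first exact: cvg_cst.
  exact: cvg_series_cvg_0 (is_cvg_series_exp_coeff r).
have ub n z : cabs z <= r -> cabs (cexp_psum n.+1 z - cexp z) <= e n.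
  move=> zr; apply: le_trans (exp_remainder_le n z) _.
  rewrite /e /exp_coeff ler_wpM2l//.
  have z0 := cabs_ge0 z.
  apply: ler_pM; rewrite ?mulr_ge0 ?exprn_ge0 ?expR_ge0 ?invr_ge0//.
    by apply: ler_pM => //; rewrite ?exprn_ge0 ?expR_ge0// lerXn2r ?nnegrE ?expR_ge0// ler_expR.
  by rewrite ler_pM2r ?invr_gt0 ?ltr0n ?fact_gt0// lerXn2r.
exists (fun n => e (2 * n).+1).
  have := cvg_comp _ _ (_ : (2 * n).+1 @[n --> \oo] --> \oo) ecvg; apply.
  move=> A [N _ NA]; exists N => // m /= Nm; apply: NA => /=.
  by rewrite (leq_trans Nm)// mul2n -addnn (leq_trans (leq_addr m m)).
move=> n z zr.
have -> : ccosh_psum n.+1 z - ccosh z = ((cexp_psum (2 * n).+2 z - cexp z) +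
    (cexp_psum (2 * n).+2 (- z) - cexp (- z))) / 2.
  by rewrite ccosh_psumE mulnS /ccosh; ring.
rewrite cabsM; have -> : cabs (2^-1 : R[i]) = 2^-1.
  have -> : (2^-1 : R[i]) = (2^-1)%:C by rewrite fmorphV rmorph_nat.
  by rewrite cabs_real ger0_norm.
rewrite ler_pdivrMr// mulr_natr mulr2n (le_trans (le_normcD _ _))// lerD// ub//.
by rewrite normcN.
Qed.

Section bessel_series.
Variable m : R.
Hypothesis m1 : - 2^-1 < m.
Notation wt := (jacobi_weight (m - 2^-1)).
Notation M := (jacobi_moment (m - 2^-1)).

Let s1 : - 1 < m - 2^-1. Proof. by move: m1; lra. Qed.

Definition poisson_const := (M 0 * Gamma (m + 1))^-1.

Let Gamma_mk_gt0 k : 0 < Gamma (m + k%:R + 1).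
Proof.
by apply: Gamma_gt0; have := ler0n R k; move: (k%:R) m1 => K; lra.
Qed.

Lemma bessel_coeffE k : bessel_coeff m k =
  poisson_const * (M k * 4 ^+ k / (2 * k)`!%:R).
Proof.
have M0 := jacobi_moment0_gt0 s1.
elim: k => [|k IH].
  have G0 := Gamma_mk_gt0 0; rewrite addr0 in G0.
  rewrite /bessel_coeff /poisson_const muln0 fact0 expr0 addr0.
  by field; rewrite !gt_eqF.
have Gk := Gamma_mk_gt0 k.
have k0 := ler0n R k.
have mk0 : 0 < m + k%:R + 1 by move: (k%:R) k0 m1 => K; lra.
have GS : Gamma (m + k.+1%:R + 1) = (m + k%:R + 1) * Gamma (m + k%:R + 1).
  by rewrite -GammaS// -natr1 addrA.
have fk : 0 < (k`!)%:R :> R by rewrite ltr0n fact_gt0.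
have f2k : 0 < (2 * k)`!%:R :> R by rewrite ltr0n fact_gt0.
have cS : bessel_coeff m k.+1 = bessel_coeff m k / ((k%:R + 1) * (m + k%:R + 1)).
  rewrite /bessel_coeff GS factS natrM -natr1; field.
  by rewrite !gt_eqF// ltr_wpDl.
have := jacobi_momentS s1 k.
have -> : k%:R + (m - 2^-1) + 3 / 2 = m + k%:R + 1 by field.
move=> MS.
have -> : M k.+1 = (k%:R + 1 / 2) * M k / (m + k%:R + 1).
  by rewrite -MS; field; rewrite gt_eqF.
rewrite cS IH mulnS !factS !natrM exprS -[(2 * k).+2%:R]natr1 -[(2 * k).+1%:R]natr1 natrM.
by field; rewrite !gt_eqF// ?ltr_wpDl// ?mulr_ge0// !addr_gt0//.
Qed.

Definition bessel_psum n z : R[i] :=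
  \sum_(k < n) (bessel_coeff m k)%:C * (z / 2) ^+ (2 * k).

End bessel_series.
End Poisson.

Section Bessel.
Context {R : realType}.
Notation mu := (@lebesgue_measure R).
Notation D0y := (`]0, +oo[%classic : set R).
Notation D01 := (`]0, 1[%classic : set R).
Notation Re := complex.Re.
Notation Im := complex.Im.
Notation cabs := ComplexField.Normc.normc.
Implicit Types (x t u s : R) (k n : nat) (y z : R[i]).
Variable m : R.
Hypothesis m1 : - 2^-1 < m.
Notation wt := (jacobi_weight (m - 2^-1)).
Notation M := (jacobi_moment (m - 2^-1)).
Notation poisson_const := (poisson_const m).
Notation bessel_psum := (bessel_psum m).

Let s1 : - 1 < m - 2^-1. Proof. by move: m1; lra. Qed.

Lemma ccoshE z : ccosh z = (2^-1)%:C * (cexp z + cexp (- z)).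
Proof. by rewrite /ccosh mulrC fmorphV rmorph_nat. Qed.

Lemma Re_ccosh z : Re (ccosh z) = (expR (Re z) + expR (- Re z)) / 2 * cos (Im z).
Proof. by rewrite ccoshE Re_scale Re_add !Re_cexp Re_opp Im_opp cosN; field. Qed.

Lemma Im_ccosh z : Im (ccosh z) = (expR (Re z) - expR (- Re z)) / 2 * sin (Im z).
Proof. by rewrite ccoshE Im_scale Im_add !Im_cexp Re_opp Im_opp sinN; field. Qed.

Lemma cabs_ccosh z : cabs (ccosh z) <= expR (cabs z).
Proof.
rewrite ccoshE cabsM cabs_real ger0_norm ?invr_ge0//.
rewrite mulrC ler_pdivrMr// mulr_natr mulr2n (le_trans (le_normcD _ _))// !cabs_cexp.
by rewrite lerD// ler_expR (le_trans (ler_norm _))// (le_trans (Re_le_cabs _))// ?normcN.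
Qed.

Lemma measurable_ccosh z :
  measurable_fun [set: R] (fun u => Re (ccosh (z * u%:C))) /\
  measurable_fun [set: R] (fun u => Im (ccosh (z * u%:C))).
Proof.
have me c : measurable_fun [set: R] (fun u => expR (c * u)).
  by apply: measurableT_comp => //; exact: mulrl_measurable.
have mme c : measurable_fun [set: R] (fun u => expR (- (c * u))).
  by under eq_fun do rewrite -mulNr; exact: me.
split.
  under eq_fun do rewrite Re_ccosh (mulrC z) Re_scale Im_scale mulrC (mulrC _ (Re z)) (mulrC _ (Im z)).
  apply: measurable_funM.
    by apply: measurableT_comp measurable_cosR _; exact: mulrl_measurable.
  by apply: measurable_funM => //; apply: measurable_funD.
under eq_fun do rewrite Im_ccosh (mulrC z) Re_scale Im_scale mulrC (mulrC _ (Re z)) (mulrC _ (Im z)).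
apply: measurable_funM.
  by apply: measurableT_comp measurable_sinR _; exact: mulrl_measurable.
by apply: measurable_funM => //; apply: measurable_funB.
Qed.

Lemma integrable_weight_ccosh_psum n z :
  mu.-integrable D01 (EFin \o (fun u => wt u * Re (ccosh_psum n (z * u%:C)))) /\
  mu.-integrable D01 (EFin \o (fun u => wt u * Im (ccosh_psum n (z * u%:C)))) /\
  Re (bessel_psum n z) = poisson_const * \int[mu]_(u in D01) (wt u * Re (ccosh_psum n (z * u%:C))) /\
  Im (bessel_psum n z) = poisson_const * \int[mu]_(u in D01) (wt u * Im (ccosh_psum n (z * u%:C))).
Proof.
have M0 k := integrable_jacobi_moment s1 k.
elim: n => [|n [ir [ii [er ei]]]].
  rewrite /bessel_psum /ccosh_psum !big_ord0 /=.
  have z0 (f : R -> R) : (forall u, f u = 0) -> mu.-integrable D01 (EFin \o f) /\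
      \int[mu]_(u in D01) f u = 0.
    move=> f0; have -> : f = cst 0 by exact/funext.
    by split; [exact: integrable0|rewrite /Rintegral integral0].
  have [|ir er] := z0 (fun u => wt u * Re (\sum_(k < 0)
      ((2 * k)`!%:R^-1)%:C * (z * u%:C) ^+ (2 * k))).
    by move=> u; rewrite big_ord0 /= mulr0.
  have [|ii ei] := z0 (fun u => wt u * Im (\sum_(k < 0)
      ((2 * k)`!%:R^-1)%:C * (z * u%:C) ^+ (2 * k))).
    by move=> u; rewrite big_ord0 /= mulr0.
  by rewrite er ei mulr0; do ![split].
pose c := (2 * n)`!%:R^-1 : R.
have rE u : wt u * Re (ccosh_psum n.+1 (z * u%:C)) = wt u * Re (ccosh_psum n (z * u%:C)) +
    c * Re (z ^+ (2 * n)) * (wt u * u ^+ (2 * n)).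
  rewrite /ccosh_psum big_ord_recr /= -/(ccosh_psum n _) Re_add Re_scale exprMn -rmorphXn.
  by rewrite [_ ^+ _ * _%:C]mulrC Re_scale -/c; ring.
have iE u : wt u * Im (ccosh_psum n.+1 (z * u%:C)) = wt u * Im (ccosh_psum n (z * u%:C)) +
    c * Im (z ^+ (2 * n)) * (wt u * u ^+ (2 * n)).
  rewrite /ccosh_psum big_ord_recr /= -/(ccosh_psum n _) Im_add Im_scale exprMn -rmorphXn.
  by rewrite [_ ^+ _ * _%:C]mulrC Im_scale -/c; ring.
have cE : (bessel_coeff m n)%:C * (z / 2) ^+ (2 * n) = (poisson_const * (M n * c))%:C * z ^+ (2 * n).
  rewrite (bessel_coeffE m1) exprMn.
  have -> : (2^-1 : R[i]) ^+ (2 * n) = ((4 ^+ n)^-1)%:C.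
    rewrite exprM -exprVn rmorphXn; congr (_ ^+ _).
    have -> : (4 : R) = 2 ^+ 2 by rewrite -natrX.
    by rewrite fmorphV rmorphXn rmorph_nat exprVn.
  rewrite mulrCA -rmorphM mulrC; congr (_ * _); congr (_%:C).
  by rewrite -/c; field; rewrite expf_neq0.
have m01 : measurable D01 by [].
have i2 (q : R) := integrable_scale q m01 (M0 n).
split; first by apply: eq_Rintegrable (integrable_add m01 ir (i2 (c * Re (z ^+ (2 * n))))) => // u _; rewrite rE.
split; first by apply: eq_Rintegrable (integrable_add m01 ii (i2 (c * Im (z ^+ (2 * n))))) => // u _; rewrite iE.
rewrite /bessel_psum big_ord_recr /= -/(bessel_psum n z) cE.
split.
  rewrite Re_add er Re_scale; under [in RHS]eq_Rintegral do rewrite rE.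
  by rewrite RintegralD// RintegralZl// -/(jacobi_moment _ _); ring.
rewrite Im_add ei Im_scale; under [in RHS]eq_Rintegral do rewrite iE.
by rewrite RintegralD// RintegralZl// -/(jacobi_moment _ _); ring.
Qed.

Lemma cvg_bessel_psum z :
  Re (bessel_psum n z) @[n --> \oo] -->
    poisson_const * \int[mu]_(u in D01) (wt u * Re (ccosh (z * u%:C))) /\
  Im (bessel_psum n z) @[n --> \oo] -->
    poisson_const * \int[mu]_(u in D01) (wt u * Im (ccosh (z * u%:C))).
Proof.
have [e ecvg eB] := cvg_ccosh_psum (cabs_ge0 z).
have zu u : 0 < u < 1 -> cabs (z * u%:C) <= cabs z.
  move=> /andP[u0 u1]; rewrite cabsM cabs_real gtr0_norm//.
  by rewrite ler_piMr ?cabs_ge0// ltW.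
have key (p : R[i] -> R) : (forall y, `|p y| <= cabs y) ->
    (forall y w, p (y - w) = p y - p w) ->
    measurable_fun D01 (fun u => p (ccosh (z * u%:C))) ->
    (forall n, mu.-integrable D01 (EFin \o (fun u => wt u * p (ccosh_psum n (z * u%:C))))) ->
    \int[mu]_(u in D01) (wt u * p (ccosh_psum n (z * u%:C))) @[n --> \oo] -->
    \int[mu]_(u in D01) (wt u * p (ccosh (z * u%:C))).
  move=> pc pB mp ipn.
  have ip0 : mu.-integrable D01 (EFin \o (fun u => wt u * p (ccosh (z * u%:C)))).
    apply: (integrable_weightM s1 (C := expR (cabs z))) => // u u01.
    rewrite (le_trans (pc _))// (le_trans (cabs_ccosh _))// ler_expR; exact: zu.
  have M0 : 0 <= M 0 by exact/ltW/jacobi_moment0_gt0.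
  rewrite -cvg_shiftS; apply/cvgrPdist_le => /= d d0.
  have d1 : 0 < d / (M 0 + 1) by rewrite divr_gt0// ltr_wpDl.
  move/cvgr0Pnorm_le : ecvg => /(_ _ d1) ecvg.
  near=> n; rewrite -RintegralB//.
  apply: le_trans (le_normr_Rintegral _ _) _ => //; first exact: integrable_sub.
  apply: (@le_trans _ _ (\int[mu]_(u in D01) (d / (M 0 + 1) * wt u))).
    apply: le_Rintegral => //.
    - exact: integrable_norm (integrable_sub _ ip0 (ipn n.+1)).
    - by apply: integrable_scale => //; exact: integrable_jacobi_weight.
    move=> u /in01 u01; rewrite -mulrBr -pB normrM ger0_norm ?jacobi_weight_ge0// mulrC.
    rewrite ler_wpM2r ?jacobi_weight_ge0// (le_trans (pc _))// -normcN opprB.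
    rewrite (le_trans (eB n _ (zu u u01)))// (le_trans (ler_norm _))//.
    by near: n.
  rewrite RintegralZl//; last exact: integrable_jacobi_weight.
  have -> : \int[mu]_(u in D01) wt u = M 0.
    by apply: eq_Rintegral => u _; rewrite muln0 expr0 mulr1.
  by rewrite mulrAC ler_pdivrMr ?ltr_wpDl// mulrDr mulr1 lerDl ltW.
have [mre mim] := measurable_ccosh z.
have iw n := integrable_weight_ccosh_psum n z.
split.
  rewrite (_ : (fun n => _) = (fun n => poisson_const *
      \int[mu]_(u in D01) (wt u * Re (ccosh_psum n (z * u%:C))))).
    apply: cvgM; first exact: cvg_cst.
    apply: key; [exact: Re_le_cabs|exact: Re_sub|exact: measurable_funTS|].
    by move=> n; have [] := iw n.
  by apply/funext => n; have [_ [_ []]] := iw n.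
rewrite (_ : (fun n => _) = (fun n => poisson_const *
    \int[mu]_(u in D01) (wt u * Im (ccosh_psum n (z * u%:C))))).
  apply: cvgM; first exact: cvg_cst.
  apply: key; [exact: Im_le_cabs|exact: Im_sub|exact: measurable_funTS|].
  by move=> n; have [_ []] := iw n.
by apply/funext => n; have [_ [_ []]] := iw n.
Unshelve. all: by end_near. Qed.

End Bessel.

Section Bessel_integrals.
Context {R : realType}.
Notation mu := (@lebesgue_measure R).
Notation D0y := (`]0, +oo[%classic : set R).
Notation D01 := (`]0, 1[%classic : set R).
Notation Re := complex.Re.
Notation Im := complex.Im.
Notation cabs := ComplexField.Normc.normc.
Implicit Types (x t u s : R) (k n : nat) (y z : R[i]).
Variable m : R.
Hypothesis m1 : - 2^-1 < m.
Notation wt := (jacobi_weight (m - 2^-1)).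
Notation M := (jacobi_moment (m - 2^-1)).

Let s1 : - 1 < m - 2^-1. Proof. by move: m1; lra. Qed.

Lemma measurable_cosM x : measurable_fun [set: R] (fun u => cos (x * u)).
Proof. by apply: measurableT_comp measurable_cosR _; exact: mulrl_measurable. Qed.

Definition jacobi_cos x := \int[mu]_(u in D01) (wt u * cos (x * u)).

Lemma integrable_jacobi_cos x : mu.-integrable D01 (EFin \o (fun u => wt u * cos (x * u))).
Proof.
apply: (integrable_weightM s1 (C := 1)); first exact: measurable_funTS (measurable_cosM x).
by move=> u _; rewrite ler_norml cos_geN1 cos_le1.
Qed.

Lemma besselJE x :
  besselJ m x = (x / 2) `^ m * (poisson_const m * jacobi_cos x).
Proof.
rewrite /besselJ; congr (_ * _); apply: (@cvg_lim R) => //.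
have [+ _] := cvg_bessel_psum m1 (0 +i* x).
have -> : (fun n => Re (bessel_psum m n (0 +i* x))) =
    series (fun k => (-1) ^+ k * bessel_coeff m k * (x / 2) ^+ (2 * k)).
  apply/funext => n; rewrite /series /= big_mkord /bessel_psum.
  elim: n => [|n IH]; first by rewrite !big_ord0.
  rewrite !big_ord_recr /= Re_add IH Re_scale; congr (_ + _).
  rewrite mulrAC mulrC; congr (_ * _).
  have -> : ((0 +i* x) / 2 : R[i]) = 0 +i* (x / 2).
    have -> : (2^-1 : R[i]) = (2^-1)%:C by rewrite fmorphV rmorph_nat.
    by rewrite mulrC; apply: complex_ext; rewrite ?Re_scale ?Im_scale /= ?mulr0// mulrC.
  rewrite !exprM.
  have -> : ((0 +i* (x / 2)) ^+ 2 : R[i]) = (- (x / 2) ^+ 2)%:C.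
    by apply: complex_ext; rewrite expr2 ?Re_mul ?Im_mul /=; ring.
  have -> : ((- (x / 2) ^+ 2)%:C ^+ n : R[i]) = ((- (x / 2) ^+ 2) ^+ n)%:C by rewrite rmorphXn.
  by rewrite /= -[- _ ^+ 2]mulN1r exprMn.
congr (_ --> _); congr (_ * _); apply: eq_Rintegral => u _.
have -> : ((0 +i* x) * u%:C : R[i]) = 0 +i* (x * u).
  by apply: complex_ext; rewrite ?Re_mul ?Im_mul /=; ring.
by rewrite Re_ccosh /= oppr0 expR0; field.
Qed.

Definition jacobi_ccosh z : R[i] := cintegral D01 (fun u => (wt u)%:C * ccosh (z * u%:C)).

Lemma cintegrable_jacobi_ccosh z :
  cintegrable D01 (fun u => (wt u)%:C * ccosh (z * u%:C)).
Proof.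
have [mr mi] := measurable_ccosh z.
have zu u : 0 < u < 1 -> cabs (ccosh (z * u%:C)) <= expR (cabs z).
  move=> /andP[u0 u1]; apply: le_trans (cabs_ccosh _) _; rewrite ler_expR cabsM cabs_real gtr0_norm//.
  by rewrite ler_piMr ?cabs_ge0// ltW.
split.
  apply: eq_Rintegrable (integrable_weightM s1 (f := fun u => Re (ccosh (z * u%:C)))
    (C := expR (cabs z)) _ _) => //.
  - by move=> u _; rewrite Re_scale.
  - exact: measurable_funTS.
  - by move=> u /zu; exact/le_trans/Re_le_cabs.
apply: eq_Rintegrable (integrable_weightM s1 (f := fun u => Im (ccosh (z * u%:C)))
  (C := expR (cabs z)) _ _) => //.
- by move=> u _; rewrite Im_scale.
- exact: measurable_funTS.
- by move=> u /zu; exact/le_trans/Im_le_cabs.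
Qed.

Lemma besselIE z :
  besselI m z = cpow (z / 2) m%:C * ((poisson_const m)%:C * jacobi_ccosh z).
Proof.
rewrite /besselI; congr (_ * _).
have [cr ci] := cvg_bessel_psum m1 z.
have E : series (fun k => (bessel_coeff m k)%:C * (z / 2) ^+ (2 * k) : R[i]^o) =
    (fun n => bessel_psum m n z).
  by apply/funext => n; rewrite /series /= big_mkord.
rewrite E; apply: cvg_complex.
  rewrite Re_scale Re_cintegral; move: cr; congr (_ --> _); congr (_ * _).
  by apply: eq_Rintegral => u _; rewrite Re_scale.
rewrite Im_scale Im_cintegral; move: ci; congr (_ --> _); congr (_ * _).
by apply: eq_Rintegral => u _; rewrite Im_scale.
Qed.

Lemma norm_jacobi_cos_le x : `|jacobi_cos x| <= M 0.
Proof.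
apply: le_trans (le_normr_Rintegral _ (integrable_jacobi_cos x)) _ => //.
apply: le_Rintegral => //.
- exact: integrable_norm (integrable_jacobi_cos x).
- exact: integrable_jacobi_moment.
move=> u _; rewrite muln0 expr0 mulr1 normrM ger0_norm ?jacobi_weight_ge0//.
by rewrite ler_piMr ?jacobi_weight_ge0// ler_norml cos_geN1 cos_le1.
Qed.

Lemma jacobi_cos_lipschitz x (x' : R) : `|jacobi_cos x - jacobi_cos x'| <= M 0 * `|x - x'|.
Proof.
have ix := integrable_jacobi_cos x; have iy := integrable_jacobi_cos x'.
rewrite /jacobi_cos -RintegralB//.
have ixy : mu.-integrable D01 (EFin \o (fun u => wt u * cos (x * u) - wt u * cos (x' * u))).
  exact: integrable_sub.
apply: le_trans (le_normr_Rintegral _ ixy) _ => //.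
rewrite mulrC -RintegralZl//; last exact: integrable_jacobi_moment.
apply: le_Rintegral => //.
- exact: integrable_norm ixy.
- by apply: integrable_scale => //; exact: integrable_jacobi_moment.
move=> u /in01/andP[u0 u1]; rewrite muln0 expr0 mulr1 -mulrBr normrM ger0_norm ?jacobi_weight_ge0//.
rewrite mulrC ler_wpM2r ?jacobi_weight_ge0//.
apply: (@le_trans _ _ `|x * u - x' * u|).
  have h := @lipschitz_is_derive R (@cos R) (fun x => - sin x) 1 (x * u) (x' * u).
  rewrite -[leRHS]mul1r; apply: h => p.
  by rewrite normrN ler_norml sin_geN1 sin_le1.
by rewrite -mulrBl normrM (gtr0_norm u0) ler_piMr// ltW.
Qed.

Lemma continuous_jacobi_cos : continuous jacobi_cos.
Proof.
move=> x; apply/cvgrPdist_le => /= e e0.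
have M0 : 0 < M 0 by exact: jacobi_moment0_gt0.
near=> x'; apply: le_trans (jacobi_cos_lipschitz _ _) _.
rewrite mulrC -ler_pdivlMr//; near: x'.
by apply: (@cvgr_dist_le _ _ _ _ _ (fun x => x) x (@cvg_id _ _)); rewrite divr_gt0.
Unshelve. all: by end_near. Qed.

Lemma jacobi_cos_decay : exists2 e, 0 < e <= 2^-1 &
  exists2 C, 0 <= C & forall x, 0 < x -> `|jacobi_cos x| <= C * x `^ (- e).
Proof.
pose nu := m - 2^-1.
pose e := Num.min 2^-1 ((nu + 1) / 2).
have e0 : 0 < e by rewrite lt_min invr_gt0 ltr0n divr_gt0//; move: s1; rewrite -/nu; lra.
have e2 : e <= 2^-1 by rewrite ge_min lexx.
have e3 : e <= (nu + 1) / 2 by rewrite ge_min lexx orbT.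
have q1 : - 1 < nu - e by move: s1; rewrite -/nu; lra.
pose W := \int[mu]_(u in D01) jacobi_weight (nu - e) u.
have iW : mu.-integrable D01 (EFin \o jacobi_weight (nu - e)) by exact: integrable_jacobi_weight.
have W0 : 0 <= W by apply: Rintegral_ge0 => u _; exact: powR_ge0.
have M0 : 0 <= M 0 by exact/ltW/jacobi_moment0_gt0.
exists e; first by rewrite e0.
exists (M 0 + 1 + 4 * `|nu| * W); first by rewrite !addr_ge0 ?mulr_ge0.
move=> x x0; have xe : 0 < x `^ (- e) by exact: powR_gt0.
have [xle1|x1] := leP x 1.
  apply: le_trans (norm_jacobi_cos_le x) _.
  have h1 : 1 <= x `^ (- e).
    by rewrite -[leLHS](powRr0 x); apply: ger_powR; rewrite ?x0//; lra.
  have h2 : 0 <= 4 * `|nu| * W by rewrite !mulr_ge0.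
  nra.
pose d u := sin (x * u) - sin x.
have dd u : is_derive u 1 d (x * cos (x * u)).
  by apply: dvt_eq (dvtB (dvt_sinM x u) (dvt_cst (sin x) u)) _; rewrite subr0.
pose g u := nu * (1 - u ^+ 2) `^ (nu - 1) * (- (2 * u)) * d u.
pose f u := g u + x * (wt u * cos (x * u)).
have p1 u : 0 < u < 1 -> 0 < 1 - u ^+ 2.
  by move=> /andP[u0 u1]; rewrite subr_gt0 expr_lt1 ?ltW.
have dq u : is_derive u 1 (fun u : R => 1 - u ^+ 2) (- (2 * u)).
  by apply: dvt_eq (dvtB (dvt_cst 1 u) (dvtX 2 (dvt_id u))) _; rewrite sub0r mulr1 expr1.
have dw u : 0 < u < 1 -> is_derive u 1 wt (nu * (1 - u ^+ 2) `^ (nu - 1) * (- (2 * u))).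
  by move=> u01; exact: (dvt_powR nu (dq u) (p1 u u01)).
have dF u : 0 < u < 1 -> is_derive u 1 (fun u => wt u * d u) (f u).
  by move=> u01; apply: dvt_eq (dvtM (dw u u01) (dd u)) _; rewrite /f /g; ring.
have cf u : 0 < u < 1 -> {for u, continuous f}.
  move=> u01; exact: dvt_continuous (dvtD (dvtM (dvtM (dvtZ nu (dvt_powR (nu - 1) (dq u) (p1 u u01)))
     (dvtN (dvtZ 2 (dvt_id u)))) (dd u)) (dvtZ x (dvtM (dw u u01) (dvt_cosM x u)))).
(* [|sin(xu) - sin x|] is at most both [2] and [x(1 - u)], hence at most
   [2 (x(1 - u))^(1 - e)], which compensates the singularity of [wt] at [1]. *)
have dB u : 0 < u < 1 -> `|d u| <= 2 * x `^ (1 - e) * (1 - u ^+ 2) `^ (1 - e).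
  move=> /andP[u0 u1]; have h0 : 0 < 1 - u by rewrite subr_gt0.
  have h1 : 0 < x * (1 - u) by rewrite mulr_gt0.
  apply: (@le_trans _ _ (2 * (x * (1 - u)) `^ (1 - e))).
    have [c|c] := leP 1 (x * (1 - u)).
      apply: (@le_trans _ _ 2).
        rewrite (le_trans (ler_normB _ _))// -[leRHS]/(1 + 1) lerD// ler_norml sin_geN1 sin_le1//.
      rewrite -[leLHS]mulr1 ler_wpM2l// -[leLHS](powRr0 (x * (1 - u))); apply: ler_powR => //; lra.
    apply: (@le_trans _ _ (x * (1 - u))).
      rewrite (le_trans (sin_lipschitz _ _))// distrC -[X in X - _]mulr1 -mulrBr gtr0_norm//.
    apply: (@le_trans _ _ ((x * (1 - u)) `^ (1 - e))).
      rewrite -[leLHS](powRr1 (ltW h1)); apply: ger_powR; [by rewrite h1 (ltW c)|lra].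
    by rewrite ler_peMl ?powR_ge0// ler1n.
  rewrite powRM ?(ltW x0) ?(ltW h0)// mulrA ler_wpM2l ?mulr_ge0 ?powR_ge0//.
  apply: ge0_ler_powR; rewrite ?nnegrE; nra.
have gB u : 0 < u < 1 -> `|g u| <= 4 * `|nu| * x `^ (1 - e) * jacobi_weight (nu - e) u.
  move=> u01; have /andP[u0 u1] := u01.
  have P0 : 0 < 1 - u ^+ 2 by exact: p1.
  have n2 : `|2 * u| = 2 * u by rewrite ger0_norm// mulr_ge0// ltW.
  rewrite /g 3!normrM normrN n2 (ger0_norm (powR_ge0 (1 - u ^+ 2) (nu - 1))).
  have -> : jacobi_weight (nu - e) u = (1 - u ^+ 2) `^ (nu - 1) * (1 - u ^+ 2) `^ (1 - e).
    rewrite /jacobi_weight -powRD; last by apply/implyP => _; rewrite gt_eqF.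
    by congr (_ `^ _); ring.
  have := dB u u01; rewrite -/nu.
  set X := x `^ (1 - e); set A := _ `^ (nu - 1); set B := _ `^ (1 - e) => DB.
  have NA : 0 <= `|nu| * A by rewrite mulr_ge0 ?powR_ge0.
  apply: (@le_trans _ _ (`|nu| * A * 2 * (2 * X * B))).
    apply: ler_pM => //; first by rewrite mulr_ge0// mulr_ge0// ltW.
    by apply: ler_wpM2l => //; move: u1; lra.
  by rewrite le_eqVlt; apply/orP; left; apply/eqP; ring.
have m01 : measurable D01 by [].
have igb := integrable_scale (4 * `|nu| * x `^ (1 - e)) m01 iW.
have mwt : measurable_fun D01 wt by exact: measurable_funTS (measurable_jacobi_weight _).
have mg : measurable_fun D01 g.
  apply: measurable_funM; last first.
    by apply: measurable_funTS; apply: measurable_funB => //;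
      apply: measurableT_comp measurable_sinR _; exact: mulrl_measurable.
  apply: measurable_funM.
    by apply: measurable_funM => //; exact: measurable_funTS (measurable_jacobi_weight _).
  by apply: measurable_funTS; apply: measurableT_comp => //; exact: mulrl_measurable.
have ig : mu.-integrable D01 (EFin \o g).
  by apply: (ler_integrable m01 mg _ igb) => u /in01; exact: gB.
have ic := integrable_jacobi_cos x.
have fi : mu.-integrable D01 (EFin \o f).
  by apply: integrable_add => //; exact: (integrable_scale x m01 ic).
have F0 : wt u * d u @[u --> 0^'+] --> wt 0 * d 0.
  have h0 : 0 < 1 - 0 ^+ 2 :> R by rewrite expr0n subr0.
  by apply: cvg_at_right_filter; exact: dvt_continuous (dvtM (dvt_powR nu (dq 0) h0) (dd 0)).
have F1 : wt u * d u @[u --> 1^'-] --> 0.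
  apply: norm_cvg0.
  apply: (@squeeze_cvgr _ _ _ _ (cst 0) (fun u => 2 * x `^ (1 - e) * (1 - u ^+ 2) `^ (nu + (1 - e)))).
  - near=> u; have u1 : u < 1 by near: u; exact: nbhs_left_lt.
    have u0 : 0 < u by near: u; exact: nbhs_left_gt.
    have u01 : 0 < u < 1 by rewrite u0.
    rewrite /= normr_ge0/= normrM ger0_norm ?jacobi_weight_ge0//.
    rewrite powRD; last by apply/implyP => _; rewrite gt_eqF// p1.
    by rewrite mulrCA -/(jacobi_weight nu u) ler_wpM2l ?jacobi_weight_ge0// dB.
  - exact: cvg_cst.
  - rewrite -[X in _ --> X](mulr0 (2 * x `^ (1 - e))); apply: cvgM; first exact: cvg_cst.
    by apply: cvg_onem_sqr_powR; move: s1; rewrite -/nu; lra.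
have := Rintegral_FTC01 dF cf F0 F1 fi.
rewrite /f RintegralD//; last exact: (integrable_scale x m01 ic).
rewrite RintegralZl// -/(jacobi_cos x).
have -> : wt 0 * d 0 = - sin x.
  by rewrite /jacobi_weight /d expr0n subr0 powR1 mul1r mulr0 sin0 sub0r.
have gI : `|\int[mu]_(u in D01) g u| <= 4 * `|nu| * x `^ (1 - e) * W.
  apply: le_trans (le_normr_Rintegral _ ig) _ => //.
  have -> : 4 * `|nu| * x `^ (1 - e) * W =
      \int[mu]_(u in D01) (4 * `|nu| * x `^ (1 - e) * jacobi_weight (nu - e) u).
    by rewrite RintegralZl.
  by apply: le_Rintegral => //; exact: integrable_norm ig.
rewrite opprK add0r => FE.
have -> : jacobi_cos x = x^-1 * (sin x - \int[mu]_(u in D01) g u).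
  by rewrite -FE addrAC subrr add0r mulrA mulVf ?mul1r// gt_eqF.
rewrite normrM gtr0_norm ?invr_gt0//.
have xE : x^-1 * x `^ (1 - e) = x `^ (- e).
  rewrite -(mulr_powRB1 (ltW x0) (_ : 0 < 1 - e)); last lra.
  by rewrite mulrA mulVf ?gt_eqF// mul1r; congr (_ `^ _); ring.
have h1 : x^-1 <= x `^ (- e).
  rewrite -xE ler_peMr ?invr_ge0 ?(ltW x0)// -[leLHS](powRr0 x); apply: ler_powR; lra.
apply: (@le_trans _ _ (x^-1 * (1 + 4 * `|nu| * x `^ (1 - e) * W))).
  rewrite ler_wpM2l ?invr_ge0 ?(ltW x0)// (le_trans (ler_normB _ _))// lerD//.
  by rewrite ler_norml sin_geN1 sin_le1.
rewrite mulrDr mulr1.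
have -> : x^-1 * (4 * `|nu| * x `^ (1 - e) * W) = 4 * `|nu| * W * x `^ (- e).
  by rewrite -xE; ring.
by rewrite !mulrDl mul1r lerD2r; have := mulr_ge0 M0 (ltW xe); move: h1; lra.
Unshelve. all: by end_near. Qed.

End Bessel_integrals.

(** * The Stieltjes transform *)

Section Stieltjes.
Context {R : realType}.
Notation mu := (@lebesgue_measure R).
Notation D0y := (`]0, +oo[%classic : set R).
Notation D01 := (`]0, 1[%classic : set R).
Notation Re := complex.Re.
Notation Im := complex.Im.
Notation sqrt := Num.sqrt.
Notation cabs := ComplexField.Normc.normc.
Implicit Types (x t u s : R) (k n : nat) (y z : R[i]).
Variables m a : R.
Hypothesis m1 : - 2^-1 < m.
Hypothesis a0 : 0 < a.
Notation wt := (jacobi_weight (m - 2^-1)).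
Notation M := (jacobi_moment (m - 2^-1)).

Let s1 : - 1 < m - 2^-1. Proof. by move: m1; lra. Qed.

Let M0 : 0 < M 0. Proof. exact: jacobi_moment0_gt0. Qed.

Definition bsin t := sin (a * sqrt t) * jacobi_cos m (a * sqrt t).

Lemma measurable_bsin : measurable_fun [set: R] bsin.
Proof.
have ms : measurable_fun [set: R] (fun t => a * sqrt t).
  by apply: measurable_funM => //; exact: measurable_sqrtR.
apply: measurable_funM; first exact: measurableT_comp measurable_sinR ms.
by apply: measurableT_comp ms; apply: continuous_measurable_fun; exact: continuous_jacobi_cos.
Qed.

Lemma norm_bsin_le t : `|bsin t| <= M 0.
Proof.
rewrite normrM -[leRHS]mul1r; apply: ler_pM => //; last exact: norm_jacobi_cos_le.
by rewrite ler_norml sin_geN1 sin_le1.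
Qed.

Lemma integrable_bsin_div : mu.-integrable D0y (EFin \o (fun t => bsin t / t)).
Proof.
have [e /andP[e0 e2] [C C0 dec]] := jacobi_cos_decay m1.
pose p := e / 2; have p0 : 0 < p by rewrite divr_gt0.
have ae : 0 <= C * a `^ (- e) by rewrite mulr_ge0 ?powR_ge0.
have aM : 0 <= a * M 0 by rewrite mulr_ge0 ?(ltW a0) ?(ltW M0).
apply: (@ler_integrable _ _ _ (fun t => (4 * (a * M 0 + C * a `^ (- e))) *
    (t `^ (p - 1) / (1 + t `^ p) ^+ 2))) => //.
- apply: measurable_funM; first exact: measurable_funTS measurable_bsin.
  exact: measurable_invr_D.
- move=> t /in0y t0; have st : 0 < sqrt t by rewrite sqrtr_gt0.
  have tp : 0 < t `^ p by exact: powR_gt0.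
  have d0 : 0 < (1 + t `^ p) ^+ 2 by rewrite exprn_gt0// addr_gt0.
  rewrite mulrA ler_pdivlMr//.
  have [t1|t1] := leP t 1.
    apply: (@le_trans _ _ (a * M 0 * t `^ (p - 1) * 4)).
      apply: ler_pM; rewrite ?normr_ge0 ?(ltW d0)//.
        apply: (@le_trans _ _ (a * M 0 * t `^ (- 2^-1))).
          rewrite normrM normfV (gtr0_norm t0) ler_pdivrMr//.
          have -> : a * M 0 * t `^ (- 2^-1) * t = a * sqrt t * M 0.
            rewrite -[in X in _ * X](powRr1 (ltW t0)) -mulrA -powRD; last first.
              by apply/implyP => _; rewrite gt_eqF.
            rewrite (_ : - 2^-1 + 1 = 2^-1); last by field.
            by rewrite powR12_sqrt ?(ltW t0)//; ring.
          rewrite normrM; apply: ler_pM => //; last exact: norm_jacobi_cos_le.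
          by rewrite (le_trans (sin_le_norm _))// gtr0_norm// mulr_gt0.
        rewrite ler_wpM2l//; apply: ger_powR; [by rewrite t0|].
        by rewrite /p; move: e2; lra.
      have tp1 : t `^ p <= 1 by rewrite -[leRHS](powRr0 t); apply: ger_powR; rewrite ?t0 ?(ltW p0).
      by move: tp tp1; move: (t `^ p) => T; nra.
    have := mulr_ge0 ae (powR_ge0 t (p - 1)); lra.
  apply: (@le_trans _ _ (C * a `^ (- e) * t `^ (- p - 1) * (4 * (t `^ p) ^+ 2))).
    apply: ler_pM; rewrite ?normr_ge0 ?(ltW d0)//.
      rewrite normrM normfV (gtr0_norm t0) ler_pdivrMr//.
      have -> : C * a `^ (- e) * t `^ (- p - 1) * t = C * (a * sqrt t) `^ (- e).
        rewrite powRM ?(ltW a0) ?(ltW st)// -powR12_sqrt ?(ltW t0)// -powRrM.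
        rewrite -[in X in _ * X](powRr1 (ltW t0)) -mulrA -powRD; last first.
          by apply/implyP => _; rewrite gt_eqF.
        by rewrite -mulrA; congr (_ * (_ * _ `^ _)); rewrite /p; field.
      rewrite normrM -[leRHS]mul1r; apply: ler_pM => //; last by apply: dec; rewrite mulr_gt0.
      by rewrite ler_norml sin_geN1 sin_le1.
    have tp1 : 1 <= t `^ p by rewrite -[leLHS](powRr0 t); apply: ler_powR; rewrite ?(ltW t1) ?(ltW p0).
    by move: tp1; move: (t `^ p) => T; nra.
  rewrite -(mulrA (C * a `^ (- e))).
  have -> : t `^ (- p - 1) * (4 * (t `^ p) ^+ 2) = 4 * t `^ (p - 1) :> R.
    have sq q : (t `^ q) ^+ 2 = t `^ (q * 2) by rewrite powRrM powR_mulrn// powR_ge0.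
    rewrite sq.
    rewrite mulrCA -powRD; last by apply/implyP => _; rewrite gt_eqF.
    by congr (_ * _ `^ _); ring.
  have := mulr_ge0 aM (powR_ge0 t (p - 1)); lra.
- by apply: integrable_scale => //; exact: integrable_hat.
Qed.

Lemma Rintegral_bsin_fubini (h : R -> R) (C : R) : measurable_fun [set: R] h ->
  (forall t, 0 < t -> `|h t| <= C / (1 + t)) ->
  \int[mu]_(t in D0y) (bsin t / t * h t) = \int[mu]_(u in D01)
    (wt u * ((\int[mu]_(t in D0y) (sin (a * (1 + u) * sqrt t) / t * h t) +
              \int[mu]_(t in D0y) (sin (a * (1 - u) * sqrt t) / t * h t)) / 2)).
Proof.
move=> mhT hC; have mh : measurable_fun D0y h by exact: measurable_funTS.
have iK b := integrable_sinK mh hC b.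
pose K t := sin (a * sqrt t) / t * h t.
pose H u t := wt u * cos (a * sqrt t * u) * K t.
have HE u t : H u t = wt u / 2 * (sin (a * (1 + u) * sqrt t) / t * h t +
    sin (a * (1 - u) * sqrt t) / t * h t).
  have -> : a * (1 + u) * sqrt t = a * sqrt t + a * sqrt t * u by ring.
  have -> : a * (1 - u) * sqrt t = a * sqrt t - a * sqrt t * u by ring.
  by rewrite sinD sinB /H /K; move: t^-1 => T; field.
have iH u : mu.-integrable D0y (EFin \o H u).
  apply: (@eq_Rintegrable _ _ _ _ _ (fun t _ => esym (HE u t))) => //.
  by apply: integrable_scale => //; apply: integrable_add => //; exact: iK.
have [|//|//|||||_ _ E] := @RFubini _ _ _ _ R mu mu D01 D0y H (fun u => (a * C * pi) * wt u) => //.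
- have ms : measurable_fun [set: R * R] (fun p : R * R => a * sqrt p.2).
    by apply: measurable_funM => //; apply: measurableT_comp measurable_snd; exact: measurable_sqrtR.
  apply: measurable_funM.
    apply: measurable_funM.
      by apply: measurableT_comp measurable_fst; exact: measurable_jacobi_weight.
    apply: measurableT_comp measurable_cosR _.
    by apply: measurable_funM => //; exact: measurable_fst.
  apply: measurable_funM; last by apply: measurableT_comp measurable_snd.
  apply: measurable_funM; first exact: measurableT_comp measurable_sinR ms.
  by apply: measurableT_comp measurable_snd; exact: measurable_invr.
- move=> t _.
  apply: (@eq_Rintegrable _ _ (fun u => K t * (wt u * cos (a * sqrt t * u)))) => //.
    by move=> u _; rewrite /H mulrC.
  by apply: integrable_scale => //; exact: integrable_jacobi_cos.
- move=> u _; apply: (@le_trans _ _ (\int[mu]_(t in D0y) (a * C * wt u * (sqrt t * (1 + t))^-1))).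
    apply: le_Rintegral => //.
    + exact: integrable_norm (iH u).
    + by apply: integrable_scale => //; exact: integrable_sqrtK.
    move=> t /in0y t0; rewrite /H 2!normrM (ger0_norm (jacobi_weight_ge0 _ _)).
    have := le_sinK hC a t0; rewrite -/(K t) (gtr0_norm a0) => KB.
    have c1 : `|cos (a * sqrt t * u)| <= 1 by rewrite ler_norml cos_geN1 cos_le1.
    have -> : a * C * wt u * (sqrt t * (1 + t))^-1 = wt u * 1 * (a * C * (sqrt t * (1 + t))^-1).
      by ring.
    apply: ler_pM => //; first by rewrite mulr_ge0 ?jacobi_weight_ge0.
    by rewrite ler_wpM2l ?jacobi_weight_ge0.
  rewrite RintegralZl//; last exact: integrable_sqrtK.
  by rewrite Rintegral_sqrtK mulrAC.
- by apply: integrable_scale => //; exact: integrable_jacobi_weight.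
transitivity (\int[mu]_(t in D0y) \int[mu]_(u in D01) H u t).
  apply: eq_Rintegral => t _; rewrite /H.
  under eq_Rintegral do rewrite mulrC.
  rewrite RintegralZl//; last exact: integrable_jacobi_cos.
  by rewrite -/(jacobi_cos m _) /K /bsin; ring.
rewrite -E; apply: eq_Rintegral => u _.
under eq_Rintegral do rewrite HE.
rewrite RintegralZl//; last by apply: integrable_add => //; exact: iK.
by rewrite RintegralD// -!mulrA [2^-1 * _]mulrC.
Qed.

Lemma cintegral_wt : cintegral D01 (fun u => (wt u)%:C) = (M 0)%:C.
Proof.
apply: complex_ext; rewrite ?Re_cintegral ?Im_cintegral /=.
  by apply: eq_Rintegral => u _; rewrite muln0 expr0 mulr1.
by rewrite /Rintegral integral0.
Qed.

Lemma cintegral_bsin_divK (w : R[i]) : 0 < Re w ->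
  cintegral D0y (fun t => (bsin t / t)%:C * (w * w + t%:C)^-1) =
  pi%:C / (w * w) * ((M 0)%:C - cexp (- (w * a%:C)) * jacobi_ccosh m (a%:C * w)).
Proof.
move=> w0; have [C C0 kC] := ker_bound w0.
have ctw : cintegrable D01 (fun u => (wt u)%:C).
  split; first exact: integrable_jacobi_weight.
  by rewrite /=; exact: integrable0.
have cic := cintegrable_jacobi_ccosh m1 (a%:C * w).
rewrite -cintegral_wt /jacobi_ccosh -cintegralZ// -cintegralB//; last exact: cintegrableZ.
rewrite -cintegralZ//; last by apply: cintegrableB => //; exact: cintegrableZ.
have SE u : 0 < u < 1 ->
    pi%:C / (w * w) * ((wt u)%:C - cexp (- (w * a%:C)) * ((wt u)%:C * ccosh (a%:C * w * u%:C))) =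
    (wt u)%:C * ((2^-1)%:C *
      (cintegral D0y (fun t => (sin (a * (1 + u) * sqrt t) / t)%:C * (w * w + t%:C)^-1) +
       cintegral D0y (fun t => (sin (a * (1 - u) * sqrt t) / t)%:C * (w * w + t%:C)^-1))).
  move=> /andP[u0 u1].
  have b1 : 0 <= a * (1 + u) by rewrite mulr_ge0 ?addr_ge0 ?(ltW a0) ?(ltW u0).
  have b2 : 0 <= a * (1 - u) by rewrite mulr_ge0 ?(ltW a0)// subr_ge0 ltW.
  rewrite (cintegral_sinker w0 b1) (cintegral_sinker w0 b2).
  have -> : - (w * (a * (1 + u))%:C) = - (w * a%:C) + - (a%:C * w * u%:C).
    by rewrite rmorphM rmorphD rmorph1; ring.
  have -> : - (w * (a * (1 - u))%:C) = - (w * a%:C) + a%:C * w * u%:C.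
    by rewrite rmorphM rmorphB rmorph1; ring.
  rewrite !cexpD ccoshE.
  have hh : (2^-1)%:C + (2^-1)%:C = 1 :> R[i] 
    by apply: complex_ext; rewrite ?Re_add ?Im_add /=; field.
  move: (2^-1)%:C hh => h hh.
  move: (cexp _) (cexp _) (cexp _) (wt u)%:C (pi%:C / (w * w)) => E E1 E2 W P.
  transitivity ((h + h) * W * P - P * E2 * W * h * (E1 + E)); last by ring.
  by rewrite hh; ring.
apply: complex_ext; rewrite ?Re_cintegral ?Im_cintegral.
  transitivity (\int[mu]_(t in D0y) (bsin t / t * Re (w * w + t%:C)^-1)).
    by apply: eq_Rintegral => t _; rewrite Re_scale.
  rewrite (@Rintegral_bsin_fubini _ C); last 2 first.
  - exact: measurable_Re_ker.
  - by move=> t /ltW t0; rewrite (le_trans (Re_le_cabs _))// kC.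
  apply: eq_Rintegral => u /set_mem/in01 u01; rewrite SE// !Re_scale Re_add !Re_cintegral.
  rewrite mulrC [X in _ = _ * X]mulrC mulrC.
  by congr (_ * ((_ + _) / _)); apply: eq_Rintegral => t _; rewrite Re_scale.
transitivity (\int[mu]_(t in D0y) (bsin t / t * Im (w * w + t%:C)^-1)).
  by apply: eq_Rintegral => t _; rewrite Im_scale.
rewrite (@Rintegral_bsin_fubini _ C); last 2 first.
- exact: measurable_Im_ker.
- by move=> t /ltW t0; rewrite (le_trans (Im_le_cabs _))// kC.
apply: eq_Rintegral => u /set_mem/in01 u01; rewrite SE// !Im_scale Im_add !Im_cintegral.
rewrite mulrC [X in _ = _ * X]mulrC mulrC.
by congr (_ * ((_ + _) / _)); apply: eq_Rintegral => t _; rewrite Im_scale.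
Qed.

Lemma cintegrable_bsin_divK (w : R[i]) : 0 < Re w ->
  cintegrable D0y (fun t => (bsin t / t)%:C * (w * w + t%:C)^-1).
Proof.
move=> w0; have [C C0 kC] := ker_bound w0.
have ib := integrable_bsin_div.
have mb := integrable_measurable ib.
apply: (@cintegrable_le _ _ _ (fun t => C * `|bsin t / t|)) => //.
- have -> : (fun t => Re ((bsin t / t)%:C * (w * w + t%:C)^-1)) =
      (fun t => bsin t / t * Re (w * w + t%:C)^-1).
    by apply/funext => t; rewrite Re_scale.
  by apply: measurable_funM mb _; apply: measurable_funTS; exact: measurable_Re_ker.
- have -> : (fun t => Im ((bsin t / t)%:C * (w * w + t%:C)^-1)) =
      (fun t => bsin t / t * Im (w * w + t%:C)^-1).
    by apply/funext => t; rewrite Im_scale.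
  by apply: measurable_funM mb _; apply: measurable_funTS; exact: measurable_Im_ker.
- move=> t /in0y t0; rewrite cabsM cabs_real mulrC ler_wpM2r//.
  apply: le_trans (kC t (ltW t0)) _; rewrite ler_pdivrMr ?addr_gt0//.
  by rewrite ler_peMr// lerDl ltW.
- by apply: integrable_scale => //; exact: integrable_norm ib.
Qed.

Let cvgV : (n.+1%:R)^-1 @[n --> \oo] --> (0 : R).
Proof. exact: cvg_harmonic. Qed.

Lemma Rintegral_bsin_div : \int[mu]_(t in D0y) (bsin t / t) = pi * M 0.
Proof.
have M0E : M 0 = \int[mu]_(u in D01) wt u.
  by apply: eq_Rintegral => u _; rewrite muln0 expr0 mulr1.
pose fn n t := bsin t / t * (n.+1%:R ^+ 2 / (n.+1%:R ^+ 2 + t)).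
have N0 n : 0 < n.+1%:R :> R by rewrite ltr0n.
have mf n : measurable_fun D0y (fn n).
  apply: measurable_funM; first exact: integrable_measurable integrable_bsin_div.
  by apply: measurable_funM => //; apply: measurable_invr_D; exact: measurable_funD.
have ib := integrable_bsin_div.
have fcvg t : D0y t -> fn n t @[n --> \oo] --> bsin t / t.
  move=> /in0y t0; rewrite -[X in _ --> X]mulr1; apply: cvgM; first exact: cvg_cst.
  apply/cvgrPdist_le => e e0.
  have : t * n.+1%:R^-1 @[n --> \oo] --> (t * 0 : R) by apply: cvgM => //; exact: cvg_cst.
  rewrite mulr0 => /cvgr0Pnorm_le/(_ _ e0); apply: filterS => n; apply: le_trans.
  have d0 : 0 < n.+1%:R ^+ 2 + t by rewrite addr_gt0// exprn_gt0.
  have -> : 1 - n.+1%:R ^+ 2 / (n.+1%:R ^+ 2 + t) = t / (n.+1%:R ^+ 2 + t).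
    by move: (n.+1%:R ^+ 2) d0 => N d0; field; rewrite gt_eqF.
  rewrite 2!normrM ler_wpM2l// 2!normfV lef_pV2 ?posrE ?normr_gt0 ?gt_eqF//.
  rewrite 2?gtr0_norm//; have : 1 <= n.+1%:R :> R by rewrite ler1n.
  by move: (n.+1%:R) t0 => N; nra.
have fle n t : D0y t -> `|fn n t| <= `|bsin t / t|.
  move=> /in0y t0; rewrite normrM ler_piMr//.
  have d0 : 0 < n.+1%:R ^+ 2 + t by rewrite addr_gt0// exprn_gt0.
  by rewrite ger0_norm ?divr_ge0 ?(ltW d0) ?exprn_ge0// ler_pdivrMr// mul1r lerDl ltW.
have m0y : measurable D0y by [].
have [_ cl] := Rdominated_cvg m0y mf fcvg (integrable_norm ib) fle.
pose G n u := expR (- (n.+1%:R * a)) * ((expR (a * n.+1%:R * u) + expR (- (a * n.+1%:R * u))) / 2).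
pose gn n u := wt u * G n u.
have GB n u : 0 < u < 1 -> 0 <= G n u <= expR (- (n.+1%:R * (a * (1 - u)))).
  move=> /andP[u0 u1]; rewrite /G mulr_ge0 ?divr_ge0 ?addr_ge0 ?expR_ge0//=.
  have -> : - (n.+1%:R * (a * (1 - u))) = - (n.+1%:R * a) + a * n.+1%:R * u by ring.
  have h0 : 0 <= a * n.+1%:R * u by rewrite mulr_ge0 ?(ltW u0)// mulr_ge0 ?(ltW a0).
  rewrite expRD ler_wpM2l ?expR_ge0//.
  have : expR (- (a * n.+1%:R * u)) <= expR (a * n.+1%:R * u).
    by rewrite ler_expR (le_trans _ h0)// oppr_le0.
  by move: (expR (a * n.+1%:R * u)) (expR _) => A B; lra.
have G1 n u : 0 < u < 1 -> `|G n u| <= 1.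
  move=> u01; have /andP[h0 h1] := GB n u u01; rewrite ger0_norm//; apply: le_trans h1 _.
  rewrite -[leRHS]expR0 ler_expR oppr_le0 mulr_ge0// mulr_ge0 ?(ltW a0)//.
  by move: u01 => /andP[_ /ltW]; rewrite subr_ge0.
have mG n : measurable_fun D01 (G n).
  apply: measurable_funTS; apply: measurable_funM => //; apply: measurable_funM => //.
  apply: measurable_funD.
    by apply: measurableT_comp => //; exact: mulrl_measurable.
  by apply: measurableT_comp => //; apply: measurableT_comp => //; exact: mulrl_measurable.
have ign n : mu.-integrable D01 (EFin \o gn n).
  exact: (integrable_weightM s1 (mG n) (G1 n)).
have E n : \int[mu]_(t in D0y) fn n t = pi * (M 0 - \int[mu]_(u in D01) gn n u).
  have w0 : 0 < Re (n.+1%:R%:C : R[i]) by rewrite /= N0.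
  have := congr1 (fun y => n.+1%:R ^+ 2 * Re y) (cintegral_bsin_divK w0).
  have -> : n.+1%:R%:C * n.+1%:R%:C = (n.+1%:R ^+ 2)%:C :> R[i] by rewrite -rmorphM -expr2.
  have -> : - (n.+1%:R%:C * a%:C) = (- (n.+1%:R * a))%:C :> R[i] by rewrite rmorphN rmorphM.
  have N2 : n.+1%:R ^+ 2 != 0 :> R by rewrite expf_neq0// gt_eqF.
  have -> : pi%:C / (n.+1%:R ^+ 2)%:C = (pi / n.+1%:R ^+ 2)%:C :> R[i] by rewrite -fmorphV -rmorphM.
  have gE : \int[mu]_(u in D01) gn n u =
      expR (- (n.+1%:R * a)) * Re (jacobi_ccosh m (a%:C * n.+1%:R%:C)).
    have [ic _] := cintegrable_jacobi_ccosh m1 (a%:C * n.+1%:R%:C).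
    rewrite Re_cintegral -RintegralZl//; apply: eq_Rintegral => u _.
    rewrite Re_scale -!rmorphM Re_ccosh /gn /G.
    have -> : Re ((a * n.+1%:R * u)%:C : R[i]) = a * n.+1%:R * u by [].
    have -> : Im ((a * n.+1%:R * u)%:C : R[i]) = 0 by [].
    by rewrite cos0; ring.
  have fE : \int[mu]_(t in D0y) fn n t = n.+1%:R ^+ 2 *
      Re (cintegral D0y (fun t => (bsin t / t)%:C * ((n.+1%:R ^+ 2)%:C + t%:C)^-1)).
    have [ic _] := cintegrable_bsin_divK w0.
    rewrite Re_cintegral -RintegralZl//; last first.
      by apply: eq_Rintegrable ic => // t _; rewrite -rmorphM -expr2.
    apply: eq_Rintegral => t _; rewrite Re_scale -rmorphD -fmorphV.
    have -> : Re ((n.+1%:R ^+ 2 + t)^-1%:C : R[i]) = (n.+1%:R ^+ 2 + t)^-1 by [].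
    by rewrite /fn; ring.
  rewrite cexp_real Re_scale Re_sub Re_scale -gE -fE => ->.
  have -> : Re ((M 0)%:C : R[i]) = M 0 by [].
  by rewrite mulrA (mulrCA _ pi) divff// mulr1.
have g0 : \int[mu]_(u in D01) gn n u @[n --> \oo] --> 0.
  have gcvg u : D01 u -> gn n u @[n --> \oo] --> 0.
    move=> /in01 u01; rewrite -[X in _ --> X](mulr0 (wt u)); apply: cvgM; first exact: cvg_cst.
    have c0 : 0 < a * (1 - u) by rewrite mulr_gt0// subr_gt0; case/andP: u01.
    apply: (@squeeze_cvgr _ _ _ _ (cst 0) (fun n => (a * (1 - u))^-1 * n.+1%:R^-1)).
    - apply: nearW => n; have /andP[h0 h1] := GB n u u01; rewrite h0 /=; apply: le_trans h1 _.
      have -> : (a * (1 - u))^-1 * n.+1%:R^-1 = (n.+1%:R * (a * (1 - u)))^-1 by rewrite [in RHS]invfM mulrC.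
      have Nc0 : 0 < n.+1%:R * (a * (1 - u)) by rewrite mulr_gt0.
      rewrite expRN lef_pV2 ?posrE ?expR_gt0//.
      by apply: le_trans (expR_ge1Dx _); rewrite lerDr.
    - exact: cvg_cst.
    - by rewrite -[X in _ --> X](mulr0 (a * (1 - u))^-1); apply: cvgM => //; exact: cvg_cst.
  have gle n u : D01 u -> `|gn n u| <= wt u.
    move=> /in01 u01; rewrite normrM ger0_norm ?jacobi_weight_ge0//.
    by rewrite ler_piMr ?jacobi_weight_ge0// G1.
  have m01 : measurable D01 by [].
  have [_] := Rdominated_cvg m01 (fun n => integrable_measurable (ign n)) gcvg
    (integrable_jacobi_weight s1) gle.
  by rewrite /Rintegral integral0.
have cr : pi * (M 0 - \int[mu]_(u in D01) gn n u) @[n --> \oo] --> pi * (M 0 - 0).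
  by apply: cvgM; [exact: cvg_cst|apply: cvgB => //; exact: cvg_cst].
have EE : (fun n => \int[mu]_(t in D0y) fn n t) = (fun n => pi * (M 0 - \int[mu]_(u in D01) gn n u)).
  exact/funext.
by rewrite subr0 in cr; rewrite EE in cl; exact: cvg_unique cl cr.
Qed.

Lemma cintegral_bsin (w : R[i]) : 0 < Re w ->
  cintegrable D0y (fun t => (bsin t)%:C * (w * w + t%:C)^-1) /\
  cintegral D0y (fun t => (bsin t)%:C * (w * w + t%:C)^-1) =
  pi%:C * (cexp (- (w * a%:C)) * jacobi_ccosh m (a%:C * w)).
Proof.
move=> w0; have ib := integrable_bsin_div.
have m0y : measurable D0y by [].
have wn0 : w != 0 by apply: contraTneq w0 => ->; rewrite /= ltxx.
have c1 : cintegrable D0y (fun t => (bsin t / t)%:C).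
  by split => //=; exact: integrable0.
have c2 := cintegrable_bsin_divK w0.
have eq t : D0y t -> (bsin t / t)%:C - (w * w) * ((bsin t / t)%:C * (w * w + t%:C)^-1) =
    (bsin t)%:C * (w * w + t%:C)^-1.
  move=> /in0y t0; have t1 : t%:C != 0 :> R[i] by rewrite fmorph_eq0 gt_eqF.
  have z0 := zt_neq0 w0 (ltW t0).
  have -> : (bsin t / t)%:C = (bsin t)%:C / t%:C :> R[i] by rewrite rmorphM fmorphV.
  by move: t1 z0; move: t%:C (bsin t)%:C => T B t1 z0; field; rewrite t1 z0.
split.
  by apply: cintegrable_eq m0y eq _; apply: cintegrableB => //; exact: cintegrableZ.
rewrite -(cintegral_eq eq) cintegralB//; last exact: cintegrableZ.
rewrite cintegralZ// cintegral_bsin_divK//.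
have -> : cintegral D0y (fun t => (bsin t / t)%:C) = (pi * M 0)%:C.
  apply: complex_ext; rewrite ?Re_cintegral ?Im_cintegral /=; first exact: Rintegral_bsin_div.
  by rewrite /Rintegral integral0.
have -> : (pi * M 0)%:C = pi%:C * (M 0)%:C :> R[i] by rewrite rmorphM.
move: (cexp _) (jacobi_ccosh _ _) (M 0)%:C pi%:C => E J N p.
by field.
Qed.

End Stieltjes.

(** * The Laplace transform *)

Section Laplace.
Context {R : realType}.
Notation mu := (@lebesgue_measure R).
Notation D0y := (`]0, +oo[%classic : set R).
Notation Re := complex.Re.
Notation Im := complex.Im.
Implicit Types (x t u s : R).
Variables (g : R -> R) (K : R).
Hypothesis mg : measurable_fun [set: R] g.
Hypothesis gK : forall t, `|g t| <= K.
Hypothesis ig : mu.-integrable D0y (EFin \o (fun t => g t / t)).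

Lemma integrable_laplace s : 0 < s ->
  mu.-integrable D0y (EFin \o (fun t => expR (- (s * t)) * g t)).
Proof. by move=> s0; exact: integrable_expRNM_bounded. Qed.

Let laplace s := \int[mu]_(t in D0y) (expR (- (s * t)) * g t).

Lemma Rintegral_expRNM p : 0 < p -> \int[mu]_(t in D0y) expR (- (p * t)) = p^-1.
Proof.
move=> p0; have := Rintegral_expR_cos 0 p0.
under eq_Rintegral do rewrite mul0r cos0 mulr1.
by move=> ->; field; rewrite gt_eqF.
Qed.

Lemma laplace_fubini (c : R -> R) (p : R) : measurable_fun [set: R] c ->
  (forall x, `|c x| <= 1) -> 0 <= p ->
  mu.-integrable D0y (EFin \o (fun s => expR (- (p * s)) * c s * laplace s)) /\
  \int[mu]_(s in D0y) (expR (- (p * s)) * c s * laplace s) =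
  \int[mu]_(t in D0y) (g t * \int[mu]_(s in D0y) (expR (- ((p + t) * s)) * c s)).
Proof.
move=> mc c1 p0.
pose h t s := g t * (expR (- ((p + t) * s)) * c s).
have hE t s : h t s = expR (- (p * s)) * c s * (expR (- (s * t)) * g t).
  have e : - ((p + t) * s) = - (p * s) + - (s * t) by ring.
  by rewrite /h e expRD; ring.
have pt t : 0 < t -> 0 < p + t by move=> t0; rewrite ltr_wpDl.
have ic t : 0 < t -> mu.-integrable D0y (EFin \o (fun s => expR (- ((p + t) * s)) * c s)).
  by move=> t0; apply: integrable_expRNM_bounded mc c1; exact: pt.
have ih t : D0y t -> mu.-integrable D0y (EFin \o h t).
  by move=> /in0y t0; apply: integrable_scale => //; exact: ic.
have [|//|//|||||i2 i3 E] := @RFubini _ _ _ _ R mu mu D0y D0y h (fun t => `|g t / t|) => //.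
- apply: measurable_funM; first by apply: measurableT_comp measurable_fst.
  apply: measurable_funM; last by apply: measurableT_comp measurable_snd.
  apply: measurableT_comp => //; apply: measurableT_comp => //.
  apply: measurable_funM; last exact: measurable_snd.
  by apply: measurable_funD => //; exact: measurable_fst.
- move=> s /in0y s0.
  apply: (@eq_Rintegrable _ _ (fun t => expR (- (p * s)) * c s * (expR (- (s * t)) * g t))) => //.
  by apply: integrable_scale => //; exact: integrable_laplace.
- move=> t Dt; have t0 := in0y Dt.
  apply: (@le_trans _ _ (\int[mu]_(s in D0y) (`|g t| * expR (- ((p + t) * s))))).
    apply: le_Rintegral => //.
    + exact: integrable_norm (ih t Dt).
    + by apply: integrable_scale => //; apply: integrable_expRNM; exact: pt.
    move=> s _; rewrite /h 2!normrM ler_wpM2l// (ger0_norm (expR_ge0 _)).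
    by rewrite ler_piMr ?expR_ge0.
  rewrite RintegralZl//; last by apply: integrable_expRNM; exact: pt.
  rewrite Rintegral_expRNM ?pt// normrM normfV (gtr0_norm t0) ler_wpM2l//.
  by rewrite lef_pV2 ?posrE ?pt// lerDr.
- exact: integrable_norm ig.
have LE s : D0y s -> \int[mu]_(t in D0y) h t s = expR (- (p * s)) * c s * laplace s.
  move=> /in0y s0; under eq_Rintegral do rewrite hE.
  by rewrite RintegralZl//; exact: integrable_laplace.
split.
  by apply: eq_Rintegrable i3.
transitivity (\int[mu]_(s in D0y) \int[mu]_(t in D0y) h t s).
  by apply: eq_Rintegral => s /set_mem s0; rewrite LE.
rewrite -E; apply: eq_Rintegral => t /set_mem/in0y t0.
by rewrite RintegralZl//; exact: ic.
Qed.

Lemma cintegral_laplace (z : R[i]) : 0 <= Re z ->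
  cintegrable D0y (fun s => cexp (- (z * s%:C)) * (laplace s)%:C) /\
  cintegral D0y (fun s => cexp (- (z * s%:C)) * (laplace s)%:C) =
  cintegral D0y (fun t => (g t)%:C * (z + t%:C)^-1).
Proof.
move=> p0.
have cle x : `|cos x| <= 1 :> R by rewrite ler_norml cos_geN1 cos_le1.
have sle x : `|- sin x| <= 1 :> R by rewrite normrN ler_norml sin_geN1 sin_le1.
have [ir er] := laplace_fubini (c := fun s => cos (Im z * s)) (measurable_cosM _) (fun x => cle _) p0.
have ms0 : measurable_fun [set: R] (fun s => sin (Im z * s)).
  by apply: measurableT_comp measurable_sinR _; exact: mulrl_measurable.
have ms : measurable_fun [set: R] (fun s => - sin (Im z * s)).
  exact: measurableT_comp ms0.
have [ii ei] := laplace_fubini ms (fun x => sle _) p0.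
have rE s : Re (cexp (- (z * s%:C)) * (laplace s)%:C) =
    expR (- (Re z * s)) * cos (Im z * s) * laplace s.
  rewrite mulrC Re_scale Re_cexp Re_opp Im_opp (mulrC z) Re_scale Im_scale cosN.
  by rewrite (mulrC s (Re z)) (mulrC s (Im z)) [RHS]mulrC.
have iE s : Im (cexp (- (z * s%:C)) * (laplace s)%:C) =
    expR (- (Re z * s)) * (- sin (Im z * s)) * laplace s.
  rewrite mulrC Im_scale Im_cexp Re_opp Im_opp (mulrC z) Re_scale Im_scale sinN.
  by rewrite (mulrC s (Re z)) (mulrC s (Im z)) [RHS]mulrC.
split.
  by split; [apply: eq_Rintegrable ir|apply: eq_Rintegrable ii].
have zt t : 0 < t -> 0 < Re z + t by move=> t0; rewrite ltr_wpDl.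
apply: complex_ext; rewrite ?Re_cintegral ?Im_cintegral.
  under eq_Rintegral do rewrite rE.
  rewrite er; apply: eq_Rintegral => t /set_mem/in0y t0.
  by rewrite Re_scale Re_inv Re_add Im_add /= addr0 Rintegral_expR_cos// zt.
under eq_Rintegral do rewrite iE.
rewrite ei; apply: eq_Rintegral => t /set_mem/in0y t0.
rewrite Im_scale Im_inv Re_add Im_add /= addr0; congr (_ * _).
under eq_Rintegral do rewrite mulrN -mulN1r.
rewrite RintegralZl//; last first.
  apply: (integrable_expRNM_bounded (zt t t0) ms0 (k := 1)) => s.
  by rewrite ler_norml sin_geN1 sin_le1.
by rewrite Rintegral_expR_sin ?zt// mulN1r mulNr.
Qed.

End Laplace.

Lemma cpow_scale_csqrt (R : realType) (a m : R) (z : R[i]) : 0 < a -> z != 0 ->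
  `|carg z| < pi ->
  cpow z (- m / 2)%:C * cpow (a%:C * csqrt z / 2) m%:C = ((a / 2) `^ m)%:C.
Proof.
move=> a0 z0 hz; have a2 : 0 < a / 2 by rewrite divr_gt0.
have -> : a%:C * csqrt z / 2 = cexp ((ln (a / 2))%:C + (2^-1)%:C * clog z).
  rewrite cexpD cexp_real lnK ?posrE// -csqrtE rmorphM fmorphV rmorph_nat; ring.
rewrite /cpow clog_cexp; last first.
  rewrite Im_add Im_scale /= add0r; move: hz; rewrite ltr_norml => /andP[].
  by have := pi_gt0 R; lra.
rewrite -cexpD /powR gt_eqF// -cexp_real; congr cexp.
have -> : (- m / 2)%:C = - (m%:C * (2^-1)%:C) :> R[i] by rewrite mulNr rmorphN rmorphM.
by rewrite rmorphM; ring.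
Qed.

Theorem theorem10 (R : realType) (a mu : R) (z : R[i])
  (ha : 0 < a) (hmu : - 2^-1 < mu) (hz0 : z != 0) (hz : `|carg z| < pi) :
  let D : set R := `]0, +oo[%classic in
  let f (t : R) : R :=
    t `^ (- mu / 2) * besselJ mu (a * Num.sqrt t) * sin (a * Num.sqrt t) in
  let F : R[i] :=
    cexp (- (a%:C * csqrt z)) * cpow z (- mu / 2)%:C
      * besselI mu (a%:C * csqrt z) in
  let stieltjes (t : R) : R[i] := (f t)%:C / (z + t%:C) in
  let inner (s : R) : R :=
    \int[lebesgue_measure]_(t in D) (expR (- (s * t)) * f t) in
  let outer (s : R) : R[i] := cexp (- (z * s%:C)) * (inner s)%:C in
  (cintegrable D stieltjes /\ F = (pi^-1)%:C * cintegral D stieltjes)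
  /\
  (0 <= complex.Re z ->
   [/\ forall s : R, 0 < s ->
         (@lebesgue_measure R).-integrable D
           (fun t => (expR (- (s * t)) * f t)%:E),
       cintegrable D outer
     & F = (pi^-1)%:C * cintegral D outer]).

Proof.
move=> D f F stieltjes inner outer.
pose w := csqrt z.
have w0 : 0 < complex.Re w by exact: Re_csqrt_gt0.
have wz : w * w = z by rewrite -expr2 sqr_csqrt.
pose c := (a / 2) `^ mu * poisson_const mu.
have fE t : D t -> f t = c * bsin mu a t.
  move=> /in0y t0; have st : 0 < Num.sqrt t by rewrite sqrtr_gt0.
  rewrite /f besselJE// /bsin /c.
  have -> : a * Num.sqrt t / 2 = a / 2 * Num.sqrt t by ring.
  rewrite powRM ?divr_ge0 ?(ltW ha) ?(ltW st)// -[Num.sqrt t]powR12_sqrt ?(ltW t0)// -powRrM.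
  have -> : t `^ (- mu / 2) = (t `^ (2^-1 * mu))^-1 by rewrite -powRN; congr (_ `^ _); field.
  by field; rewrite gt_eqF// powR_gt0.
have mD : measurable D by exact: measurable_itv.
have [cS eS] := cintegral_bsin hmu ha w0.
have SE t : D t -> c%:C * ((bsin mu a t)%:C * (w * w + t%:C)^-1) = stieltjes t.
  by move=> Dt; rewrite /stieltjes fE// wz mulrA -rmorphM.
have FE : F = c%:C * (cexp (- (w * a%:C)) * jacobi_ccosh mu (a%:C * w)).
  have := cpow_scale_csqrt mu ha hz0 hz; rewrite /F besselIE// -/w (mulrC w) /c.
  set A := cpow z (- mu / 2)%:C; set B := cpow (a%:C * w / 2) mu%:C => AB.
  have -> : ((a / 2) `^ mu * poisson_const mu)%:C = A * B * (poisson_const mu)%:C :> R[i].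
    by rewrite AB rmorphM.
  by move: (poisson_const mu)%:C A B {AB} => p A B; ring.
have pp : (pi^-1)%:C * pi%:C = 1 :> R[i] by rewrite -rmorphM mulVf// gt_eqF// pi_gt0.
have stieltjesP : F = (pi^-1)%:C * cintegral D stieltjes.
  rewrite -(cintegral_eq SE) cintegralZ// eS FE.
  by rewrite [c%:C * (pi%:C * _)]mulrCA [RHS]mulrA pp mul1r.
split.
  by split=> //; apply: (cintegrable_eq mD SE); exact: cintegrableZ.
move=> z0.
pose g t := c * bsin mu a t.
have mg : measurable_fun [set: R] g by apply: measurable_funM => //; exact: measurable_bsin.
have gK t : `|g t| <= `|c| * jacobi_moment (mu - 2^-1) 0.
  by rewrite normrM ler_wpM2l// norm_bsin_le.
have ig : (@lebesgue_measure R).-integrable D (EFin \o (fun t => g t / t)).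
  apply: (@eq_Rintegrable _ _ (fun t => c * (bsin mu a t / t))) => //.
    by move=> t _; rewrite mulrA.
  by apply: integrable_scale => //; exact: integrable_bsin_div.
have innerE s : inner s = \int[lebesgue_measure]_(t in D) (expR (- (s * t)) * g t).
  by apply: eq_Rintegral => t /set_mem Dt; rewrite fE.
have [cL eL] := cintegral_laplace mg gK ig z0.
have oE s : D s -> cexp (- (z * s%:C)) *
    (\int[lebesgue_measure]_(t in D) (expR (- (s * t)) * g t))%:C = outer s.
  by move=> _; rewrite /outer innerE.
split.
- move=> s s0; apply: eq_Rintegrable (integrable_laplace mg gK s0) => // t Dt.
  by rewrite fE.
- exact: cintegrable_eq mD oE cL.
- rewrite stieltjesP -(cintegral_eq oE) eL; congr (_ * _); apply: cintegral_eq => t Dt.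
  by rewrite /stieltjes fE.
Qed.
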